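(* There exists $d_0>0$ such that for every $0<d<d_0$ $$\partial^2F(d,v_0)[\varphi]>0\qquad\text{for every }\varphi\in\widetilde H^1_\#(Q)\setminus\{0\}.$$
   Context: Setting. Let $N\ge2$, write $z=(x,y)\in\mathbb R^{N-1}\times\mathbb R$, let $e_1,\dots,e_N$ be the canonical basis, $\mathbb M^N$ the real $N\times N$ matrices with $A:B=\mathrm{tr}(A^TB)$, $\mathbb M^N_+$ those with positive determinant, and $Q=(0,1)^{N-1}$. For $d>0$ let $\Omega_d=Q\times(0,d)$, $\Omega_d^\#=\mathbb R^{N-1}\times(0,d)$, $\Gamma_d=Q\times\{d\}$ (exterior normal $e_N$). $\mathcal V(\Omega_d)$ is the space of $w\in W^{1,\infty}(\Omega_d^\#;\mathbb R^N)$ with $w(x,0)=0$ and $w(x+e_i,y)=w(x,y)$ for $i=1,\dots,N-1$; $\widetilde{\mathcal V}(\Omega_d)$ is its completion in the norm of $H^1(\Omega_d;\mathbb R^N)$. The boundary datum is $u_0(x,y)=(A[x],0)$ with $A\in\mathbb M^{N-1}_+$. $W:\mathbb M^N_+\to[0,+\infty)$ is of class $C^3$, $W_\xi=DW$, $W_{\xi\xi}=D^2W$. $\psi:\mathbb R^N\to[0,+\infty)$ is of class $C^3$ away from the origin, positively $1$-homogeneous, with $m|z|\le\psi(z)\le M'|z|$ for some $m,M'>0$, and there is $\bar c>0$ with $\nabla^2\psi(v)[w,w]>\bar c|w|^2$ for all $v\in S^{N-1}$ and all nonzero $w\perp v$. Flat configuration. $(d,v_0)$ is a flat configuration with volume $d$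 if $v_0(z)=M[z]$ for some $M\in\mathbb M^N_+$, $v_0-u_0\in\mathcal V(\Omega_d)$, $W_\xi(\nabla v_0)[e_N]=0$ on $\Gamma_d$, and there is $c_0>0$ such that $\int_{\Omega_d}W_{\xi\xi}(\nabla v_0)\nabla w:\nabla w\,dz\ge c_0\|w\|^2_{H^1(\Omega_d;\mathbb R^N)}$ for all $w\in\widetilde{\mathcal V}(\Omega_d)$. It is assumed that $W$ admits a flat configuration: $v_0(z)=M[z]$ is fixed and $(d,v_0)$ is a flat configuration for every $d>0$. Quadratic form. $\widetilde H^1_\#(Q)$ is the set of $\varphi\in H^1_{loc}(\mathbb R^{N-1})$ that are $1$-periodic in each coordinate direction with $\int_Q\varphi\,dx=0$; such $\varphi$ are identified with functions on $\Gamma_d$. The quadratic form associated with the second variation of the energy $F(h,u)=\int_{\Omega_h}W(\nabla u)\,dz+\int_{\Gamma_h}\psi(\nu_h)\,d\mathcal H^{N-1}$ at the critical pair $(d,v_0)$ is $$\partial^2F(d,v_0)[\varphi]=-\int_{\Omega_d}W_{\xi\xi}(\nabla v_0)\nabla v_\varphi:\nabla v_\varphi\,dz+\int_Q\nabla^2\psi(e_N)[(\nabla\varphi,0),(\nabla\varphi,0)]\,dx$$ (the curvature term and the term $\partial_\nu(W\circ\nabla v_0)$ vanish), where $v_\varphi\in\widetilde{\mathcal V}(\Omega_d)$ is the unique solution of $\int_{\Omega_d}W_{\xi\xi}(\nabla v_0)\nabla v_\varphi:\nabla w\,dz=\int_{\Gamma_d}\mathrm{div}_{\Gamma_d}(\varphi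 W_\xi(\nabla v_0))\cdot w\,d\mathcal H^{N-1}$ for all $w\in\widetilde{\mathcal V}(\Omega_d)$ (row-wise tangential divergence, i.e. $\mathrm{div}_{\Gamma_d}(\varphi W_\xi(\nabla v_0))=W_\xi(\nabla v_0)[(\nabla\varphi,0)]$). *)

(* Defs.v *)
From HB Require Import structures.
From mathcomp Require Import all_boot all_order all_algebra.
From mathcomp Require Import all_classical all_reals all_analysis.

Set Implicit Arguments.
Unset Strict Implicit.
Unset Printing Implicit Defensive.

Import Order.TTheory GRing.Theory Num.Theory.
Import numFieldNormedType.Exports.

Local Open Scope classical_set_scope.
Local Open Scope ring_scope.

(* [\tr (A^T *m B)] is A : B on matrices and the Euclidean product on columns;
   the library norm [`|_|] on matrices is the sup norm. *)
Definition frob (R : realType) m n (A B : 'M[R]_(m, n)) : R := \tr (A^T *m B).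

Definition enorm (R : realType) n (z : 'cV[R]_n) : R := Num.sqrt (frob z z).

(* The point (x, y) of R^k x R as a point of R^(k+1). *)
Definition vsnoc (R : realType) k (x : 'cV[R]_k) (y : R) : 'cV[R]_k.+1 :=
  \col_i oapp (fun j => x j ord0) y (unlift ord_max i).

Definition vinit (R : realType) k (z : 'cV[R]_k.+1) : 'cV[R]_k :=
  \col_i z (lift ord_max i) ord0.

Definition vlast (R : realType) k (z : 'cV[R]_k.+1) : R := z ord_max ord0.

Section lebesgue_cV.
Context {R : realType}.

Section measurable_cV.
Variable n : nat.

(* Generated by the coordinates: the Borel sigma-algebra of R^n. *)
Let coord (i : 'I_n) (z : 'cV[R]_n) : measurableTypeR R := z i ord0.

Let cV_set0 : g_sigma_preimage coord set0.
Proof. exact: sigma_algebra0. Qed.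

Let cV_setC A : g_sigma_preimage coord A -> g_sigma_preimage coord (~` A).
Proof. exact: sigma_algebraC. Qed.

Let cV_bigcup (F : _^nat) : (forall i, g_sigma_preimage coord (F i)) ->
  g_sigma_preimage coord (\bigcup_i F i).
Proof. exact: sigma_algebra_bigcup. Qed.

HB.instance Definition _ := @isMeasurable.Build default_measure_display
  'cV[R]_n (g_sigma_preimage coord) cV_set0 cV_setC cV_bigcup.

Lemma measurable_cVP d (T : measurableType d) (f : T -> 'cV[R]_n) :
  (forall i, measurable_fun setT (fun t => f t i ord0)) ->
  measurable_fun setT f.
Proof.
move=> mf.
suff fS : (g_sigma_preimage coord `<=` [set A | measurable (f @^-1` A)]).
  by move=> _ A mA; rewrite setTI; exact: fS.
apply: smallest_sub.
  split => /=.
  - by rewrite preimage_set0.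
  - by move=> A mA; rewrite setTD -preimage_setC; exact: measurableC.
  - by move=> F mF; rewrite preimage_bigcup; exact: bigcupT_measurable.
rewrite -bigcup_seq => A [i _ [B mB <-]] /=.
rewrite setTI -comp_preimage; have := mf i measurableT B mB.
by rewrite setTI.
Qed.

End measurable_cV.

Definition vpair k (p : 'cV[R]_k * measurableTypeR R) : 'cV[R]_k.+1 :=
  vsnoc p.1 p.2.

Lemma measurable_vpair k : measurable_fun setT (@vpair k).
Proof.
apply: measurable_cVP => i; rewrite /vpair /vsnoc.
case: (unliftP ord_max i) => [j ->|->].
  rewrite (_ : (fun _ => _) = (fun z : 'cV[R]_k => z j ord0) \o fst); last first.
    by apply/funext => p; rewrite mxE liftK.
  apply: measurableT_comp => // _ B mB; rewrite setTI.
  apply: sub_sigma_algebra; rewrite -bigcup_seq /=.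
  by exists j; [rewrite /= mem_index_enum|exists B => //; rewrite setTI].
rewrite (_ : (fun _ => _) = snd) //.
by apply/funext => p; rewrite mxE unlift_none.
Qed.

Section leb_succ.
Variables (k : nat) (m : {measure set 'cV[R]_k -> \bar R}).

Definition leb_succ : set 'cV[R]_k.+1 -> \bar R :=
  pushforward (m \x @lebesgue_measure R)%E (@vpair k).

Let mpre A : measurable A -> measurable (@vpair k @^-1` A).
Proof.
by move=> mA; rewrite -[X in measurable X]setTI; exact: measurable_vpair.
Qed.

Let leb_succ0 : leb_succ set0 = 0%E.
Proof. by rewrite /leb_succ /pushforward preimage_set0 measure0. Qed.

Let leb_succ_ge0 A : (0 <= leb_succ A)%E.
Proof. by rewrite /leb_succ /pushforward measure_ge0. Qed.

Let leb_succ_sigma_additive : semi_sigma_additive leb_succ.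
Proof.
move=> F mF tF mUF; rewrite /leb_succ /pushforward preimage_bigcup.
apply: measure_semi_sigma_additive.
- by move=> i; exact: mpre.
- apply/trivIsetP => i j _ _ ij; rewrite -preimage_setI.
  by move/trivIsetP : tF => /(_ _ _ _ _ ij) ->//; rewrite preimage_set0.
- by rewrite -preimage_bigcup; exact: mpre.
Qed.

HB.instance Definition _ := isMeasure.Build _ _ _ leb_succ
  leb_succ0 leb_succ_ge0 leb_succ_sigma_additive.

End leb_succ.

(* Lebesgue measure on R^n: the image of the n-fold product of the Lebesgue
   measure on R under the identification of R^k x R with R^(k+1). *)
Fixpoint leb (n : nat) : {measure set 'cV[R]_n -> \bar R} :=
  match n with
  | 0 => dirac (0 : 'cV[R]_0)
  | k.+1 => leb_succ (leb k)
  end.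

End lebesgue_cV.

Section calculus.
Context {R : realType} {V : normedModType R}.

Fixpoint Ck (k : nat) (U : set V) (f : V -> R) : Prop :=
  match k with
  | 0 => forall x, U x -> {for x, continuous f}
  | j.+1 => (forall x, U x -> differentiable f x) /\
            (forall v, Ck j U ('D_v f))
  end.

(* For W on matrices, [D2 W X B C] is W_xixi(X) B : C. *)
Definition D2 (f : V -> R) (x u v : V) : R := 'D_u ('D_v f) x.

End calculus.

Definition gradmx {R : realType} m n (f : 'M[R]_(m, n) -> R)
    (X : 'M[R]_(m, n)) : 'M[R]_(m, n) :=
  \matrix_(i, j) 'D_(delta_mx i j) f X.

Section sobolev.
Context {R : realType} {n : nat}.
Implicit Types (U K : set 'cV[R]_n) (f eta : 'cV[R]_n -> R).

Definition loc_integrable U f : Prop :=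
  measurable_fun U f /\
  forall K, compact K -> K `<=` U -> (leb n).-integrable K (EFin \o f).

(* Weak derivatives are tested against C^1 functions with compact support in
   U; for locally integrable functions this amounts to testing against
   smooth ones. *)
Definition test_function U eta : Prop :=
  Ck 1 setT eta /\
  exists K, [/\ compact K, K `<=` U & forall z, ~ K z -> eta z = 0].

Definition is_weak_grad U f (G : 'cV[R]_n -> 'cV[R]_n) : Prop :=
  [/\ loc_integrable U f,
      forall j, loc_integrable U (fun z => G z j ord0) &
      forall eta, test_function U eta -> forall j : 'I_n,
        \int[leb n]_(z in U) (f z * 'D_(delta_mx j ord0) eta z) =
        - \int[leb n]_(z in U) (G z j ord0 * eta z)].

Definition weakly_differentiable U f : Prop := exists G, is_weak_grad U f G.

(* Determined almost everywhere in U when f is weakly differentiable. *)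
Definition weak_grad U f : 'cV[R]_n -> 'cV[R]_n :=
  xget (fun=> 0) [set G | is_weak_grad U f G].

Context {m : nat}.
Implicit Types w : 'cV[R]_n -> 'cV[R]_m.

Definition weakly_differentiable_vec U w : Prop :=
  forall i, weakly_differentiable U (fun z => w z i ord0).

Definition weak_jac U w (z : 'cV[R]_n) : 'M[R]_(m, n) :=
  \matrix_(i, j) weak_grad U (fun y => w y i ord0) z j ord0.

Definition ess_bounded p q U (F : 'cV[R]_n -> 'M[R]_(p, q)) : Prop :=
  exists C : R, \forall z \ae leb n, U z -> frob (F z) (F z) <= C.

Definition W1infty U w : Prop :=
  [/\ weakly_differentiable_vec U w, ess_bounded U w &
      ess_bounded U (weak_jac U w)].

Definition sqnormL2 U w : \bar R :=
  (\int[leb n]_(z in U) (frob (w z) (w z))%:E)%E.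

Definition sqnormH1 U w : \bar R :=
  (\int[leb n]_(z in U)
     (frob (w z) (w z) + frob (weak_jac U w z) (weak_jac U w z))%:E)%E.

Definition H1 U w : Prop :=
  weakly_differentiable_vec U w /\ (sqnormH1 U w < +oo)%E.

Definition H1loc f : Prop :=
  weakly_differentiable setT f /\
  forall K, compact K ->
    (\int[leb n]_(z in K)
       (f z ^+ 2 + frob (weak_grad setT f z) (weak_grad setT f z))%:E < +oo)%E.

End sobolev.

Section setting.
Context {R : realType} {k : nat}.
Notation N := k.+1.
Implicit Types (d : R) (w v : 'cV[R]_N -> 'cV[R]_N) (phi : 'cV[R]_k -> R).

Definition cubeQ : set 'cV[R]_k := [set x | forall i, 0 < x i ord0 < 1].

Definition Omega d : set 'cV[R]_N :=
  [set z | cubeQ (vinit z) /\ 0 < vlast z < d].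

Definition strip d : set 'cV[R]_N := [set z | 0 < vlast z < d].

Definition closed_strip d : set 'cV[R]_N := [set z | 0 <= vlast z <= d].

(* An element of W^{1,oo} of the strip is represented by the function that is
   continuous up to the boundary. *)
Definition calV d w : Prop :=
  [/\ W1infty (strip d) w,
      {within closed_strip d, continuous w},
      (forall x, w (vsnoc x 0) = 0) &
      (forall (i : 'I_k) x y, 0 <= y <= d ->
         w (vsnoc (x + delta_mx i ord0) y) = w (vsnoc x y))].

(* The completion of [calV d] is realized as its closure in H^1(Omega_d). *)
Definition calVt d w : Prop :=
  H1 (Omega d) w /\
  exists2 u : nat -> 'cV[R]_N -> 'cV[R]_N, (forall i, calV d (u i)) &
    sqnormH1 (Omega d) (u i \- w) @[i --> \oo] --> 0%E.

(* The trace on Gamma_d, as a function on Q: the continuous extension to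
   [calVt d] of the restriction map on [calV d]. *)
Definition is_trace d w (T : 'cV[R]_k -> 'cV[R]_N) : Prop :=
  measurable_fun cubeQ T /\
  exists u : nat -> 'cV[R]_N -> 'cV[R]_N,
    [/\ forall i, calV d (u i),
        sqnormH1 (Omega d) (u i \- w) @[i --> \oo] --> 0%E &
        sqnormL2 cubeQ (fun x => u i (vsnoc x d) - T x) @[i --> \oo] --> 0%E].

Definition trace d w : 'cV[R]_k -> 'cV[R]_N :=
  xget (fun=> 0) [set T | is_trace d w T].

Variables (A : 'M[R]_k) (W : 'M[R]_N -> R) (psi : 'cV[R]_N -> R).

Definition u0 (z : 'cV[R]_N) : 'cV[R]_N := vsnoc (A *m vinit z) 0.

Definition eN : 'cV[R]_N := delta_mx ord_max ord0.

(* The integral of W_xixi(M) Dv : Dw, the constant M being Dv_0. *)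
Definition hessW_form d (M : 'M[R]_N) v w : R :=
  \int[leb N]_(z in Omega d)
     D2 W M (weak_jac (Omega d) v z) (weak_jac (Omega d) w z).

(* (d, v_0) is a flat configuration, with v_0(z) = M z. *)
Definition flat_configuration d (M : 'M[R]_N) : Prop :=
  [/\ 0 < \det M,
      calV d (fun z => M *m z - u0 z),
      gradmx W M *m eN = 0 &
      exists2 c0 : R, 0 < c0 & forall w, calVt d w ->
        (c0%:E * sqnormH1 (Omega d) w <= (hessW_form d M w w)%:E)%E].

Definition H1per phi : Prop :=
  [/\ H1loc phi,
      forall i : 'I_k, \forall x \ae leb k, phi (x + delta_mx i ord0) = phi x &
      \int[leb k]_(x in cubeQ) phi x = 0].

(* The vector (grad phi, 0). *)
Definition tgrad phi (x : 'cV[R]_k) : 'cV[R]_N :=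
  vsnoc (weak_grad setT phi x) 0.

(* Gamma_d is flat: its surface measure is Lebesgue measure on Q, and the
   tangential divergence of phi W_xi(M) is W_xi(M)[(grad phi, 0)]. *)
Definition is_vphi d (M : 'M[R]_N) phi v : Prop :=
  calVt d v /\
  forall w, calVt d w ->
    hessW_form d M v w =
    \int[leb k]_(x in cubeQ) frob (gradmx W M *m tgrad phi x) (trace d w x).

(* The solution, determined almost everywhere in Omega_d; it exists by the
   coercivity condition of a flat configuration (Lax-Milgram), so the default
   value is never selected for phi in [H1per]. *)
Definition vphi d (M : 'M[R]_N) phi : 'cV[R]_N -> 'cV[R]_N :=
  xget (fun=> 0) [set v | is_vphi d M phi v].

(* The curvature of Gamma_d and the normal derivative of W(Dv_0) vanish, hence
   so do the corresponding terms of the general second variation. *)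
Definition second_variation d (M : 'M[R]_N) phi : R :=
  - hessW_form d M (vphi d M phi) (vphi d M phi) +
  \int[leb k]_(x in cubeQ) D2 psi eN (tgrad phi x) (tgrad phi x).

End setting.

(* Main.v *)
Require Import Defs.
From HB Require Import structures.
From mathcomp Require Import all_boot all_order all_algebra.
From mathcomp Require Import all_classical all_reals all_analysis.
From mathcomp Require Import measurable_realfun.
From mathcomp Require Import ring lra.

Set Implicit Arguments.
Unset Strict Implicit.
Unset Printing Implicit Defensive.

Import Order.TTheory GRing.Theory Num.Theory.
Import numFieldNormedType.Exports.

Local Open Scope classical_set_scope.
Local Open Scope ring_scope.

(** A thin film is stable because the elastic part of the second variation is
    of the order of the thickness, while the surface part does not depend on
    it.

    Let F denote the elastic form [hessW_form] and c0 the coercivity constant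
    of the flat configuration of thickness 1. For d < 1, a function of calV d
    translated upwards by 1 - d and extended by zero below belongs to calV 1
    and has the same energy. Hence c0 |Du|^2 <= F(u, u) with a constant that
    does not depend on d ([coercivity_thin]; here and below, squared norms are
    L^2 norms). As u vanishes on the bottom, its value on the top is the
    integral of its vertical derivative over a segment of length d, so that
    |u(., d)|^2 <= d |Du|^2 ([trace_inequality]). Together,
    |u(., d)|^2 <= (d / c0) F(u, u), and this bound passes to the completion of
    calV d ([trace_bound]).

    The solution v of the equation of v_phi, tested with itself, satisfies
    F(v, v) = int g . v(., d) with g = W_xi(M)[(grad phi, 0)]. Young's
    inequality and the trace bound give F(v, v) <= (d / c0) |g|^2, which is at
    most C d |grad phi|^2 ([elastic_energy_bound]). Ellipticity of psi bounds
    the surface term from below by cbar |grad phi|^2 ([surface_energy_bound]).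
    A periodic function of mean zero whose gradient vanishes on Q is zero
    ([zero_gradient]), so the second variation is positive as soon as
    C d < cbar.

    The facts about weak derivatives behind the extension and the trace both
    come from Green's formula on a strip ([green_strip]), obtained by cutting
    test functions off near the two faces. That a vanishing gradient forces a
    function to be constant on the cube is read off from the integrals over
    boxes: test functions that are primitives in one coordinate show that the
    average over a box does not change when the box is stretched across the
    cube in that coordinate ([widen_transfer]). *)

(** * Lebesgue measure on R^n *)

Section lebesgue_Rn.
Context {R : realType}.
Notation mu1 := (@lebesgue_measure R).

Lemma measurable_coord n (i : 'I_n) :
  measurable_fun setT (fun z : 'cV[R]_n => z i ord0).
Proof.
move=> _ B mB; rewrite setTI; apply: sub_sigma_algebra; rewrite -bigcup_seq /=.
by exists i; [rewrite /= mem_index_enum|exists B => //; rewrite setTI].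
Qed.

Lemma measurable_vsnoc k (x : 'cV[R]_k) :
  measurable_fun setT (fun y : measurableTypeR R => vsnoc x y).
Proof.
apply: measurable_cVP => i; rewrite /vsnoc.
case: (unliftP ord_max i) => [j ->|->].
  by under eq_fun do rewrite mxE liftK; exact: measurable_cst.
by under eq_fun do rewrite mxE unlift_none; exact: measurable_id.
Qed.

Definition box n (A : 'I_n -> set R) : set 'cV[R]_n :=
  [set z | forall i, A i (z i ord0)].

Lemma measurable_box n (A : 'I_n -> set R) :
  (forall i, measurable (A i)) -> measurable (box A).
Proof.
move=> mA.
rewrite (_ : box A = \big[setI/setT]_(i < n)
    ((fun z : 'cV[R]_n => z i ord0) @^-1` (A i))).
  apply: bigsetI_measurable => i _.
  by rewrite -[X in measurable X]setTI; exact: measurable_coord.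
rewrite -bigcap_seq; apply/seteqP; split => z /= Az i; first by move=> _; exact: Az.
by apply: Az; rewrite /= mem_index_enum.
Qed.

Lemma vsnoc_lift k (x : 'cV[R]_k) y j :
  vsnoc x y (lift ord_max j) ord0 = x j ord0.
Proof. by rewrite mxE liftK. Qed.

Lemma vsnoc_max k (x : 'cV[R]_k) y : vsnoc x y ord_max ord0 = y.
Proof. by rewrite mxE unlift_none. Qed.

Lemma vsnocK k (z : 'cV[R]_k.+1) : vsnoc (vinit z) (vlast z) = z.
Proof.
apply/colP => i; case: (unliftP ord_max i) => [j ->|->].
  by rewrite vsnoc_lift mxE.
by rewrite vsnoc_max.
Qed.

Lemma vinit_vsnoc k (x : 'cV[R]_k) y : vinit (vsnoc x y) = x.
Proof. by apply/colP => i; rewrite mxE vsnoc_lift. Qed.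

Lemma vlast_vsnoc k (x : 'cV[R]_k) y : vlast (vsnoc x y) = y.
Proof. exact: vsnoc_max. Qed.

Lemma vsnocD k (x x' : 'cV[R]_k) y y' :
  vsnoc x y + vsnoc x' y' = vsnoc (x + x') (y + y').
Proof.
apply/colP => i; rewrite mxE; case: (unliftP ord_max i) => [j ->|->].
  by rewrite !vsnoc_lift mxE.
by rewrite !vsnoc_max.
Qed.

Lemma vpair_box k (A : 'I_k.+1 -> set R) :
  @vpair R k @^-1` box A = box (fun j => A (lift ord_max j)) `*` A ord_max.
Proof.
apply/seteqP; split => -[x y] /=.
  move=> Axy; split => [j|] /=.
    by have := Axy (lift ord_max j); rewrite /vpair vsnoc_lift.
  by have := Axy ord_max; rewrite /vpair vsnoc_max.
move=> [Ax Ay] i; rewrite /vpair; case: (unliftP ord_max i) => [j ->|->].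
  by rewrite vsnoc_lift; exact: Ax.
by rewrite vsnoc_max.
Qed.

Lemma leb_box n (A : 'I_n -> set R) : (forall i, measurable (A i)) ->
  leb n (box A) = (\big[*%E/1%E]_(i < n) mu1 (A i))%E.
Proof.
elim: n A => [|n ih] A mA.
  rewrite big_ord0 /= diracE mem_set//.
  by move=> [].
transitivity ((leb n \x mu1)%E (@vpair R n @^-1` box A)) => //.
rewrite vpair_box product_measure1E//; last 2 first.
- by apply: measurable_box => i; exact: mA.
- exact: mA.
rewrite big_ord_recr /= ih//; congr (_ * _)%E.
apply: eq_bigr => i _; congr (mu1 (A _)); apply: val_inj => /=.
by rewrite /bump leqNgt ltn_ord.
Qed.

Lemma coord_le_norm m n (z : 'M[R]_(m, n)) i j : `|z i j| <= `|z|.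
Proof.
rewrite [leRHS]/Num.norm /= mx_normrE.
by apply/bigmax_geP; right => /=; exists (i, j).
Qed.

Definition cube n (r : R) : set 'cV[R]_n := box (fun=> `]- r, r[%classic).

Lemma measurable_cube n r : measurable (@cube n r).
Proof. by apply: measurable_box => i; exact: measurable_itv. Qed.

Lemma norm_cube n (z : 'cV[R]_n) r : `|z| < r -> cube r z.
Proof.
move=> zr i; rewrite /= in_itv /= -ltr_norml.
by rewrite (le_lt_trans _ zr)// coord_le_norm.
Qed.

Lemma leb_bounded_box n (a b : 'I_n -> R) :
  (leb n (box (fun i => `]a i, b i[%classic)) < +oo)%E.
Proof.
rewrite leb_box//.
suff : (\big[*%E/1%E]_(i < n) mu1 `]a i, b i[%classic)%E \is a fin_num.
  by move=> /fin_numPlt /andP[].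
elim/big_ind : _ => // [x y|i _]; first exact: fin_numM.
by rewrite lebesgue_measure_itv /=; case: ifPn.
Qed.

Lemma leb_cube_fin n r : (leb n (cube r) < +oo)%E.
Proof. exact: leb_bounded_box. Qed.

Lemma cubes_cover n : \bigcup_m (cube m%:R) = [set: 'cV[R]_n].
Proof.
apply/seteqP; split => // z _; exists (Num.bound `|z|) => //.
by apply: norm_cube; exact: archi_boundP.
Qed.

Lemma leb_sigma_finite n : sigma_finite setT (leb n : set 'cV[R]_n -> \bar R).
Proof.
exists (fun m => cube m%:R); first by rewrite cubes_cover.
by move=> m; split; [exact: measurable_cube|exact: leb_cube_fin].
Qed.

(** A copy of the measure that carries the sigma-finite structure demanded by
    Fubini's theorem. *)
Definition leb_sfin n : set 'cV[R]_n -> \bar R := leb n.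

HB.instance Definition _ n := Measure.copy (@leb_sfin n) (leb n).

HB.instance Definition _ n :=
  Measure_isSigmaFinite.Build _ _ _ (@leb_sfin n) (leb_sigma_finite n).

Section fubini.
Variable k : nat.
Local Open Scope ereal_scope.

Lemma ge0_integral_vpair (f : 'cV[R]_k.+1 -> \bar R) :
  measurable_fun setT f -> (forall z, 0 <= f z) ->
  \int[leb k.+1]_z f z = \int[@leb_sfin k \x mu1]_p f (vpair p).
Proof.
move=> mf f0.
by rewrite [LHS](ge0_integral_pushforward (@measurable_vpair R k)).
Qed.

Lemma ge0_integral_vsnoc (f : 'cV[R]_k.+1 -> \bar R) :
  measurable_fun setT f -> (forall z, 0 <= f z) ->
  \int[leb k.+1]_z f z = \int[leb k]_x \int[mu1]_y f (vsnoc x y).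
Proof.
move=> mf f0; rewrite ge0_integral_vpair// fubini_tonelli1//.
by apply: (measurableT_comp mf); exact: measurable_vpair.
Qed.

Lemma measurable_integral_vsnoc (f : 'cV[R]_k.+1 -> \bar R) :
  measurable_fun setT f -> (forall z, 0 <= f z) ->
  measurable_fun setT (fun x => \int[mu1]_y f (vsnoc x y)).
Proof.
move=> mf f0; apply: (@measurable_fun_fubini_tonelli_F _ _ _ _ _ mu1 (f \o @vpair R k));
  last by move=> p; exact: f0.
by apply: (measurableT_comp mf); exact: measurable_vpair.
Qed.

Lemma integrable_vpair (f : 'cV[R]_k.+1 -> \bar R) :
  (leb k.+1).-integrable setT f ->
  (@leb_sfin k \x mu1).-integrable setT (f \o @vpair R k).
Proof.
move=> /integrableP[mf iffin]; apply/integrableP; split.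
  by apply: (measurableT_comp mf); exact: measurable_vpair.
by rewrite -(ge0_integral_vpair (f := fun z => `|f z|))//; exact: measurableT_comp.
Qed.

Lemma integral_vsnoc (f : 'cV[R]_k.+1 -> \bar R) :
  (leb k.+1).-integrable setT f ->
  \int[leb k.+1]_z f z = \int[leb k]_x \int[mu1]_y f (vsnoc x y).
Proof.
move=> intf; have intf' := integrable_vpair intf.
rewrite [LHS](integral_pushforward (@measurable_vpair R k) _ intf') //.
  by rewrite preimage_setT -integral12_prod_meas1.
exact: (measurable_int _ intf).
Qed.

Lemma integrable_integral_vsnoc (f : 'cV[R]_k.+1 -> \bar R) :
  (leb k.+1).-integrable setT f ->
  (leb k).-integrable setT (fun x => \int[mu1]_y f (vsnoc x y)).
Proof. by move=> /integrable_vpair /integrable_fubini_F. Qed.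

Lemma ae_integrable_vsnoc (f : 'cV[R]_k.+1 -> \bar R) :
  (leb k.+1).-integrable setT f ->
  {ae leb k, forall x, mu1.-integrable setT (fun y => f (vsnoc x y))}.
Proof. by move=> /integrable_vpair /ae_integrable1. Qed.

End fubini.

Section translation.
Local Open Scope ereal_scope.

Lemma measurable_shift n (v : 'cV[R]_n) :
  measurable_fun setT (fun z : 'cV[R]_n => (z + v)%R).
Proof.
apply: measurable_cVP => i.
rewrite (_ : (fun _ => _) = (fun z : 'cV[R]_n => z i ord0 + v i ord0)%R).
  by apply: measurable_funD => //; exact: measurable_coord.
by apply/funext => z; rewrite mxE.
Qed.

(** Lebesgue measure on the line is characterized by its values on half-open
    intervals, and these are translation invariant. *)
Lemma ge0_integral_shift1 (c : R) (f : R -> \bar R) :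
  measurable_fun setT f -> (forall y, 0 <= f y) ->
  \int[mu1]_y f (y + c)%R = \int[mu1]_y f y.
Proof.
move=> mf f0.
have mc : measurable_fun setT (fun y : measurableTypeR R => (y + c)%R : measurableTypeR R).
  by apply: measurable_funD.
transitivity (\int[pushforward mu1 (fun y => (y + c)%R : measurableTypeR R)]_y f y).
  by rewrite (ge0_integral_pushforward mc).
apply: eq_measure_integral => A mA _; apply/esym.
apply: lebesgue_measure_unique => // _ [[a b] _ <-] /=.
rewrite /pushforward (_ : _ @^-1` _ = `](a - c)%R, (b - c)%R]%classic).
  rewrite !lebesgue_measure_itv /= !lte_fin ltrD2r; case: ifP => // _.
  by rewrite -!EFinB; congr (_%:E); ring.
by apply/seteqP; split => y /=; rewrite !in_itv /= ltrBlDr lerBrDr.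
Qed.

(** One coordinate at a time: Tonelli's theorem splits off the last one. *)
Lemma ge0_integral_shift n (v : 'cV[R]_n) (f : 'cV[R]_n -> \bar R) :
  measurable_fun setT f -> (forall z, 0 <= f z) ->
  \int[leb n]_z f (z + v)%R = \int[leb n]_z f z.
Proof.
elim: n v f => [|n ih] v f mf f0.
  by apply: eq_integral => z _; congr f; apply/colP => -[].
rewrite ge0_integral_vsnoc; last 2 first.
- by apply: (measurableT_comp mf); exact: measurable_shift.
- by move=> z; exact: f0.
rewrite (ge0_integral_vsnoc mf f0).
transitivity (\int[leb n]_x \int[mu1]_y f (vsnoc (x + vinit v)%R y)).
  apply: eq_integral => x _.
  rewrite -[RHS](ge0_integral_shift1 (vlast v)) //.
    by apply: eq_integral => y _; rewrite -vsnocD vsnocK.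
  apply: (measurableT_comp mf).
  exact: measurable_vsnoc.
rewrite (ih (vinit v) (fun x => \int[mu1]_y f (vsnoc x y)))//.
  exact: measurable_integral_vsnoc.
by move=> x; exact: integral_ge0.
Qed.

Lemma integral_shift n (v : 'cV[R]_n) (f : 'cV[R]_n -> \bar R) :
  measurable_fun setT f ->
  \int[leb n]_z f (z + v)%R = \int[leb n]_z f z.
Proof.
move=> mf; rewrite integralE [RHS]integralE; congr (_ - _).
  have := ge0_integral_shift v (measurable_funepos mf).
  move=> /(_ (fun z => funepos_ge0 f z)) <-.
  by apply: eq_integral => z _; rewrite !funeposE.
have := ge0_integral_shift v (measurable_funeneg mf).
move=> /(_ (fun z => funeneg_ge0 f z)) <-.
by apply: eq_integral => z _; rewrite !funenegE.
Qed.

Lemma integral_shift_set n (v : 'cV[R]_n) (D : set 'cV[R]_n) (f : 'cV[R]_n -> \bar R) :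
  measurable D -> measurable_fun D f ->
  \int[leb n]_(z in [set z | D (z + v)%R]) f (z + v)%R = \int[leb n]_(z in D) f z.
Proof.
move=> mD mf; rewrite integral_mkcond [RHS]integral_mkcond.
have mfD : measurable_fun setT (f \_ D) by exact/(measurable_restrictT _ mD).
rewrite -[RHS](integral_shift v mfD).
by apply: eq_integral => z _; rewrite /patch; congr (if _ then _ else _).
Qed.

Lemma measurable_preshift n (v : 'cV[R]_n) (D : set 'cV[R]_n) :
  measurable D -> measurable [set z | D (z + v)%R].
Proof.
by move=> mD; have := measurable_shift v measurableT mD; rewrite setTI.
Qed.

Lemma leb_shift n (v : 'cV[R]_n) (D : set 'cV[R]_n) :
  measurable D -> leb n [set z | D (z + v)%R] = leb n D.
Proof.
move=> mD; have := @integral_shift_set n v D (cst 1) mD (measurable_cst _).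
by rewrite !integral_cst// ?mul1e//; exact: measurable_preshift.
Qed.

Lemma ae_shift n (v : 'cV[R]_n) (P : 'cV[R]_n -> Prop) :
  (\forall z \ae leb n, P z) -> \forall z \ae leb n, P (z + v)%R.
Proof.
move=> [N [mN N0 PN]]; exists [set z | N (z + v)%R]; split.
- exact: measurable_preshift.
- by rewrite -N0; exact: leb_shift.
- by move=> z /= Pz; exact: PN.
Qed.

End translation.

Lemma leb_hyperplane n (i : 'I_n) (c : R) :
  leb n [set z : 'cV[R]_n | z i ord0 = c] = 0%E.
Proof.
rewrite (_ : [set _ | _] = box (fun j => if j == i then [set c] else setT)).
  rewrite leb_box; last by move=> j; case: ifP.
  by rewrite (bigD1 i)//= eqxx lebesgue_measure_set1 mul0e.
apply/seteqP; split => z /= zi.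
  by move=> j; case: eqP => //= ->.
by have := zi i; rewrite /= eqxx.
Qed.

Definition obox n (a b : 'I_n -> R) := box (fun i => `]a i, b i[%classic).
Definition cbox n (a b : 'I_n -> R) := box (fun i => `[a i, b i]%classic).

Definition rat_low n (p : 'cV[rat]_n * rat) (i : 'I_n) : R :=
  ratr (p.1 i ord0) - ratr p.2.
Definition rat_up n (p : 'cV[rat]_n * rat) (i : 'I_n) : R :=
  ratr (p.1 i ord0) + ratr p.2.

(** Boxes with rational centre and radius form a countable basis; the closed
    box lies in U as well, so that bumps supported in it are test functions. *)
Lemma open_rat_box n (U : set 'cV[R]_n) z : open U -> U z ->
  exists p, obox (rat_low p) (rat_up p) z /\ cbox (rat_low p) (rat_up p) `<=` U.
Proof.
move=> oU Uz.
have /nbhs_ballP[e /= e0 eU] : nbhs z U by exact: open_nbhs_nbhs.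
have [r r0e] : exists r : rat, 0 < (ratr r : R) < e / 2.
  have [r] := @rat_in_itvoo R 0 (e / 2) ltac:(by rewrite divr_gt0).
  by rewrite in_itv /= => ?; exists r.
have [q qz] : exists q : 'cV[rat]_n, forall i, `|z i ord0 - ratr (q i ord0)| < (ratr r : R).
  have /choice[f fz] : forall i : 'I_n, exists q : rat, `|z i ord0 - ratr q| < (ratr r : R).
    move=> i; have [q] := @rat_in_itvoo R (z i ord0 - ratr r) (z i ord0 + ratr r)
      ltac:(by case/andP: r0e; lra).
    by rewrite in_itv /= => /andP[? ?]; exists q; rewrite ltr_norml; apply/andP; split; lra.
  by exists (\col_i f i) => i; rewrite mxE.
exists (q, r); split.
  move=> i; rewrite /= in_itv /= /rat_low /rat_up /=.
  have := qz i; rewrite ltr_norml => /andP[? ?].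
  by apply/andP; split; lra.
move=> z' Bz'; apply: eU; split => // i j; rewrite (ord1 j) /ball /=.
have := qz i; have := Bz' i; rewrite /= in_itv /= ltr_norml /rat_low /rat_up /=.
move=> /andP[? ?] /andP[? ?].
by case/andP: r0e => ? ?; rewrite ltr_norml; apply/andP; split; lra.
Qed.

Lemma obox_cbox n (a b : 'I_n -> R) : obox a b `<=` cbox a b.
Proof. by move=> z zab i; have := zab i; rewrite /= !in_itv /= => /andP[? ?]; rewrite !ltW. Qed.

Lemma measurable_obox n (a b : 'I_n -> R) : measurable (obox a b).
Proof. by apply: measurable_box => i; exact: measurable_itv. Qed.

(** Rational boxes form a countable basis, so the product sigma-algebra
    contains the open sets. *)
Lemma open_measurable_cV n (U : set 'cV[R]_n) : open U -> measurable U.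
Proof.
move=> oU.
have -> : U = \bigcup_(p in [set p | cbox (rat_low p) (rat_up p) `<=` U])
    obox (rat_low p) (rat_up p).
  apply/seteqP; split => [z Uz|z [p /= + Bz]]; last by apply; exact: obox_cbox.
  by have [p [pz pU]] := open_rat_box oU Uz; exists p.
rewrite bigcup_mkcond; apply: countable_bigcupT_measurable => // p.
by case: ifP => // _; exact: measurable_obox.
Qed.

Lemma closed_measurable_cV n (A : set 'cV[R]_n) : closed A -> measurable A.
Proof. by move/closed_openC/open_measurable_cV/measurableC; rewrite setCK. Qed.

Lemma compact_measurable_cV n (A : set 'cV[R]_n) : compact A -> measurable A.
Proof.
by move/compact_closed => /(_ (@norm_hausdorff _ _)); exact: closed_measurable_cV.
Qed.

Lemma within_continuous_measurable_cV n (D : set 'cV[R]_n) (f : 'cV[R]_n -> R) :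
  measurable D -> {within D, continuous f} -> measurable_fun D f.
Proof.
move=> mD /continuousP cf; apply: (measurability _ (RGenOpens.measurableE R)).
move=> _ [_ [a [b ->] <-]].
have /open_subspaceP[V oV VD] : open (f @^-1` `]a, b[ : set (subspace D)).
  by apply: cf; exact: interval_open.
by rewrite setIC -VD; apply: measurableI => //; exact: open_measurable_cV.
Qed.

Lemma continuous_measurable_cV n (f : 'cV[R]_n -> R) :
  continuous f -> measurable_fun setT f.
Proof.
by move=> cf; apply: within_continuous_measurable_cV => //; exact: continuous_subspaceT.
Qed.

Lemma closed_box_compact n (a b : 'I_n -> R) :
  compact (cbox a b).
Proof.
rewrite /cbox.
rewrite (_ : box _ = (@trmx R 1 n) @` [set v : 'rV[R]_n | forall i, `[a i, b i]%classic (v ord0 i)]).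
  apply: continuous_compact; last first.
    apply: (@rV_compact _ _ (fun i => `[a i, b i]%classic)) => i.
    exact: segment_compact.
  apply: continuous_subspaceT => v B /nbhs_ballP[e /= e0 eB].
  apply/nbhs_ballP; exists e => //= w [_ vw]; apply: eB; split => // i j.
  by rewrite !mxE; exact: vw.
apply/seteqP; split => [z Az|_ [v Av <-]]; last by move=> i; rewrite mxE; exact: Av.
by exists z^T; [move=> i; rewrite mxE; exact: Az|rewrite trmxK].
Qed.

Lemma compact_sub_cube n (K : set 'cV[R]_n) : compact K ->
  exists2 r, 0 < r & K `<=` cube r.
Proof.
move=> /compact_bounded[M [_ KM]]; exists (`|M| + 2); first by rewrite ltr_wpDl.
move=> z Kz; apply: norm_cube.
apply: (@le_lt_trans _ _ (`|M| + 1)); last by rewrite ltrD2l ltr1n.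
by apply: KM => //; rewrite (le_lt_trans (ler_norm _))// ltrDl.
Qed.

Lemma leb_compact_fin n (K : set 'cV[R]_n) : compact K -> (leb n K < +oo)%E.
Proof.
move=> cK; have [r r0 Kr] := compact_sub_cube cK.
apply: le_lt_trans (leb_cube_fin n r); apply: le_measure => //; rewrite inE.
  exact: compact_measurable_cV.
exact: measurable_cube.
Qed.

End lebesgue_Rn.

(** * Test functions of class C^1 *)

Lemma continuous_mul {R : realType} {T : topologicalType} (f g : T -> R) :
  continuous f -> continuous g -> continuous (fun z => f z * g z).
Proof. by move=> cf cg z; exact: (cvgM (cf z) (cg z)). Qed.

Lemma continuous_add {R : realType} {T : topologicalType} (f g : T -> R) :
  continuous f -> continuous g -> continuous (fun z => f z + g z).
Proof. by move=> cf cg z; exact: (cvgD (cf z) (cg z)). Qed.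

Section continuously_differentiable.
Context {R : realType} {V : normedModType R}.

Definition C1 (f : V -> R) : Prop := Ck 1 setT f.

Lemma C1_differentiable (f : V -> R) x : C1 f -> differentiable f x.
Proof. by move=> [df _]; exact: df. Qed.

Lemma C1_derivable (f : V -> R) x v : C1 f -> derivable f x v.
Proof. by move=> cf; apply: diff_derivable; exact: C1_differentiable. Qed.

Lemma C1_continuous (f : V -> R) : C1 f -> continuous f.
Proof. by move=> cf x; apply: differentiable_continuous; exact: C1_differentiable. Qed.

Lemma C1_derive_continuous (f : V -> R) v : C1 f -> continuous ('D_v f).
Proof. by move=> [_ cdf] x; exact: cdf. Qed.

Lemma C1P (f : V -> R) : (forall x, differentiable f x) ->
  (forall v, continuous ('D_v f)) -> C1 f.
Proof. by move=> df cdf; split=> [x _|v x _]; [exact: df|exact: cdf]. Qed.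

Lemma C1_cst (c : R) : C1 (cst c).
Proof.
apply: C1P => [x|v]; first exact: differentiable_cst.
rewrite (_ : 'D_v (cst c) = cst 0); first exact: cst_continuous.
by apply/funext => x; rewrite derive_cst.
Qed.

Lemma C1_deriveM (f g : V -> R) v x : C1 f -> C1 g ->
  'D_v (f \* g) x = f x * 'D_v g x + g x * 'D_v f x.
Proof. by move=> cf cg; rewrite deriveM//; exact: C1_derivable. Qed.

Lemma C1M (f g : V -> R) : C1 f -> C1 g -> C1 (f \* g).
Proof.
move=> cf cg; apply: C1P => [x|v].
  by apply: differentiableM; exact: C1_differentiable.
rewrite (_ : 'D_v _ = (f \* 'D_v g) \+ (g \* 'D_v f)); last first.
  by apply/funext => x; exact: C1_deriveM.
by move=> x; apply: cvgD; apply: cvgM;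
  first [exact: C1_continuous|exact: C1_derive_continuous].
Qed.

Lemma C1_prod (I : Type) (s : seq I) (P : pred I) (F : I -> V -> R) :
  (forall i, C1 (F i)) -> C1 (fun x => \prod_(i <- s | P i) F i x).
Proof.
move=> cF; elim: s => [|i s ih].
  by under eq_fun do rewrite big_nil; exact: C1_cst.
under eq_fun do rewrite big_cons.
by case: (P i) => //; exact: C1M.
Qed.

End continuously_differentiable.

Section coordinate.
Context {R : realType}.

Lemma derive_coord_comp n (g : R -> R) (i : 'I_n) (v z : 'cV[R]_n) :
  (forall t, derivable g t 1) ->
  'D_v (fun z : 'cV[R]_n => g (z i ord0)) z = v i ord0 * 'D_1 g (z i ord0).
Proof.
move=> dg.
transitivity ('D_(v i ord0) g (z i ord0)).
  rewrite /derive (_ : (fun h => _) = (fun h => h^-1 *: ((g \o shift (z i ord0)) (h *: v i ord0) - g (z i ord0)))) //.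
  by apply/funext => h /=; rewrite !mxE.
have dgz : differentiable g (z i ord0) by exact/derivable1_diffP.
rewrite !deriveE// -[v i ord0 in LHS]mulr1.
by rewrite [_ * 1](_ : _ = v i ord0 *: 1)// linearZ.
Qed.

Lemma C1_coord n (g : R -> R) (i : 'I_n) :
  (forall t, derivable g t 1) -> continuous ('D_1 g) ->
  C1 (fun z : 'cV[R]_n => g (z i ord0)).
Proof.
move=> dg cg; apply: C1P => [z|v].
  apply: (@differentiable_comp _ _ _ _ (fun z : 'cV[R]_n => z i ord0) g).
    exact: differentiable_coord.
  exact/derivable1_diffP.
rewrite (_ : 'D_v _ = fun z => v i ord0 * 'D_1 g (z i ord0)); last first.
  by apply/funext => z; exact: derive_coord_comp.
have cgi : continuous (fun z : 'cV[R]_n => 'D_1 g (z i ord0)).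
  move=> z; apply: (continuous_comp (f := fun z : 'cV[R]_n => z i ord0) (g := 'D_1 g)).
    exact: coord_continuous.
  exact: cg.
exact: (continuous_mul (f := cst (v i ord0)) (@cst_continuous _ _ _) cgi).
Qed.

End coordinate.

Section primitive.
Context {R : realType}.
Notation mu1 := (@lebesgue_measure R).

Definition prim (f : R -> R) (t : R) : R := \int[mu1]_(s in `]-oo, t]) f s.

Variables (a b : R) (f : R -> R).
Hypothesis cf : continuous f.
Hypothesis f_out : forall t, ~~ (a < t < b) -> f t = 0.

Lemma restrict_supp (D : set R) : (forall t, a < t < b -> D t) -> f \_ D = f.
Proof.
move=> abD; apply/funext => t; rewrite /patch; case: ifPn => // /negP tD.
by rewrite f_out//; apply/negP => tab; apply: tD; rewrite inE; exact: abD.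
Qed.

Lemma integrable_supp : mu1.-integrable setT (EFin \o f).
Proof.
rewrite -(@restrict_supp `[a, b]); last first.
  by move=> t /andP[? ?]; rewrite /= in_itv /=; apply/andP; split; exact: ltW.
rewrite -restrict_EFin.
have h : mu1.-integrable `[a, b]%classic (EFin \o f).
  apply: continuous_compact_integrable; first exact: segment_compact.
  exact: continuous_subspaceT.
by move/integrable_mkcond : h; apply.
Qed.

Lemma derivable_prim t : derivable (prim f) t 1 /\ 'D_1 (prim f) t = f t.
Proof.
rewrite -derive1E; apply: (@continuous_FTC1 _ f -oo%O t (t + 1)).
- by rewrite ltrDl.
- by apply: integrableS integrable_supp.
- by rewrite /Order.lt /=.
- exact: cf.
Qed.

Lemma derive_prim : 'D_1 (prim f) = f.
Proof. by apply/funext => t; case: (derivable_prim t). Qed.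

Lemma prim_left t : t <= a -> prim f t = 0.
Proof.
move=> ta; rewrite /prim /Rintegral integral0_eq// => s.
rewrite /= in_itv /= => st; rewrite f_out//; apply/negP => /andP[+ _].
by rewrite ltNge (le_trans st ta).
Qed.

Lemma prim_right t : b <= t -> prim f t = \int[mu1]_s f s.
Proof.
move=> bt; rewrite /prim Rintegral_mkcond restrict_supp// => s /andP[_ sb].
by rewrite /= in_itv /= ltW// (lt_le_trans sb).
Qed.

End primitive.

Section step.
Context {R : realType}.
Notation mu1 := (@lebesgue_measure R).
Variables (a b : R).
Hypothesis ab : a < b.

(** Product of the positive parts of t - a and b - t, up to a factor 4. *)
Definition tent (t : R) : R := (t - a + `|t - a|) * (b - t + `|b - t|).

Lemma continuous_tent : continuous tent.
Proof.
have cpos (g : R -> R) : continuous g -> continuous (fun t => g t + `|g t|).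
  move=> cg t; apply: cvgD; first exact: cg.
  by apply: cvg_norm; exact: cg.
have c1 : continuous (fun t => t - a + `|t - a|).
  by apply: (cpos (fun t => t - a)) => s; apply: cvgB; [exact: cvg_id|exact: cvg_cst].
have c2 : continuous (fun t => b - t + `|b - t|).
  by apply: (cpos (fun t => b - t)) => s; apply: cvgB; [exact: cvg_cst|exact: cvg_id].
by move=> t; apply: cvgM; [exact: c1|exact: c2].
Qed.

Lemma tent_ge0 t : 0 <= tent t.
Proof.
have pos x : 0 <= x + `|x| :> R by have := ler_norm (- x); rewrite normrN; lra.
by rewrite /tent mulr_ge0.
Qed.

Lemma tent_gt0 t : a < t < b -> 0 < tent t.
Proof.
move=> /andP[? ?]; rewrite /tent !gtr0_norm ?subr_gt0//.
by rewrite mulr_gt0// addr_gt0// subr_gt0.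
Qed.

Lemma tent_out t : ~~ (a < t < b) -> tent t = 0.
Proof.
rewrite negb_and -!leNgt => /orP[ta|bt]; rewrite /tent.
  by rewrite (ler0_norm (x := t - a)) ?subr_le0// subrr mul0r.
by rewrite (ler0_norm (x := b - t)) ?subr_le0// subrr mulr0.
Qed.

Let m := \int[mu1]_s tent s.

(** The mass is the increment over [a, b] of a primitive whose derivative is
    positive inside. *)
Lemma tent_mass_gt0 : 0 < m.
Proof.
rewrite /m -(prim_right tent_out (lexx b)) -(prim_left tent_out (lexx a)).
have dT := derivable_prim continuous_tent tent_out.
apply: (gtr0_derive1_lt_cc (a := a) (b := b)) => //.
- by move=> x _; case: (dT x).
- move=> x; rewrite in_itv /= derive1E => xab.
  by have [_ ->] := dT x; exact: tent_gt0.
- apply: continuous_subspaceT => x.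
  by apply: differentiable_continuous; apply/derivable1_diffP; case: (dT x).
- by rewrite in_itv /= lexx ltW.
- by rewrite in_itv /= lexx ltW.
Qed.

Definition step_density (t : R) : R := tent t / m.

(** A C^1 step, rising from 0 to 1 over [a, b]. *)
Definition step (t : R) : R := prim step_density t.

Lemma continuous_step_density : continuous step_density.
Proof. by move=> t; apply: cvgMr_tmp; exact: continuous_tent. Qed.

Lemma step_density_ge0 t : 0 <= step_density t.
Proof. by rewrite divr_ge0 ?tent_ge0// ltW// tent_mass_gt0. Qed.

Lemma step_density_out t : ~~ (a < t < b) -> step_density t = 0.
Proof. by move=> tab; rewrite /step_density tent_out// mul0r. Qed.

Lemma integrable_step_density : mu1.-integrable setT (EFin \o step_density).
Proof. exact: integrable_supp continuous_step_density step_density_out. Qed.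

Lemma step_density_mass : \int[mu1]_s step_density s = 1.
Proof.
rewrite /step_density RintegralZr//; last first.
  exact: integrable_supp continuous_tent tent_out.
by rewrite divff// gt_eqF// tent_mass_gt0.
Qed.

Lemma derivable_step t : derivable step t 1.
Proof. by case: (derivable_prim continuous_step_density step_density_out t). Qed.

Lemma derive_step : 'D_1 step = step_density.
Proof. exact: derive_prim continuous_step_density step_density_out. Qed.

Lemma step_left t : t <= a -> step t = 0.
Proof. by move=> ta; rewrite /step (prim_left step_density_out). Qed.

Lemma step_right t : b <= t -> step t = 1.
Proof. by move=> bt; rewrite /step (prim_right step_density_out)// step_density_mass. Qed.

Lemma step_ge0 t : 0 <= step t.
Proof. by apply: Rintegral_ge0 => s _; exact: step_density_ge0. Qed.

Lemma step_le1 t : step t <= 1.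
Proof.
rewrite -step_density_mass /step /prim Rintegral_mkcond.
apply: le_Rintegral => //.
- rewrite -restrict_EFin.
  have h : mu1.-integrable `]-oo, t]%classic (EFin \o step_density).
    exact: integrableS integrable_step_density.
  by move/integrable_mkcond : h; apply.
- exact: integrable_step_density.
- by move=> s _; rewrite /patch; case: ifP => // _; exact: step_density_ge0.
Qed.

End step.

Section plateau.
Context {R : realType}.

(** C^1, valued in [0, 1], supported in [a, b], and equal to 1 on
    [a + e, b - e] with e = 1 / (n + 1), as soon as this interval is nonempty. *)
Definition plateau (a b : R) (n : nat) (t : R) : R :=
  step a (a + n.+1%:R^-1) t * (1 - step (b - n.+1%:R^-1) b t).

Variables (a b : R).
Let e_gt0 n : 0 < n.+1%:R^-1 :> R. Proof. by rewrite invr_gt0. Qed.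
Let alt n : a < a + n.+1%:R^-1. Proof. by rewrite ltrDl. Qed.
Let blt n : b - n.+1%:R^-1 < b. Proof. by rewrite ltrBlDr ltrDl. Qed.

Lemma plateau_ge0 n t : 0 <= plateau a b n t.
Proof. by rewrite mulr_ge0 ?step_ge0// subr_ge0 step_le1. Qed.

Lemma plateau_le1 n t : plateau a b n t <= 1.
Proof.
rewrite -[leRHS]mulr1 ler_pM ?step_ge0 ?subr_ge0 ?step_le1//.
by rewrite gerBl step_ge0.
Qed.

Lemma plateau_out n t : ~~ (a < t < b) -> plateau a b n t = 0.
Proof.
rewrite negb_and -!leNgt /plateau => /orP[ta|bt].
  by rewrite step_left// mul0r.
by rewrite (step_right (blt n))// subrr mulr0.
Qed.

Lemma derivable_plateau n t : derivable (plateau a b n) t 1.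
Proof.
apply: derivableM; first exact: derivable_step.
by apply: derivableB; [exact: derivable_cst|exact: derivable_step].
Qed.

Lemma continuous_derivable (f : R -> R) : (forall t, derivable f t 1) -> continuous f.
Proof.
by move=> df t; apply: differentiable_continuous; apply/derivable1_diffP.
Qed.

Lemma continuous_plateau n : continuous (plateau a b n).
Proof. by apply: continuous_derivable => t; exact: derivable_plateau. Qed.

Lemma continuous_derive_plateau n : continuous ('D_1 (plateau a b n)).
Proof.
rewrite (_ : 'D_1 (plateau a b n) = fun t =>
  step a (a + n.+1%:R^-1) t * - step_density (b - n.+1%:R^-1) b t +
  (1 - step (b - n.+1%:R^-1) b t) * step_density a (a + n.+1%:R^-1) t).
  have c1 : continuous (step a (a + n.+1%:R^-1)).
    by apply: continuous_derivable => t; exact: derivable_step.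
  have c2 : continuous (step (b - n.+1%:R^-1) b).
    by apply: continuous_derivable => t; exact: derivable_step.
  apply: continuous_add; apply: continuous_mul.
  - exact: c1.
  - by move=> t; apply: cvgN; exact: continuous_step_density.
  - by move=> t; apply: cvgB; [exact: cvg_cst|exact: c2].
  - exact: continuous_step_density.
apply/funext => t; rewrite /plateau deriveM; last 2 first.
- exact: derivable_step.
- by apply: derivableB; [exact: derivable_cst|exact: derivable_step].
rewrite deriveB; [|exact: derivable_cst|exact: derivable_step].
rewrite derive_cst sub0r; congr (_ * - _ + _ * _).
  exact: (congr1 (fun f => f t) (derive_step (b - n.+1%:R^-1) b)).
exact: (congr1 (fun f => f t) (derive_step a (a + n.+1%:R^-1))).
Qed.

Lemma plateau_cvg t : a < t < b -> \forall n \near \oo, plateau a b n t = 1.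
Proof.
move=> /andP[at_ tb].
pose d := Num.min (t - a) (b - t).
have d0 : 0 < d by rewrite lt_min !subr_gt0 at_.
near=> n.
have : n.+1%:R^-1 < d.
  rewrite invf_plt ?posrE//; apply: (@lt_le_trans _ _ n%:R); last by rewrite ler_nat.
  by near: n; exact: nbhs_infty_gtr.
rewrite lt_min => /andP[? ?].
have ta : a + n.+1%:R^-1 <= t by rewrite addrC -lerBrDr ltW.
have tb' : t <= b - n.+1%:R^-1 by rewrite lerBrDr addrC -lerBrDr ltW.
by rewrite /plateau step_right// step_left// subr0 mulr1.
Unshelve. all: by end_near. Qed.

Lemma plateau_cvg_indic t : plateau a b n t @[n --> \oo] --> (\1_(`]a, b[%classic) t : R).
Proof.
rewrite indicE; have [tab|tab] := boolP (t \in _).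
  rewrite inE /= in_itv /= in tab.
  apply: cvg_near_cst; exact: plateau_cvg.
rewrite (_ : (fun n => _) = cst 0); first exact: cvg_cst.
apply/funext => n; apply: plateau_out; apply/negP => tab'.
by move/negP : tab; apply; rewrite inE /= in_itv.
Qed.

End plateau.

Lemma cvg_bigprod {R : realType} (I : Type) (s : seq I) (u : I -> nat -> R) (l : I -> R) :
  (forall i, u i m @[m --> \oo] --> l i) ->
  (\prod_(i <- s) u i m) @[m --> \oo] --> \prod_(i <- s) l i.
Proof.
move=> ul; elim: s => [|i s ih].
  by under eq_fun do rewrite big_nil; rewrite big_nil; exact: cvg_cst.
under eq_fun do rewrite big_cons; rewrite big_cons.
exact: (cvgM (ul i) ih).
Qed.

Section box_bump.
Context {R : realType} {n : nat}.
Variables (a b : 'I_n -> R).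

(** The C^1 test functions that approximate the indicator of a box from
    below. *)
Definition box_bump (m : nat) (z : 'cV[R]_n) : R := \prod_(i < n) plateau (a i) (b i) m (z i ord0).

Lemma box_bump_C1 m : C1 (box_bump m).
Proof.
apply: C1_prod => i; apply: C1_coord; first exact: derivable_plateau.
exact: continuous_derive_plateau.
Qed.

Lemma box_bump_ge0 m z : 0 <= box_bump m z.
Proof. by apply: prodr_ge0 => i _; exact: plateau_ge0. Qed.

Lemma box_bump_le1 m z : box_bump m z <= 1.
Proof. by apply: prodr_ile1 => i _; rewrite plateau_ge0 plateau_le1. Qed.

Lemma box_bump_out m z : ~ obox a b z -> box_bump m z = 0.
Proof.
move=> /existsNP[i] /=; rewrite in_itv /= => /negP zi.
by rewrite /box_bump (bigD1 i)//= plateau_out// mul0r.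
Qed.

Lemma box_bump_cvg z :
  box_bump m z @[m --> \oo] --> (\1_(obox a b) z : R).
Proof.
rewrite (_ : \1__ z = \prod_(i < n) (\1_(`]a i, b i[%classic) (z i ord0) : R)).
  by apply: cvg_bigprod => i; exact: plateau_cvg_indic.
rewrite indicE; case: (boolP (z \in _)) => zB.
  by rewrite big1// => i _; rewrite indicE mem_set//; move/set_mem : zB; exact.
have /existsNP[i zi] : ~ obox a b z by move=> zB'; move/negP : zB; apply; rewrite inE.
by rewrite (bigD1 i)//= indicE memNset// mul0r.
Qed.

Lemma measurable_C1 (f : 'cV[R]_n -> R) : C1 f -> measurable_fun setT f.
Proof. by move=> cf; apply: continuous_measurable_cV; exact: C1_continuous. Qed.

Lemma test_function_box_bump (U : set 'cV[R]_n) m :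
  cbox a b `<=` U -> test_function U (box_bump m).
Proof.
move=> BU; split; first exact: box_bump_C1.
exists (cbox a b); split => //; first exact: closed_box_compact.
move=> z zB; apply: box_bump_out => zB'; apply: zB => i; have := zB' i.
by rewrite /= !in_itv /= => /andP[? ?]; rewrite !ltW.
Qed.

End box_bump.

(** * Weak gradients *)

Section real_integrals.
Context d (T : measurableType d) (R : realType) (mu : {measure set T -> \bar R}).
Variables (D : set T) (mD : measurable D).
Implicit Types f g : T -> R.

Lemma EFin_Rintegral f : mu.-integrable D (EFin \o f) ->
  (\int[mu]_(x in D) (f x)%:E)%E = (\int[mu]_(x in D) f x)%:E.
Proof. by move=> intf; rewrite /Rintegral fineK//; exact: integrable_fin_num. Qed.

Lemma ae_le_integrable f g : measurable_fun D f ->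
  (\forall x \ae mu, D x -> `|f x| <= g x) ->
  mu.-integrable D (EFin \o g) -> mu.-integrable D (EFin \o f).
Proof.
move=> mf fg /integrableP[mg gfin]; apply/integrableP; split; first exact/measurable_EFinP.
apply: le_lt_trans gfin; apply: ae_ge0_le_integral => //.
- by apply: measurableT_comp => //; exact/measurable_EFinP.
- by apply: measurableT_comp.
- apply: filterS fg => x fgx Dx; rewrite lee_fin.
  by rewrite (le_trans (fgx Dx))// ler_norm.
Qed.

Lemma ae_bounded_integrable f (C : R) : (mu D < +oo)%E -> measurable_fun D f ->
  (\forall x \ae mu, D x -> `|f x| <= C) -> mu.-integrable D (EFin \o f).
Proof.
move=> Dfin mf fC; apply: (ae_le_integrable (g := cst C)) => //.
apply: measurable_bounded_integrable => //.
by exists `|C|; split=> [|M CM x _ /=]; [exact: num_real|exact: ltW].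
Qed.

Lemma integrable_scale f (c : R) : mu.-integrable D (EFin \o f) ->
  mu.-integrable D (EFin \o (fun x => c * f x)).
Proof. by move=> intf; have := integrableZl mD c intf; apply: eq_integrable. Qed.

Lemma ae_eq_Rintegral f g : measurable_fun D f -> measurable_fun D g ->
  (\forall x \ae mu, D x -> f x = g x) ->
  \int[mu]_(x in D) f x = \int[mu]_(x in D) g x.
Proof.
move=> mf mg fg; rewrite /Rintegral; congr fine; apply: ae_eq_integral => //.
- exact/measurable_EFinP.
- exact/measurable_EFinP.
- by apply: filterS fg => x fgx Dx; rewrite fgx.
Qed.

Lemma Rdominated_cvg (u : nat -> T -> R) f g :
  (forall n, measurable_fun D (u n)) ->
  (forall x, D x -> u n x @[n --> \oo] --> f x) ->
  mu.-integrable D (EFin \o g) ->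
  (forall n x, D x -> `|u n x| <= g x) ->
  (\int[mu]_(x in D) u n x) @[n --> \oo] --> \int[mu]_(x in D) f x.
Proof.
move=> mu_ uf ig ug.
have mf : measurable_fun D f by exact: measurable_fun_cvg mu_ uf.
have [intf _ cvgint] := @dominated_convergence _ _ _ mu D mD
  (fun n x => (u n x)%:E) (EFin \o f) (EFin \o g)
  ltac:(by move=> n; exact/measurable_EFinP) ltac:(exact/measurable_EFinP)
  ltac:(by apply: aeW => x Dx; apply: cvg_EFin; [exact: nearW|exact: uf])
  ig ltac:(by apply: aeW => x n Dx; rewrite /= lee_fin; exact: ug).
apply: fine_cvg; rewrite fineK; last exact: integrable_fin_num.
exact: cvgint.
Qed.

Lemma Rintegral_supp (E : set T) f : E `<=` D -> (forall x, D x -> ~ E x -> f x = 0) ->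
  \int[mu]_(x in E) f x = \int[mu]_(x in D) f x.
Proof.
move=> ED fE; rewrite Rintegral_mkcond [RHS]Rintegral_mkcond; congr Rintegral.
apply/funext => x; rewrite /patch; case: (boolP (x \in E)) => xE.
  by rewrite ifT//; apply/mem_set/ED/set_mem.
case: ifP => // xD; rewrite fE//; first exact/set_mem.
by move/mem_set; exact/negP.
Qed.

Lemma integrable_supp_set (E : set T) f : measurable E -> E `<=` D ->
  (forall x, D x -> ~ E x -> f x = 0) ->
  mu.-integrable E (EFin \o f) -> mu.-integrable D (EFin \o f).
Proof.
move=> mE ED fE /integrable_mkcond => /(_ mE) intf; apply/integrable_mkcond => //.
rewrite (_ : _ \_ D = (EFin \o f) \_ E)//; apply/funext => x; rewrite /patch.
case: (boolP (x \in E)) => xE.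
  by rewrite ifT//; apply/mem_set/ED/set_mem.
case: ifP => // xD; rewrite /= fE//; first exact/set_mem.
by move/mem_set; exact/negP.
Qed.

End real_integrals.

Lemma ae_forall_count d (X : measurableType d) (R : realType)
    (mu : {measure set X -> \bar R}) (I : countType) (P : I -> X -> Prop) :
  (forall i, \forall x \ae mu, P i x) -> \forall x \ae mu, forall i, P i x.
Proof.
move=> aeP.
have /ae_foralln : forall n, \forall x \ae mu, (if unpickle n is Some i then P i x else True).
  by move=> n; case: (unpickle n) => [i|]; [exact: aeP|exact: aeW].
by apply: filterS => x Px i; have := Px (pickle i); rewrite pickleK.
Qed.

Section boxes.
Context {R : realType} {n : nat}.
Implicit Types (a b : 'I_n -> R) (f : 'cV[R]_n -> R).

Definition oboxes : set (set 'cV[R]_n) := [set B | exists a b, B = obox a b].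

Lemma oboxI a b a' b' : obox a b `&` obox a' b' =
  obox (fun i => Num.max (a i) (a' i)) (fun i => Num.min (b i) (b' i)).
Proof.
apply/seteqP; split => [z [zB zB'] i|z zB].
  have := zB i; have := zB' i.
  by rewrite /= !in_itv /= gt_max lt_min => /andP[-> ->] /andP[-> ->].
by split => i; have := zB i; rewrite /= !in_itv /= gt_max lt_min => /andP[/andP[? ?] /andP[? ?]]; apply/andP.
Qed.

Lemma measurable_generated_oboxes :
  (measurable : set (set 'cV[R]_n)) = <<s oboxes >>.
Proof.
apply/seteqP; split; last first.
  apply: smallest_sub; first exact: sigma_algebra_measurable.
  by move=> _ [a [b ->]]; exact: measurable_obox.
apply: smallest_sub; first exact: smallest_sigma_algebra.
move=> A; rewrite -bigcup_seq /= => -[i _ [B mB <-]].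
suff : (measurable : set (set (measurableTypeR R))) `<=`
    image_set_system setT (fun z : 'cV[R]_n => z i ord0) <<s oboxes >> by exact.
rewrite (RGenOpens.measurableE R); apply: smallest_sub.
  by apply: sigma_algebra_image; exact: smallest_sigma_algebra.
move=> _ [x [y ->]]; rewrite /image_set_system /= setTI.
rewrite (_ : _ @^-1` _ = \bigcup_m obox (fun j => if j == i then x else - m%:R)
    (fun j => if j == i then y else m%:R)).
  apply: sigma_algebra_bigcup => m; apply: sub_sigma_algebra.
  by exists (fun j => if j == i then x else - m%:R), (fun j => if j == i then y else m%:R).
apply/seteqP; split => [z zxy|z [m _ zm]]; last first.
  by have := zm i; rewrite /= eqxx.
exists (Num.bound `|z|) => // j /=; case: eqP => [->//|_].
by have := norm_cube (archi_boundP (normr_ge0 z)) j.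
Qed.

(** Boxes form a pi-system that generates the sigma-algebra, so by Dynkin's
    lemma f has integral zero on every measurable subset of the box. *)
Lemma ae_zero_boxes a b f : (leb n).-integrable (obox a b) (EFin \o f) ->
  (forall a' b', (forall i, a i <= a' i) -> (forall i, b' i <= b i) ->
    \int[leb n]_(z in obox a' b') f z = 0) ->
  \forall z \ae leb n, obox a b z -> f z = 0.
Proof.
set D := obox a b => intf f0.
have mD : measurable D by exact: measurable_obox.
have intfE E : measurable E -> (leb n).-integrable (D `&` E) (EFin \o f).
  move=> mE; apply: integrableS intf => //; first exact: measurableI.
have zE E : measurable E -> (\int[leb n]_(z in D `&` E) (f z)%:E)%E = 0%E.
  rewrite measurable_generated_oboxes.
  apply: (@dynkin_induction _ _ oboxes (fun E => (\int[leb n]_(z in D `&` E) (f z)%:E)%E = 0%E)).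
  - exact: measurable_generated_oboxes.
  - move=> _ _ [a1 [b1 ->]] [a2 [b2 ->]]; rewrite oboxI.
    by exists (fun i => Num.max (a1 i) (a2 i)), (fun i => Num.min (b1 i) (b2 i)).
  - by rewrite setIT EFin_Rintegral// f0.
  - move=> _ [a1 [b1 ->]].
    have := intfE _ (measurable_obox a1 b1).
    rewrite oboxI => /(EFin_Rintegral (measurable_obox _ _)) ->.
    by rewrite f0// => i; [rewrite le_max lexx|rewrite ge_min lexx].
  - move=> S mS S0.
    have : (\int[leb n]_(z in D) (f z)%:E =
        \int[leb n]_(z in D `&` S) (f z)%:E + \int[leb n]_(z in D `&` ~` S) (f z)%:E)%E.
      rewrite -integral_setU_EFin//.
      + by rewrite -setIUr setUv setIT.
      + exact: measurableI.
      + by apply: measurableI => //; exact: measurableC.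
      + rewrite -setIUr setUv setIT; apply/measurable_EFinP.
        exact: (measurable_int _ intf).
      + by apply/disj_setPS; rewrite setIACA setICr setI0.
    by rewrite S0 add0e => <-; rewrite EFin_Rintegral// f0.
  - move=> F mF tF F0; rewrite setI_bigcupr integral_bigcup//.
    + by apply: eseries0 => i _ _; exact: F0.
    + by apply: trivIset_setIl.
    + by move=> m; exact: measurableI.
    + by rewrite -setI_bigcupr; apply: intfE; exact: bigcup_measurable.
have aef : ae_eq (leb n) D (EFin \o f) (cst 0%E).
  apply: (integral_ae_eq mD intf (measurable_cst _)) => E ED mE.
  by rewrite integral0 -(zE E mE) (setIidr ED).
by apply: filterS aef => z fz Dz; have [] := fz Dz.
Qed.

End boxes.

Section weak_gradients.
Context {R : realType} {n : nat}.
Implicit Types (U : set 'cV[R]_n) (f eta : 'cV[R]_n -> R).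

Lemma derive_out (K : set 'cV[R]_n) eta v z : closed K -> (forall z, ~ K z -> eta z = 0) ->
  ~ K z -> 'D_v eta z = 0.
Proof.
move=> cK etaK Kz; rewrite (@near_eq_derive _ _ _ eta (cst 0)).
  by rewrite derive_cst.
have : nbhs z (~` K) by apply: open_nbhs_nbhs; split=> //; exact: closed_openC.
by apply: filterS => z'; exact: etaK.
Qed.

(** What an integral against a locally integrable function needs of the other
    factor; both a test function and its derivatives qualify. *)
Definition compact_factor U (g : 'cV[R]_n -> R) : Prop :=
  continuous g /\ exists K, [/\ compact K, K `<=` U & forall z, ~ K z -> g z = 0].

Lemma test_factor U eta : test_function U eta -> compact_factor U eta.
Proof. by move=> [ceta K]; split; [exact: C1_continuous|]. Qed.

Lemma test_derive_factor U eta v : test_function U eta -> compact_factor U ('D_v eta).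
Proof.
move=> [ceta [K [cK KU etaK]]]; split; first exact: C1_derive_continuous.
exists K; split => // z; apply: derive_out etaK.
exact: compact_closed (@norm_hausdorff _ _) cK.
Qed.

Lemma test_function_sub U U' eta : U `<=` U' -> test_function U eta -> test_function U' eta.
Proof. by move=> UU' [ceta [K [cK KU gK]]]; split=> //; exists K; split => //; exact: subset_trans UU'. Qed.

Lemma continuous_bounded_compact (K : set 'cV[R]_n) (g : 'cV[R]_n -> R) : compact K ->
  {within K, continuous g} -> exists2 C : R, 0 <= C & forall z, K z -> `|g z| <= C.
Proof.
move=> cK cg; have /compact_bounded[M [_ KM]] := continuous_compact cg cK.
exists (`|M| + 1); first by rewrite addr_ge0.
move=> z Kz; apply: KM; last by exists z.
by rewrite (le_lt_trans (ler_norm _))// ltrDl.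
Qed.

Lemma compact_factor_bounded U g : compact_factor U g ->
  exists2 C : R, 0 <= C & forall z, `|g z| <= C.
Proof.
move=> [cg [K [cK _ gK]]].
have [C C0 KC] := continuous_bounded_compact cK (continuous_subspaceT cg).
exists C => // z; have [Kz|/gK ->] := pselect (K z); first exact: KC.
by rewrite normr0.
Qed.

Lemma integrable_mul_factor U f g : measurable U -> loc_integrable U f ->
  compact_factor U g -> (leb n).-integrable U (EFin \o (fun z => f z * g z)).
Proof.
move=> mU [mf intf] fg; have [C C0 gC] := compact_factor_bounded fg.
case: fg => cg [K [cK KU gK]]; have mK := compact_measurable_cV cK.
apply: (integrable_supp_set mU mK KU) => [z Uz /gK ->|]; first by rewrite mulr0.
have intfK := intf K cK KU.
apply: (ae_le_integrable mK (g := fun z => C * `|f z|)).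
- apply: measurable_funM; first exact: measurable_funS mf.
  by apply: measurable_funTS; exact: continuous_measurable_cV.
- by apply: aeW => z Kz; rewrite normrM mulrC ler_wpM2r.
- have := integrableZl mK C (integrable_norm intfK).
  by apply: eq_integrable.
Qed.

Lemma box_bump_integral_cvg U f a b : open U -> loc_integrable U f -> cbox a b `<=` U ->
  (\int[leb n]_(z in U) (f z * box_bump a b m z)) @[m --> \oo] -->
    \int[leb n]_(z in obox a b) f z.
Proof.
move=> oU [mf intf] abU; have mU := open_measurable_cV oU.
have mK := compact_measurable_cV (@closed_box_compact R n a b).
have intK := intf _ (@closed_box_compact R n a b) abU.
rewrite (_ : \int[leb n]_(z in obox a b) f z = \int[leb n]_(z in cbox a b) (f z * \1_(obox a b) z)).
  rewrite (_ : (fun m => _) = (fun m => \int[leb n]_(z in cbox a b) (f z * box_bump a b m z))).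
    apply: (Rdominated_cvg mK (g := fun z => `|f z|)).
    - move=> m; apply: measurable_funM; first exact: measurable_funS mf.
      by apply: measurable_funTS; apply: measurable_C1; exact: box_bump_C1.
    - by move=> z _; apply: cvgM; [exact: cvg_cst|exact: box_bump_cvg].
    - exact: integrable_norm.
    - move=> m z _; rewrite normrM ler_piMr// ger0_norm ?box_bump_ge0//.
      exact: box_bump_le1.
  apply/funext => m; apply/esym/Rintegral_supp => // z Uz zab.
  by rewrite box_bump_out ?mulr0// => /obox_cbox.
rewrite Rintegral_mkcond [RHS]Rintegral_mkcond; congr Rintegral; apply/funext => z.
rewrite /patch indicE; case: (boolP (z \in obox a b)) => zab.
  by rewrite mulr1 ifT//; apply/mem_set/obox_cbox/set_mem.
by rewrite mulr0; case: ifP.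
Qed.

(** On a box whose closure lies in U the bumps tend to the indicator, so the
    function has integral zero on all smaller boxes and vanishes there by
    ae_zero_boxes; countably many rational boxes exhaust U. *)
Lemma fundamental_lemma U f : open U -> loc_integrable U f ->
  (forall a b m, cbox a b `<=` U -> \int[leb n]_(z in U) (f z * box_bump a b m z) = 0) ->
  \forall z \ae leb n, U z -> f z = 0.
Proof.
move=> oU lf f0; have [mf intf] := lf.
have box0 a b : cbox a b `<=` U -> \int[leb n]_(z in obox a b) f z = 0.
  move=> abU; apply: (cvg_unique _ (box_bump_integral_cvg oU lf abU)) => //.
  rewrite /= (_ : (fun m => _) = cst 0); first exact: cvg_cst.
  by apply/funext => m; exact: f0.
have aeB (p : 'cV[rat]_n * rat) : \forall z \ae leb n,
    cbox (rat_low p) (rat_up p) `<=` U -> obox (rat_low p) (rat_up p) z -> f z = 0 :> R.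
  have [pU|npU] := pselect (cbox (@rat_low R n p) (rat_up p) `<=` U); last by apply: aeW => z /npU.
  apply: filterS (_ : \forall z \ae leb n, obox (rat_low p) (rat_up p) z -> f z = 0) => [z h _ //|].
  apply: ae_zero_boxes.
    apply: integrableS (intf _ (@closed_box_compact R n _ _) pU).
    - exact: compact_measurable_cV (@closed_box_compact R n _ _).
    - exact: measurable_obox.
    - exact: obox_cbox.
  move=> a b pa bp; apply: box0; apply: subset_trans pU => z zab i.
  have := zab i; rewrite /= !in_itv /= => /andP[az zb].
  by rewrite (le_trans (pa i))// (le_trans zb).
have := ae_forall_count aeB; apply: filterS => z zp Uz.
by have [p [pz pU]] := open_rat_box oU Uz; exact: (zp p pU pz).
Qed.

Lemma loc_integrableB U f g : open U -> loc_integrable U f -> loc_integrable U g ->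
  loc_integrable U (fun z => f z - g z).
Proof.
move=> oU [mf intf] [mg intg]; split; first exact: measurable_funB.
move=> K cK KU; have mK := compact_measurable_cV cK.
by have := integrableB mK (intf K cK KU) (intg K cK KU); apply: eq_integrable.
Qed.

Lemma loc_integrable_sub U V f : open U -> open V -> V `<=` U ->
  loc_integrable U f -> loc_integrable V f.
Proof.
move=> oU oV VU [mf intf]; split; first exact: measurable_funS (open_measurable_cV oU) VU mf.
by move=> K cK KV; apply: intf => //; exact: subset_trans VU.
Qed.

Lemma is_weak_grad_unique U f (G G' : 'cV[R]_n -> 'cV[R]_n) : open U ->
  is_weak_grad U f G -> is_weak_grad U f G' ->
  \forall z \ae leb n, U z -> G z = G' z.
Proof.
move=> oU [_ lG fG] [_ lG' fG']; have mU := open_measurable_cV oU.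
have h j : \forall z \ae leb n, U z -> G z j ord0 - G' z j ord0 = 0.
  apply: (fundamental_lemma oU (loc_integrableB oU (lG j) (lG' j))) => a b m abU.
  have te := test_function_box_bump m abU; have fe := test_factor te.
  under eq_Rintegral do rewrite mulrBl.
  rewrite RintegralB//; [|exact: integrable_mul_factor..].
  have := fG _ te j; rewrite (fG' _ te j) => /oppr_inj ->.
  by rewrite subrr.
have := ae_forall_count h; apply: filterS => z hz Uz; apply/colP => j.
by apply/eqP; rewrite -subr_eq0 (hz j Uz).
Qed.

Lemma is_weak_grad_weak_grad U f : weakly_differentiable U f ->
  is_weak_grad U f (weak_grad U f).
Proof. by move=> [G UfG]; rewrite /weak_grad; case: xgetP => [G' _ //|/(_ G)]. Qed.

Lemma is_weak_grad_sub U V f G : open U -> open V -> V `<=` U ->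
  is_weak_grad U f G -> is_weak_grad V f G.
Proof.
move=> oU oV VU [lf lG fG]; split.
- exact: loc_integrable_sub VU lf.
- by move=> j; exact: loc_integrable_sub VU (lG j).
move=> eta teta j; have := fG _ (test_function_sub VU teta) j.
have [_ [K [cK KV etaK]]] := teta.
have [_ [K' [cK' KV' detaK]]] := test_derive_factor (delta_mx j ord0) teta.
rewrite (Rintegral_supp (leb n) (D := U) (E := V) (f := fun z => f z * _))// => [->|z Uz Vz].
  congr (- _); apply/esym/Rintegral_supp => // z Uz Vz.
  by rewrite etaK ?mulr0// => /KV.
by rewrite detaK ?mulr0// => /KV'.
Qed.

Lemma is_weak_gradB U f f' G G' : open U -> is_weak_grad U f G -> is_weak_grad U f' G' ->
  is_weak_grad U (fun z => f z - f' z) (fun z => G z - G' z).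
Proof.
move=> oU [lf lG fG] [lf' lG' fG']; have mU := open_measurable_cV oU; split.
- exact: loc_integrableB.
- move=> j; rewrite (_ : (fun z => _) = fun z => G z j ord0 - G' z j ord0); first exact: loc_integrableB.
  by apply/funext => z; rewrite !mxE.
move=> eta teta j; have feta := test_factor teta.
have fdeta := test_derive_factor (delta_mx j ord0) teta.
under eq_Rintegral do rewrite mulrBl.
under [in RHS]eq_Rintegral do rewrite !mxE mulrBl.
rewrite !RintegralB//; [|exact: integrable_mul_factor..].
by rewrite (fG _ teta) (fG' _ teta); ring.
Qed.

Lemma loc_integrable0 U : loc_integrable U (fun=> 0).
Proof. by split=> // K cK KU; exact: integrable0. Qed.

Lemma is_weak_grad0 U : is_weak_grad U (fun=> 0) (fun=> 0).
Proof.
split; first exact: loc_integrable0.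
  move=> j; rewrite (_ : (fun z => _) = fun=> 0); first exact: loc_integrable0.
  by apply/funext => z; rewrite mxE.
move=> eta _ j; under eq_Rintegral do rewrite mul0r.
under [in RHS]eq_Rintegral do rewrite mxE mul0r.
by rewrite /Rintegral integral0 oppr0.
Qed.

End weak_gradients.

Section weak_jacobians.
Context {R : realType} {n m : nat}.
Implicit Types (U : set 'cV[R]_n) (w : 'cV[R]_n -> 'cV[R]_m) (J : 'cV[R]_n -> 'M[R]_(m, n)).

Definition is_weak_jac U w J : Prop :=
  forall i, is_weak_grad U (fun z => w z i ord0) (fun z => (row i (J z))^T).

Lemma is_weak_jac_weak_jac U w : weakly_differentiable_vec U w ->
  is_weak_jac U w (weak_jac U w).
Proof.
move=> dw i; have := is_weak_grad_weak_grad (dw i).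
congr (is_weak_grad U _); apply/funext => z; apply/colP => j; by rewrite !mxE.
Qed.

Lemma is_weak_jac_vec U w J : is_weak_jac U w J -> weakly_differentiable_vec U w.
Proof. by move=> wJ i; eexists; exact: wJ. Qed.

Lemma is_weak_jac_unique U w J J' : open U -> is_weak_jac U w J -> is_weak_jac U w J' ->
  \forall z \ae leb n, U z -> J z = J' z.
Proof.
move=> oU wJ wJ'.
have := ae_forall_count (fun i => is_weak_grad_unique oU (wJ i) (wJ' i)).
apply: filterS => z h Uz; apply/row_matrixP => i; apply/trmx_inj; exact: h.
Qed.

Lemma weak_jac_ae U w J : open U -> is_weak_jac U w J ->
  \forall z \ae leb n, U z -> weak_jac U w z = J z.
Proof.
move=> oU wJ; apply: (is_weak_jac_unique oU _ wJ).
exact: is_weak_jac_weak_jac (is_weak_jac_vec wJ).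
Qed.

Lemma is_weak_jac_sub U V w J : open U -> open V -> V `<=` U ->
  is_weak_jac U w J -> is_weak_jac V w J.
Proof. by move=> oU oV VU wJ i; exact: is_weak_grad_sub (wJ i). Qed.

Lemma is_weak_jacB U w w' J J' : open U -> is_weak_jac U w J -> is_weak_jac U w' J' ->
  is_weak_jac U (w \- w') (fun z => J z - J' z).
Proof.
move=> oU wJ wJ' i; have := is_weak_gradB oU (wJ i) (wJ' i).
congr (is_weak_grad U _ _); apply/funext => z; last by apply/colP => j; rewrite !mxE.
by rewrite !mxE.
Qed.

Lemma is_weak_jac0 U : is_weak_jac U (fun=> 0 : 'cV[R]_m) (fun=> 0).
Proof.
move=> i; have := @is_weak_grad0 R n U.
by congr (is_weak_grad U _ _); apply/funext => z; [|apply/colP => j]; rewrite !mxE.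
Qed.

Lemma measurable_weak_jac U w J i j : is_weak_jac U w J ->
  measurable_fun U (fun z => J z i j).
Proof.
move=> /(_ i) [_ /(_ j) [+ _] _].
rewrite (_ : (fun z => _) = (fun z => J z i j))//.
by apply/funext => z; rewrite !mxE.
Qed.

End weak_jacobians.

(** * Cylinders and Green's formula on a strip *)

Section cylinders.
Context {R : realType} {k : nat}.
Notation mu1 := (@lebesgue_measure R).

(** Omega and strip are the cylinders over the cube and over the whole space. *)
Definition cyl (E : set 'cV[R]_k) (I : set R) : set 'cV[R]_k.+1 :=
  [set z | E (vinit z) /\ I (vlast z)].

Lemma continuous_vlast : continuous (@vlast R k).
Proof. by move=> z; exact: coord_continuous. Qed.

Lemma continuous_vinit : continuous (@vinit R k).
Proof.
move=> z B /nbhs_ballP[e /= e0 eB]; apply/nbhs_ballP; exists e => //= z' [_ zz'].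
by apply: eB; split => // i j; rewrite !mxE; exact: zz'.
Qed.

Lemma continuous_vsnoc_last (x : 'cV[R]_k) : continuous (vsnoc x).
Proof.
move=> y B /nbhs_ballP[e /= e0 eB]; apply/nbhs_ballP; exists e => //= y' yy'.
apply: eB; split => // i j; rewrite (ord1 j).
case: (unliftP ord_max i) => [i' ->|->].
  by rewrite !vsnoc_lift; exact: ballxx.
by rewrite !vsnoc_max.
Qed.

Lemma continuous_vsnoc_init (y : R) : continuous (fun x : 'cV[R]_k => vsnoc x y).
Proof.
move=> x B /nbhs_ballP[e /= e0 eB]; apply/nbhs_ballP; exists e => //= x' [_ xx'].
apply: eB; split => // i j; rewrite (ord1 j).
case: (unliftP ord_max i) => [i' ->|->]; first by rewrite !vsnoc_lift; exact: xx'.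
by rewrite !vsnoc_max; exact: ballxx.
Qed.

Lemma open_strip d : open (@strip R k d).
Proof.
rewrite (_ : strip d = @vlast R k @^-1` `]0, d[%classic).
  by apply: open_comp; [move=> z _; exact: continuous_vlast|exact: interval_open].
by apply/seteqP; split => z /=; rewrite in_itv.
Qed.

Lemma closed_closed_strip d : closed (@closed_strip R k d).
Proof.
rewrite (_ : closed_strip d = @vlast R k @^-1` `[0, d]%classic).
  by apply: closed_comp; [move=> z _; exact: continuous_vlast|exact: interval_closed].
by apply/seteqP; split => z /=; rewrite in_itv.
Qed.

Lemma cubeQ_obox : @cubeQ R k = obox (fun=> 0) (fun=> 1).
Proof. by apply/seteqP; split => z zQ i; have := zQ i; rewrite /= in_itv. Qed.

Lemma measurable_cubeQ : measurable (@cubeQ R k).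
Proof. by rewrite cubeQ_obox; exact: measurable_obox. Qed.

Lemma leb_cubeQ_fin : (leb k (@cubeQ R k) < +oo)%E.
Proof. by rewrite cubeQ_obox; exact: leb_bounded_box. Qed.

Lemma open_obox (a b : 'I_k -> R) : open (obox a b).
Proof.
move=> z zab.
pose e := \big[Num.min/1]_(i < k) Num.min (z i ord0 - a i) (b i - z i ord0).
have e0 : 0 < e.
  apply/bigmin_gtP => /=; split => // i _; rewrite lt_min !subr_gt0.
  by have := zab i; rewrite /= in_itv.
apply/nbhs_ballP; exists e => //= z' [_ zz'] i.
have := zz' i ord0; rewrite /ball /= => zz'i.
have : e <= Num.min (z i ord0 - a i) (b i - z i ord0) by exact: bigmin_le_cond.
rewrite le_min => /andP[? ?]; rewrite in_itv /=.
by move: zz'i; rewrite ltr_norml => /andP[? ?]; apply/andP; split; lra.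
Qed.

Lemma open_cubeQ : open (@cubeQ R k).
Proof. by rewrite cubeQ_obox; exact: open_obox. Qed.

Lemma Omega_cyl d : Omega d = cyl cubeQ `]0, d[%classic.
Proof. by apply/seteqP; split => z /=; rewrite /cyl /= in_itv. Qed.

Lemma strip_cyl d : strip d = cyl setT `]0, d[%classic.
Proof. by apply/seteqP; split => z; rewrite /cyl /strip /= in_itv //= => -[]. Qed.

Lemma OmegaE d : Omega d = (@vinit R k @^-1` cubeQ) `&` strip d.
Proof. by []. Qed.

Lemma open_Omega d : open (@Omega R k d).
Proof.
rewrite OmegaE; apply: openI; last exact: open_strip.
by apply: open_comp; [move=> z _; exact: continuous_vinit|exact: open_cubeQ].
Qed.

Lemma measurable_Omega d : measurable (@Omega R k d).
Proof. exact: open_measurable_cV (@open_Omega d). Qed.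

Lemma measurable_strip d : measurable (@strip R k d).
Proof. exact: open_measurable_cV (@open_strip d). Qed.

Lemma Omega_strip d : @Omega R k d `<=` strip d.
Proof. by move=> z []. Qed.

Lemma leb_Omega_fin d : (leb k.+1 (@Omega R k d) < +oo)%E.
Proof.
rewrite (_ : Omega d = obox (fun=> 0) (fun i => oapp (fun=> 1) d (unlift ord_max i))).
  exact: leb_bounded_box.
apply/seteqP; split => [z [zQ zd] i|z zB].
  case: (unliftP ord_max i) => [j ->|->] /=; rewrite in_itv //=.
  by have := zQ j; rewrite mxE.
split => [i|].
  by have := zB (lift ord_max i); rewrite /= liftK /= in_itv mxE.
by have := zB ord_max; rewrite /= unlift_none /= in_itv.
Qed.

Lemma measurable_cyl E I : measurable E -> measurable I -> measurable (cyl E I).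
Proof.
move=> mE mI; apply: measurableI.
  have : measurable_fun setT (@vinit R k).
    apply: measurable_cVP => i.
    rewrite (_ : (fun _ => _) = (fun z : 'cV[R]_k.+1 => z (lift ord_max i) ord0)).
      exact: measurable_coord.
    by apply/funext => z; rewrite mxE.
  by move=> /(_ measurableT _ mE); rewrite setTI.
by have := @measurable_coord R k.+1 ord_max measurableT _ mI; rewrite setTI.
Qed.

Section fubini_real.
Implicit Types F : 'cV[R]_k.+1 -> R.

Lemma integrable_vsnoc_real F : (leb k.+1).-integrable setT (EFin \o F) ->
  (leb k).-integrable setT (EFin \o (fun x => \int[mu1]_y F (vsnoc x y))).
Proof.
move=> intF; have intI := integrable_integral_vsnoc intF.
apply/integrableP; split.
  apply/measurable_EFinP; apply: (measurableT_comp (fine_measurable _)) => //.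
  exact: (measurable_int _ intI).
apply: le_lt_trans (proj2 (integrableP _ _ _ intI)).
apply: ge0_le_integral => //.
- do 2 apply: measurableT_comp => //.
  apply: (measurableT_comp (fine_measurable _)) => //.
  exact: (measurable_int _ intI).
- by apply: measurableT_comp => //; exact: (measurable_int _ intI).
- move=> x _; rewrite /Rintegral /=.
  by case: (integral _ _ _) => [r| |] //=; rewrite ?normr0 ?leey.
Qed.

Lemma Rintegral_vsnoc F : (leb k.+1).-integrable setT (EFin \o F) ->
  \int[leb k.+1]_z F z = \int[leb k]_x \int[mu1]_y F (vsnoc x y).
Proof.
move=> intF; have intI := integrable_integral_vsnoc intF.
rewrite /Rintegral (integral_vsnoc intF); congr fine.
apply: ae_eq_integral => //.
- exact: (measurable_int _ intI).
- exact: (measurable_int _ (integrable_vsnoc_real intF)).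
- have := integrable_ae measurableT intI; apply: filterS => x Ix _.
  by rewrite /= fineK//; exact: Ix.
Qed.

Variables (E : set 'cV[R]_k) (I : set R).
Hypotheses (mE : measurable E) (mI : measurable I).

Lemma patch_cyl F x : (fun y => (F \_ (cyl E I)) (vsnoc x y)) =
  if x \in E then (fun y => F (vsnoc x y)) \_ I else fun=> 0.
Proof.
apply/funext => y; rewrite /patch.
have -> : (vsnoc x y \in cyl E I) = (x \in E) && (y \in I).
  apply/idP/andP => [/set_mem[]|[/set_mem xE /set_mem yI]].
    by rewrite vinit_vsnoc vlast_vsnoc => /mem_set xE /mem_set.
  by apply/mem_set; split; rewrite ?vinit_vsnoc ?vlast_vsnoc.
by case: (x \in E).
Qed.

Lemma patch_cyl_integral F : (fun x => \int[mu1]_y (F \_ (cyl E I)) (vsnoc x y)) =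
  (fun x => \int[mu1]_(y in I) F (vsnoc x y)) \_ E.
Proof.
apply/funext => x; rewrite patch_cyl /patch.
by case: ifP => // _; [rewrite Rintegral_mkcond|rewrite /Rintegral integral0].
Qed.

Lemma integrable_cyl F : (leb k.+1).-integrable (cyl E I) (EFin \o F) ->
  (leb k).-integrable E (EFin \o (fun x => \int[mu1]_(y in I) F (vsnoc x y))).
Proof.
move=> /integrable_mkcond => /(_ (measurable_cyl mE mI)); rewrite restrict_EFin.
move=> /integrable_vsnoc_real; rewrite patch_cyl_integral -restrict_EFin => h.
by apply/integrable_mkcond.
Qed.

Lemma Rintegral_cyl F : (leb k.+1).-integrable (cyl E I) (EFin \o F) ->
  \int[leb k.+1]_(z in cyl E I) F z = \int[leb k]_(x in E) \int[mu1]_(y in I) F (vsnoc x y).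
Proof.
move=> /integrable_mkcond => /(_ (measurable_cyl mE mI)); rewrite restrict_EFin.
move=> intF; rewrite Rintegral_mkcond (Rintegral_vsnoc intF) patch_cyl_integral.
by rewrite -Rintegral_mkcond.
Qed.

Lemma ae_integrable_cyl F : (leb k.+1).-integrable (cyl E I) (EFin \o F) ->
  \forall x \ae leb k, E x -> mu1.-integrable I (EFin \o (fun y => F (vsnoc x y))).
Proof.
move=> /integrable_mkcond => /(_ (measurable_cyl mE mI)); rewrite restrict_EFin.
move=> /ae_integrable_vsnoc; apply: filterS => x intx Ex.
apply/integrable_mkcond => //; rewrite restrict_EFin.
by have := patch_cyl F x; rewrite mem_set// => <-.
Qed.

End fubini_real.
End cylinders.

Section boundary_values.
Context {R : realType}.
Notation mu1 := (@lebesgue_measure R).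

Lemma within_continuous_compose {T V : topologicalType} {Y : topologicalType}
    (A : set T) (B : set V) (g : T -> V) (h : V -> Y) :
  continuous g -> (forall t, A t -> B (g t)) ->
  {within B, continuous h} -> {within A, continuous (fun t => h (g t))}.
Proof.
move=> cg AB /subspace_continuousP ch; apply/subspace_continuousP => t At P hP.
have gP : nbhs t (fun s => B (g s) -> P (h (g s))) by exact: cg (ch _ (AB t At) P hP).
change (nbhs t (fun s => A s -> P (h (g s)))).
by apply: filterS gP => s gsP As; apply: gsP; exact: AB.
Qed.

Lemma within_continuous_measurable (h : R -> R) (a b : R) :
  {within `[a, b], continuous h} -> measurable_fun `[a, b] h.
Proof. by move=> ch; apply: subspace_continuous_measurable_fun. Qed.

Lemma within_continuous_bounded (h : R -> R) (a b : R) :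
  {within `[a, b], continuous h} -> exists2 C : R, 0 <= C & forall y, a <= y <= b -> `|h y| <= C.
Proof.
move=> ch; have /compact_bounded[M [_ KM]] := continuous_compact ch (@segment_compact _ a b).
exists (`|M| + 1); first by rewrite addr_ge0.
move=> z Kz; apply KM; last by exists z => //; rewrite /= in_itv.
by rewrite (le_lt_trans (ler_norm _))// ltrDl.
Qed.

Section one_dimension.
Variables (d a b : R).
Hypotheses (a0 : 0 <= a) (ab : a < b) (bd : b <= d).
Let I := `]0, d[%classic : set R.

Lemma density_out_itv y : ~ I y -> step_density a b y = 0.
Proof.
move=> Iy; apply: step_density_out; apply/negP => /andP[ay yb]; apply: Iy.
by rewrite /I /= in_itv /= (le_lt_trans a0 ay) (lt_le_trans yb bd).
Qed.

Lemma integrable_density_itv : mu1.-integrable I (EFin \o step_density a b).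
Proof.
apply: integrableS (integrable_step_density a b) => //.
exact: measurable_itv.
Qed.

Lemma density_itv_mass : \int[mu1]_(y in I) step_density a b y = 1.
Proof.
rewrite -(step_density_mass ab); apply: Rintegral_supp => // y _.
exact: density_out_itv.
Qed.

Lemma integrable_mul_density (h : R -> R) (C : R) : measurable_fun I h ->
  (forall y, I y -> `|h y| <= C) ->
  mu1.-integrable I (EFin \o (fun y => h y * step_density a b y)).
Proof.
move=> mh hC; have mI : measurable (I : set (measurableTypeR R)) by exact: measurable_itv.
have C0 : 0 <= C.
  pose c : R := (a + b) / 2.
  have ac : 0 < c := le_lt_trans a0 (midf_lt ab).1.
  have cd : c < d := lt_le_trans (midf_lt ab).2 bd.
  by apply: le_trans (hC c _) => //; rewrite /I /= in_itv /= ac.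
apply: (@ae_le_integrable _ _ _ mu1 I mI _ (fun y => C * step_density a b y)).
- apply: measurable_funM => //; apply: measurable_funTS.
  by apply: continuous_measurable_fun; exact: continuous_step_density.
- apply: aeW => y Iy; rewrite normrM (ger0_norm (step_density_ge0 ab y)).
  by rewrite ler_wpM2r ?step_density_ge0// hC.
- by apply: integrable_scale => //; exact: integrable_density_itv.
Qed.

Lemma Rintegral_mul_density_le (h : R -> R) (C : R) : measurable_fun I h ->
  (forall y, I y -> `|h y| <= C) ->
  `|\int[mu1]_(y in I) (h y * step_density a b y)| <= C.
Proof.
move=> mh hC; have mI : measurable (I : set (measurableTypeR R)) by exact: measurable_itv.
have inth := integrable_mul_density mh hC.
apply: (le_trans (le_normr_Rintegral mI inth)).
rewrite -[leRHS]mulr1 -density_itv_mass -RintegralZl//; last exact: integrable_density_itv.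
apply: le_Rintegral => //.
- exact: integrable_norm.
- by apply: integrable_scale => //; exact: integrable_density_itv.
- move=> y Iy; rewrite normrM (ger0_norm (step_density_ge0 ab y)).
  by rewrite ler_wpM2r ?step_density_ge0// hC.
Qed.

End one_dimension.

(** Densities of mass one concentrating at a point where h is continuous. *)
Lemma step_density_cvg (d l : R) (a b : nat -> R) (h : R -> R) :
  0 <= l <= d ->
  (forall n, [/\ 0 <= a n, a n < b n & b n <= d]) ->
  a n @[n --> \oo] --> l -> b n @[n --> \oo] --> l ->
  {within `[0, d], continuous h} ->
  (\int[mu1]_(y in `]0, d[) (h y * step_density (a n) (b n) y)) @[n --> \oo] --> h l.
Proof.
move=> ld abd al bl ch.
have mI : measurable (`]0, d[%classic : set (measurableTypeR R)) by exact: measurable_itv.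
have mh : measurable_fun `]0, d[ h.
  apply: measurable_funS (within_continuous_measurable ch) => //.
  by move=> y /=; rewrite !in_itv /= => /andP[? ?]; rewrite !ltW.
have [C C0 hC] := within_continuous_bounded ch.
have hC' y : `]0, d[%classic y -> `|h y| <= C.
  by rewrite /= in_itv /= => /andP[? ?]; apply: hC; rewrite !ltW.
apply/cvgrPdist_le => e e0.
have : within `[0, d] (nbhs l) (fun y => `|h l - h y| <= e).
  move/subspace_continuousP : ch => /(_ l); rewrite /= in_itv /= => /(_ ld).
  by move=> /cvgrPdist_le /(_ e e0).
move=> /nbhs_ballP[r /= r0 lr].
near=> n.
have [an0 abn bnd] := abd n.
have lan : `|l - a n| < r by near: n; exact: cvgr_dist_lt.
have lbn : `|l - b n| < r by near: n; exact: cvgr_dist_lt.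
rewrite -[h l in X in X <= _]mulr1 -(density_itv_mass an0 abn bnd).
rewrite -RintegralZl//; last exact: integrable_density_itv.
rewrite -RintegralB//; last 2 first.
- by apply: integrable_scale => //; exact: integrable_density_itv.
- exact: (integrable_mul_density an0 abn bnd mh hC').
under eq_Rintegral do rewrite -mulrBl.
rewrite (_ : (\int[_]_(_ in _) _) = \int[mu1]_(y in `]0, d[)
   ((if a n < y < b n then h l - h y else 0) * step_density (a n) (b n) y)); last first.
  apply: eq_Rintegral => y _; case: ifPn => // nab.
  by rewrite step_density_out// !mulr0.
apply: (Rintegral_mul_density_le an0 abn bnd).
  rewrite (_ : (fun y => _) = (fun y => h l - h y) \_ `]a n, b n[).
    apply: measurable_funTS; apply/(measurable_restrictT _ _).1 => //.
    apply: measurable_funB => //; apply: measurable_funS mh => //.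
    by move=> y /=; rewrite !in_itv /= => /andP[? ?]; apply/andP; split; lra.
  by apply/funext => y; rewrite /patch mem_setE in_itv.
move=> y _; case: ifPn => [/andP[ay yb]|_]; last by rewrite normr0 ltW.
apply: lr; last by rewrite in_itv /=; apply/andP; split; lra.
rewrite /ball /=; move: lan lbn; rewrite !ltr_norml => /andP[? ?] /andP[? ?].
by apply/andP; split; lra.
Unshelve. all: by end_near. Qed.

Variable k : nat.

Lemma integrable_cube_supp n (D : set 'cV[R]_n) (h : 'cV[R]_n -> R) (r C : R) :
  measurable D -> measurable_fun D h -> (forall z, D z -> ~ cube r z -> h z = 0) ->
  (\forall z \ae leb n, D z -> `|h z| <= C) ->
  (leb n).-integrable D (EFin \o h).
Proof.
move=> mD mh h0 hC; have mc := @measurable_cube R n r.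
apply: (@integrable_supp_set _ _ _ (leb n) D mD (D `&` cube r)) => //.
- exact: measurableI.
- by move=> z Dz nz; apply: h0 => // cz; apply: nz.
apply: (@ae_bounded_integrable _ _ _ (leb n) (D `&` cube r) _ _ C) => //.
- exact: measurableI.
- apply: le_lt_trans (leb_cube_fin n r); apply: le_measure => //; rewrite inE //.
  exact: measurableI.
- exact: measurable_funS mh.
- by apply: filterS hC => z hz [Dz _]; exact: hz.
Qed.

Lemma cube_vsnoc (r : R) (x : 'cV[R]_k) y : cube r (vsnoc x y) -> cube r x.
Proof. by move=> xy i; have := xy (lift ord_max i); rewrite vsnoc_lift. Qed.

(** Averages over thin horizontal layers that shrink to the height l tend to
    the integral over the slice at that height: step_density_cvg on each
    vertical line, then dominated convergence. *)
Lemma boundary_limit (d l r C : R) (a b : nat -> R) (h : 'cV[R]_k.+1 -> R) :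
  0 <= l <= d ->
  (forall n, [/\ 0 <= a n, a n < b n & b n <= d]) ->
  a n @[n --> \oo] --> l -> b n @[n --> \oo] --> l ->
  {within closed_strip d, continuous h} ->
  (forall z, ~ cube r z -> h z = 0) ->
  (forall z, closed_strip d z -> `|h z| <= C) ->
  (\int[leb k.+1]_(z in strip d) (h z * step_density (a n) (b n) (vlast z))) @[n --> \oo] -->
    \int[leb k]_x h (vsnoc x l).
Proof.
move=> ld abd al bl ch h0 hC.
have ss : strip d `<=` @closed_strip R k d by move=> z /andP[? ?]; rewrite /closed_strip /= !ltW.
have mss := open_measurable_cV (@open_strip R k d).
have mh : measurable_fun (strip d) h.
  apply: (measurable_funS _ ss) => //; first exact: closed_measurable_cV (@closed_closed_strip R k d).
  apply: within_continuous_measurable_cV => //.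
  exact: closed_measurable_cV (@closed_closed_strip R k d).
have inth n : (leb k.+1).-integrable (strip d)
    (EFin \o (fun z => h z * step_density (a n) (b n) (vlast z))).
  have crho : continuous (fun z : 'cV[R]_k.+1 => step_density (a n) (b n) (vlast z)).
    move=> z; apply: (continuous_comp (f := @vlast R k) (g := step_density (a n) (b n))).
      exact: continuous_vlast.
    exact: continuous_step_density.
  have [C' C'0 rhoC] := continuous_bounded_compact
     (@closed_box_compact R k.+1 (fun=> - r) (fun=> r)) (continuous_subspaceT crho).
  apply: (integrable_cube_supp (r := r) (C := C * C')) => //.
  - apply: measurable_funM => //; apply: measurable_funTS.
    exact: continuous_measurable_cV.
  - by move=> z _ /h0 ->; rewrite mul0r.
  - apply: aeW => z sz; have [cz|/h0 ->] := pselect (cube r z).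
      rewrite normrM ler_pM//; first exact/hC/ss.
      by apply: rhoC; apply: obox_cbox; exact: cz.
    rewrite mul0r normr0 mulr_ge0//.
    exact: le_trans (hC _ (ss _ sz)).
have hx (x : 'cV[R]_k) : {within `[0, d], continuous (fun y => h (vsnoc x y))}.
  apply: (within_continuous_compose (B := closed_strip d) (g := fun y => vsnoc x y)) => //.
  - exact: continuous_vsnoc_last.
  - by move=> y; rewrite /= in_itv /closed_strip /= vlast_vsnoc.
have mhx (x : 'cV[R]_k) : measurable_fun `]0, d[ (fun y => h (vsnoc x y)).
  apply: measurable_funS (within_continuous_measurable (hx x)) => //.
  by move=> y /=; rewrite !in_itv /= => /andP[? ?]; rewrite !ltW.
have hCx (x : 'cV[R]_k) y : `]0, d[%classic y -> `|h (vsnoc x y)| <= C.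
  rewrite /= in_itv /= => /andP[? ?]; apply: hC.
  by rewrite /closed_strip /= vlast_vsnoc !ltW.
rewrite (_ : (fun n => _) = fun n => \int[leb k]_x
  \int[mu1]_(y in `]0, d[) (h (vsnoc x y) * step_density (a n) (b n) y)); last first.
  apply/funext => n; rewrite strip_cyl (Rintegral_cyl measurableT (measurable_itv _)).
    by apply: eq_Rintegral => x _; apply: eq_Rintegral => y _; rewrite vlast_vsnoc.
  by rewrite -strip_cyl; exact: inth.
apply: (Rdominated_cvg measurableT (g := fun x => C * \1_(cube r) x)).
- move=> n; have := inth n; rewrite strip_cyl => /(integrable_cyl measurableT).
  move=> /(_ (measurable_itv _))/(measurable_int _)/measurable_EFinP.
  by under [X in measurable_fun _ X -> _]eq_fun do under eq_Rintegral do rewrite vlast_vsnoc.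
- by move=> x _; exact: step_density_cvg.
- apply: (@integrable_cube_supp k setT _ r `|C|) => //.
  - apply: measurable_funM; first exact: measurable_cst.
    by apply: measurable_indic; exact: measurable_cube.
  - by move=> z _ nz; rewrite indicE memNset// mulr0.
  - apply: aeW => z _; rewrite normrM ler_piMr// indicE.
    by case: (z \in _); rewrite ?normr1 ?normr0.
- move=> n x _; have [an0 abn bnd] := abd n; rewrite indicE.
  case: (boolP (x \in cube r)) => [_|xr].
    by rewrite mulr1; exact: (Rintegral_mul_density_le an0 abn bnd (mhx x) (hCx x)).
  rewrite mulr0 (_ : (fun y => _) = fun=> 0) ?/Rintegral ?integral0 ?normr0//.
  apply/funext => y; rewrite h0 ?mul0r// => /cube_vsnoc /mem_set.
  exact/negP.
Qed.

End boundary_values.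

Section green.
Context {R : realType} {k : nat}.
Variables (d : R) (d_gt0 : 0 < d).

Let e n : R := d / (n.+4)%:R.

Let e_gt0 n : 0 < e n.
Proof. by rewrite divr_gt0. Qed.

Let e_le n : 4 * e n <= d.
Proof.
rewrite /e mulrA ler_pdivrMr// mulrC ler_pM2l//.
by rewrite ler_nat.
Qed.

Let e_cvg : e n @[n --> \oo] --> 0.
Proof.
rewrite -[X in _ --> X](mulr0 d); apply: cvgM; first exact: cvg_cst.
have := @cvg_harmonic R; rewrite -(cvg_shiftn 3) /=.
by under eq_fun do rewrite addn3.
Qed.

(** C^1, supported in [e n, d - e n] and equal to 1 on [2 e n, d - 2 e n]. *)
Let cutoff n (y : R) : R := step (e n) (2 * e n) y - step (d - 2 * e n) (d - e n) y.

Let lt1 n : e n < 2 * e n. Proof. by have := e_gt0 n; lra. Qed.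
Let lt2 n : d - 2 * e n < d - e n. Proof. by have := e_gt0 n; lra. Qed.

Let derivable_cutoff n y : derivable (cutoff n) y 1.
Proof. by apply: derivableB; exact: derivable_step. Qed.

Let derive_cutoff n : 'D_1 (cutoff n) = fun y =>
  step_density (e n) (2 * e n) y - step_density (d - 2 * e n) (d - e n) y.
Proof.
apply/funext => y; rewrite /cutoff deriveB; [|exact: derivable_step..].
congr (_ - _).
  exact: (congr1 (fun f => f y) (derive_step (e n) (2 * e n))).
exact: (congr1 (fun f => f y) (derive_step (d - 2 * e n) (d - e n))).
Qed.

Let continuous_derive_cutoff n : continuous ('D_1 (cutoff n)).
Proof.
by rewrite derive_cutoff => y; apply: cvgB; exact: continuous_step_density.
Qed.

Let cutoff_out n y : ~ (e n <= y <= d - e n) -> cutoff n y = 0.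
Proof.
have := e_gt0 n; have := e_le n => ? ?.
move=> /negP; rewrite negb_and -!ltNge => /orP[ye|ye]; rewrite /cutoff.
  by rewrite !step_left ?subrr//; lra.
by rewrite !step_right ?subrr//; lra.
Qed.

Let cutoff_norm n y : `|cutoff n y| <= 1.
Proof.
rewrite /cutoff ler_norml; apply/andP; split.
  by rewrite lerBrDr (le_trans _ (step_ge0 (lt1 n) y))// addrC subr_le0 step_le1.
by rewrite lerBlDr (le_trans (step_le1 (lt1 n) y))// lerDl step_ge0.
Qed.

Let cutoff_cvg y : 0 < y < d -> cutoff n y @[n --> \oo] --> (1 : R).
Proof.
move=> /andP[y0 yd]; apply: cvg_near_cst; near=> n.
have h1 : 2 * e n <= y.
  have : e n < y / 2 by near: n; apply: (cvgr_lt 0) => //; rewrite divr_gt0.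
  by lra.
have h2 : y <= d - 2 * e n.
  have : e n < (d - y) / 2 by near: n; apply: (cvgr_lt 0) => //; rewrite divr_gt0// subr_gt0.
  by lra.
by rewrite /cutoff step_right// step_left// subr0.
Unshelve. all: by end_near. Qed.

Variables (f : 'cV[R]_k.+1 -> R) (G : 'cV[R]_k.+1 -> 'cV[R]_k.+1).
Hypothesis fG : is_weak_grad (strip d) f G.
Hypothesis cf : {within closed_strip d, continuous f}.
Hypothesis f0 : forall x, f (vsnoc x 0) = 0.
Variable C : R.
Hypothesis GC : forall j, \forall z \ae leb k.+1, strip d z -> `|G z j ord0| <= C.

Variable eta : 'cV[R]_k.+1 -> R.
Hypothesis teta : test_function setT eta.

Let test_cutoff n : test_function (strip d) (fun z => eta z * cutoff n (vlast z)).
Proof.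
have [ceta [K [cK _ etaK]]] := teta.
split; first by apply: C1M => //; apply: C1_coord; [exact: derivable_cutoff|exact: continuous_derive_cutoff].
pose S := @vlast R k @^-1` `[e n, d - e n]%classic.
have cS : closed S.
  by apply: closed_comp; [move=> z _; exact: continuous_vlast|exact: interval_closed].
exists (K `&` S); split.
- apply: (subclosed_compact _ cK); last exact: subIsetl.
  by apply: closedI => //; exact: compact_closed (@norm_hausdorff _ _) cK.
- move=> z [_]; rewrite /S /= in_itv /= => /andP[? ?].
  by have := e_gt0 n; rewrite /strip /= => ?; apply/andP; split; lra.
- move=> z nKS; have [Kz|/etaK ->] := pselect (K z); last by rewrite mul0r.
  rewrite cutoff_out ?mulr0// => zS; exact: nKS.
Qed.

Let derive_test_cutoff n j z : 'D_(delta_mx j ord0) (fun z => eta z * cutoff n (vlast z)) z =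
  'D_(delta_mx j ord0) eta z * cutoff n (vlast z) +
  (j == ord_max)%:R * (eta z * step_density (e n) (2 * e n) (vlast z) -
                       eta z * step_density (d - 2 * e n) (d - e n) (vlast z)).
Proof.
have [ceta _] := teta.
have cc : C1 (fun z : 'cV[R]_k.+1 => cutoff n (vlast z)).
  by apply: C1_coord; [exact: derivable_cutoff|exact: continuous_derive_cutoff].
rewrite (C1_deriveM _ _ ceta cc) /vlast derive_coord_comp; last exact: derivable_cutoff.
set D := (X in _ * (_ * X)).
have -> : D = step_density (e n) (2 * e n) (vlast z) - step_density (d - 2 * e n) (d - e n) (vlast z).
  exact: (congr1 (fun g => g (vlast z)) (derive_cutoff n)).
by rewrite /vlast !mxE eqxx andbT eq_sym; ring.
Qed.

(** A test function that does not vanish on the two faces is cut off near them.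
    The derivative of the cut-off is the difference of two densities of mass
    one concentrating at the faces; in the limit they produce the boundary
    values, and those on the bottom are zero. *)
Lemma green_strip j :
  \int[leb k.+1]_(z in strip d) (f z * 'D_(delta_mx j ord0) eta z) +
  \int[leb k.+1]_(z in strip d) (G z j ord0 * eta z) =
  (j == ord_max)%:R * \int[leb k]_x (f (vsnoc x d) * eta (vsnoc x d)).
Proof.
have [lf lG wG] := fG.
have [ceta [K [cK _ etaK]]] := teta.
have [r r0 Kr] := compact_sub_cube cK.
have eta0 z : ~ cube r z -> eta z = 0 by move=> zr; apply: etaK => /Kr.
have deta := test_derive_factor (delta_mx j ord0) teta.
have deta0 z : ~ cube r z -> 'D_(delta_mx j ord0) eta z = 0.
  move=> zr; apply: (derive_out (K := K)) => //; last by move=> /Kr.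
  exact: compact_closed (@norm_hausdorff _ _) cK.
have [Ce Ce0 etaC] := compact_factor_bounded (test_factor teta).
have [Cd Cd0 detaC] := compact_factor_bounded deta.
have mS := open_measurable_cV (@open_strip R k d).
have ss : strip d `<=` @closed_strip R k d by move=> z /andP[? ?]; rewrite /closed_strip /= !ltW.
have clS := @closed_closed_strip R k d.
have cBS : compact (cbox (fun=> - r) (fun=> r) `&` @closed_strip R k d).
  apply: subclosed_compact (@closed_box_compact R k.+1 (fun=> - r) (fun=> r)) _; last exact: subIsetl.
  apply: closedI => //; apply: compact_closed; first exact: norm_hausdorff.
  exact: closed_box_compact.
have [Cf Cf0 fC] : exists2 Cf : R, 0 <= Cf & forall z, closed_strip d z -> cube r z -> `|f z| <= Cf.
  have [Cf Cf0 fC] := continuous_bounded_compact cBS (continuous_subspaceW (@subIsetr _ _ _) cf).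
  by exists Cf => // z sz zr; apply: fC; split => //; exact: obox_cbox.
have mf : measurable_fun (strip d) f by case: lf.
have mG : measurable_fun (strip d) (fun z => G z j ord0) by case: (lG j).
have meta : measurable_fun (strip d) eta.
  by apply: measurable_funTS; exact: measurable_C1.
have mdeta : measurable_fun (strip d) ('D_(delta_mx j ord0) eta).
  by apply: measurable_funTS; apply: continuous_measurable_cV; case: deta.
have int1 : (leb k.+1).-integrable (strip d) (EFin \o (fun z => f z * 'D_(delta_mx j ord0) eta z)).
  apply: (@integrable_cube_supp _ _ _ _ r (Cf * Cd)) => //.
  - exact: measurable_funM.
  - by move=> z _ /deta0 ->; rewrite mulr0.
  - apply: aeW => z sz; have [zr|/deta0 ->] := pselect (cube r z).
      by rewrite normrM ler_pM// fC//; exact: ss.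
    by rewrite mulr0 normr0 mulr_ge0.
have int2 : (leb k.+1).-integrable (strip d) (EFin \o (fun z => G z j ord0 * eta z)).
  apply: (@integrable_cube_supp _ _ _ _ r (C * Ce)) => //.
  - exact: measurable_funM.
  - by move=> z _ /eta0 ->; rewrite mulr0.
  - by have := GC j; apply: filterS => z hz sz; rewrite normrM ler_pM// hz.
have int12 : (leb k.+1).-integrable (strip d)
    (EFin \o (fun z => f z * 'D_(delta_mx j ord0) eta z + G z j ord0 * eta z)).
  by have := integrableD mS int1 int2; apply: eq_integrable.
pose h z := f z * eta z.
have ch : {within closed_strip d, continuous h}.
  have ce : {within closed_strip d, continuous eta}.
    by apply: continuous_subspaceT; exact: C1_continuous.
  exact: (@continuous_mul R (subspace (closed_strip d)) f eta cf ce).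
have h0 z : ~ cube r z -> h z = 0 by move=> /eta0 z0; rewrite /h z0 mulr0.
have hC z : closed_strip d z -> `|h z| <= Cf * Ce.
  move=> sz; have [zr|/h0 ->] := pselect (cube r z).
    by rewrite normrM ler_pM// fC.
  by rewrite normr0 mulr_ge0.
pose A n := \int[leb k.+1]_(z in strip d) (h z * step_density (e n) (2 * e n) (vlast z)).
pose B n := \int[leb k.+1]_(z in strip d) (h z * step_density (d - 2 * e n) (d - e n) (vlast z)).
have Acvg : A n @[n --> \oo] --> (0 : R).
  rewrite (_ : 0 = \int[leb k]_x h (vsnoc x 0)); last first.
    by rewrite (_ : (fun x => _) = fun=> 0) ?/Rintegral ?integral0//; apply/funext => x; rewrite /h f0 mul0r.
  apply: (@boundary_limit _ _ d 0 r (Cf * Ce)) => //.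
  - by rewrite lexx ltW.
  - by move=> n; have := e_gt0 n; have := e_le n => ? ?; split; lra.
  - rewrite -[X in _ --> X](mulr0 2); apply: cvgM => //; exact: cvg_cst.
have Bcvg : B n @[n --> \oo] --> \int[leb k]_x h (vsnoc x d).
  apply: (@boundary_limit _ _ d d r (Cf * Ce)) => //.
  - by rewrite lexx ltW.
  - by move=> n; have := e_gt0 n; have := e_le n => ? ?; split; lra.
  - rewrite -[X in _ --> X](subr0 d) -[X in _ - X](mulr0 2); apply: cvgB; first exact: cvg_cst.
    by apply: cvgM => //; exact: cvg_cst.
  - by rewrite -[X in _ --> X](subr0 d); apply: cvgB => //; exact: cvg_cst.
have intrho a b : a < b -> (leb k.+1).-integrable (strip d) (EFin \o (fun z => h z * step_density a b (vlast z))).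
  move=> ab; have crho : continuous (fun z : 'cV[R]_k.+1 => step_density a b (vlast z)).
    move=> z; apply: (continuous_comp (f := @vlast R k) (g := step_density a b)).
      exact: continuous_vlast.
    exact: continuous_step_density.
  have [C' C'0 rhoC] := continuous_bounded_compact
     (@closed_box_compact R k.+1 (fun=> - r) (fun=> r)) (continuous_subspaceT crho).
  apply: (@integrable_cube_supp _ _ _ _ r (Cf * Ce * C')) => //.
  - apply: measurable_funM; first exact: measurable_funM.
    by apply: measurable_funTS; exact: continuous_measurable_cV.
  - by move=> z _ /h0 ->; rewrite mul0r.
  - apply: aeW => z sz; have [cz|/h0 ->] := pselect (cube r z).
      rewrite normrM ler_pM//; first exact/hC/ss.
      by apply: rhoC; apply: obox_cbox; exact: cz.
    by rewrite mul0r normr0 !mulr_ge0.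
have key n : \int[leb k.+1]_(z in strip d)
    ((f z * 'D_(delta_mx j ord0) eta z + G z j ord0 * eta z) * cutoff n (vlast z)) =
    (j == ord_max)%:R * (B n - A n).
  have mcut : measurable_fun (strip d) (fun z : 'cV[R]_k.+1 => cutoff n (vlast z)).
    apply: measurable_funTS; apply: measurable_C1.
    by apply: C1_coord; [exact: derivable_cutoff|exact: continuous_derive_cutoff].
  have intcut g : measurable_fun (strip d) g -> (leb k.+1).-integrable (strip d) (EFin \o g) ->
      (leb k.+1).-integrable (strip d) (EFin \o (fun z => g z * cutoff n (vlast z))).
    move=> mg intg; apply: (@ae_le_integrable _ _ _ (leb k.+1) _ mS _ (fun z => `|g z|)).
    - exact: measurable_funM.
    - by apply: aeW => z _; rewrite normrM ler_piMr.
    - exact: integrable_norm.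
  have mfd : measurable_fun (strip d) (fun z => f z * 'D_(delta_mx j ord0) eta z) by exact: measurable_funM.
  have mGe : measurable_fun (strip d) (fun z => G z j ord0 * eta z) by exact: measurable_funM.
  have E1 : \int[leb k.+1]_(z in strip d) (f z * 'D_(delta_mx j ord0) (fun z => eta z * cutoff n (vlast z)) z) =
      \int[leb k.+1]_(z in strip d) (f z * 'D_(delta_mx j ord0) eta z * cutoff n (vlast z)) +
      (j == ord_max)%:R * (A n - B n).
    have intAB : (leb k.+1).-integrable (strip d) (EFin \o (fun z =>
        h z * step_density (e n) (2 * e n) (vlast z) - h z * step_density (d - 2 * e n) (d - e n) (vlast z))).
      by have := integrableB mS (intrho _ _ (lt1 n)) (intrho _ _ (lt2 n)); apply: eq_integrable.
    rewrite -(RintegralB mS (intrho _ _ (lt1 n)) (intrho _ _ (lt2 n))) -RintegralZl//.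
    rewrite -RintegralD//; [|exact: intcut|exact: integrable_scale].
    by apply: eq_Rintegral => z _; rewrite derive_test_cutoff /h; ring.
  have := wG _ (test_cutoff n) j; rewrite E1.
  have -> : \int[leb k.+1]_(z in strip d) (G z j ord0 * (eta z * cutoff n (vlast z))) =
      \int[leb k.+1]_(z in strip d) (G z j ord0 * eta z * cutoff n (vlast z)).
    by apply: eq_Rintegral => z _; rewrite mulrA.
  under [in X in _ -> X = _]eq_Rintegral do rewrite mulrDl.
  rewrite RintegralD//; [|exact: intcut..].
  by move=> /eqP; rewrite -subr_eq0 => /eqP h0'; apply/eqP; rewrite -subr_eq0 -h0'; apply/eqP; ring.
have Lcvg : (\int[leb k.+1]_(z in strip d)
    ((f z * 'D_(delta_mx j ord0) eta z + G z j ord0 * eta z) * cutoff n (vlast z))) @[n --> \oo] -->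
    \int[leb k.+1]_(z in strip d) (f z * 'D_(delta_mx j ord0) eta z + G z j ord0 * eta z).
  apply: (Rdominated_cvg mS (g := fun z => `|f z * 'D_(delta_mx j ord0) eta z + G z j ord0 * eta z|)).
  - move=> n; apply: measurable_funM.
      by apply: measurable_funD; exact: measurable_funM.
    apply: measurable_funTS; apply: measurable_C1.
    by apply: C1_coord; [exact: derivable_cutoff|exact: continuous_derive_cutoff].
  - move=> z sz; rewrite -[X in _ --> X]mulr1; apply: cvgM; first exact: cvg_cst.
    exact: cutoff_cvg.
  - exact: integrable_norm.
  - by move=> n z _; rewrite normrM ler_piMr.
rewrite -(RintegralD mS int1 int2); apply: (cvg_unique _ Lcvg) => //.
rewrite (_ : (fun n => _) = fun n => (j == ord_max)%:R * (B n - A n)); last exact/funext/key.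
apply: cvgM; first exact: cvg_cst.
by rewrite -[X in _ --> X]subr0; exact: cvgB.
Qed.

End green.

(** * The trace inequality *)

Section trace_inequality.
Context {R : realType}.
Notation mu1 := (@lebesgue_measure R).

Lemma ae_le_Rintegral d (T : measurableType d) (mu : {measure set T -> \bar R})
    (D : set T) (f g : T -> R) : measurable D ->
  mu.-integrable D (EFin \o f) -> mu.-integrable D (EFin \o g) ->
  (\forall x \ae mu, D x -> f x <= g x) ->
  \int[mu]_(x in D) f x <= \int[mu]_(x in D) g x.
Proof.
move=> mD intf intg fg.
have mf : measurable_fun D f by apply/measurable_EFinP; exact: (measurable_int _ intf).
have mg : measurable_fun D g by apply/measurable_EFinP; exact: (measurable_int _ intg).
rewrite -subr_ge0 -RintegralB//.
rewrite (@ae_eq_Rintegral _ _ _ mu D mD _ (fun x => Num.max 0 (g x - f x))).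
- by apply: Rintegral_ge0 => x _; rewrite le_max lexx.
- exact: measurable_funB.
- by apply: measurable_maxr => //; exact: measurable_funB.
- by apply: filterS fg => x fgx Dx; rewrite max_r// subr_ge0 fgx.
Qed.

(** The integral of the square of g minus its mean is nonnegative. *)
Lemma cauchy_schwarz_itv (d : R) (g : R -> R) : 0 < d ->
  mu1.-integrable `]0, d[ (EFin \o g) ->
  mu1.-integrable `]0, d[ (EFin \o (fun y => g y ^+ 2)) ->
  (\int[mu1]_(y in `]0, d[) g y) ^+ 2 <= d * \int[mu1]_(y in `]0, d[) (g y ^+ 2).
Proof.
move=> d0 intg intg2.
have mI : measurable (`]0, d[%classic : set (measurableTypeR R)) by exact: measurable_itv.
have muI : fine (mu1 `]0, d[) = d by rewrite lebesgue_measure_itv /= lte_fin d0 /= subr0.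
have mufin : (mu1 (`]0%R, d[%classic : set R) < +oo)%E.
  by rewrite lebesgue_measure_itv /= lte_fin d0 /= ltry.
set I := \int[mu1]_(y in _) g y; set J := \int[mu1]_(y in _) (g y ^+ 2).
pose c := I / d.
have intc : mu1.-integrable `]0, d[ (EFin \o (fun=> c ^+ 2)).
  apply: (@ae_bounded_integrable _ _ _ mu1 _ mI _ (`|c ^+ 2|)) => //.
  exact: aeW.
have int2c : mu1.-integrable `]0, d[ (EFin \o (fun y => 2 * c * g y)) by exact: integrable_scale.
have : 0 <= \int[mu1]_(y in `]0, d[) (g y ^+ 2 - 2 * c * g y + c ^+ 2).
  apply: Rintegral_ge0 => y _.
  by rewrite (_ : _ + _ = (g y - c) ^+ 2) ?sqr_ge0//; ring.
have int12 : mu1.-integrable `]0, d[ (EFin \o (fun y => g y ^+ 2 - 2 * c * g y)).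
  by have := integrableB mI intg2 int2c; apply: eq_integrable.
rewrite (RintegralD mI int12 intc) (RintegralB mI intg2 int2c) (RintegralZl _ mI intg).
rewrite Rintegral_cst// muI -/I -/J.
have -> : J - 2 * c * I + c ^+ 2 * d = J - I ^+ 2 / d.
  by rewrite /c; field; rewrite gt_eqF.
by rewrite subr_ge0 ler_pdivrMr// mulrC.
Qed.

Variable k : nat.

Lemma derive_line0 (V : normedModType R) (g : V -> R) (v z : V) :
  (\forall h \near (0 : R), g (h *: v + z) = g z) -> 'D_v g z = 0.
Proof.
move=> gz; rewrite /derive; apply/cvg_lim => //; apply: cvg_near_cst.
apply: cvg_within; apply: filterS gz => h /= ->.
by rewrite subrr scaler0.
Qed.

Definition extend (a : 'I_k -> R) (c : R) (i : 'I_k.+1) : R :=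
  oapp a c (unlift ord_max i).

Lemma box_bump_vsnoc (a b : 'I_k -> R) (c e : R) m (x : 'cV[R]_k) y :
  box_bump (extend a c) (extend b e) m (vsnoc x y) =
  box_bump a b m x * plateau c e m y.
Proof.
rewrite /box_bump [LHS]big_ord_recr; apply: f_equal2; last first.
  by rewrite vsnoc_max /extend unlift_none.
apply: eq_bigr => i _.
have -> : widen_ord (leqnSn k) i = lift ord_max i.
  by apply: val_inj; rewrite /= /bump leqNgt ltn_ord.
by rewrite vsnoc_lift /extend liftK.
Qed.

Lemma plateau_inner (d : R) m y : 0 <= y <= d -> plateau (-1) (d + 1) m y = 1.
Proof.
move=> /andP[y0 yd].
have e1 : m.+1%:R^-1 <= 1 :> R by rewrite invf_le1// ler1n.
have h1 : -1 + m.+1%:R^-1 <= y by rewrite (le_trans _ y0)// addrC subr_le0.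
have h2 : y <= d + 1 - m.+1%:R^-1 by rewrite (le_trans yd)// -addrA lerDl subr_ge0.
by rewrite /plateau step_right ?step_left ?subr0 ?mulr1// ?ltrDl ?gtrBl ?invr_gt0.
Qed.

Variables (d : R) (d_gt0 : 0 < d).
Variables (f : 'cV[R]_k.+1 -> R) (G : 'cV[R]_k.+1 -> 'cV[R]_k.+1).
Hypothesis fG : is_weak_grad (strip d) f G.
Hypothesis cf : {within closed_strip d, continuous f}.
Hypothesis f0 : forall x, f (vsnoc x 0) = 0.
Variable C : R.
Hypothesis GC : forall j, \forall z \ae leb k.+1, strip d z -> `|G z j ord0| <= C.

Let top (x : 'cV[R]_k) : R := f (vsnoc x d).
Let GN z : R := G z ord_max ord0.

Let GC_Omega : \forall z \ae leb k.+1, Omega d z -> `|GN z| <= C.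
Proof. by have := GC ord_max; apply: filterS => z h /Omega_strip; exact: h. Qed.

Let mGN : measurable_fun (Omega d) GN.
Proof.
have [_ /(_ ord_max)[+ _] _] := fG.
apply: measurable_funS; [exact: measurable_strip|exact: Omega_strip].
Qed.

Let intGN : (leb k.+1).-integrable (Omega d) (EFin \o GN).
Proof.
exact: (@ae_bounded_integrable _ _ _ _ _ (@measurable_Omega R k d) _ C (@leb_Omega_fin R k d)).
Qed.

Let intGN2 : (leb k.+1).-integrable (Omega d) (EFin \o (fun z => GN z ^+ 2)).
Proof.
apply: (@ae_bounded_integrable _ _ _ _ _ (@measurable_Omega R k d) _ (C ^+ 2) (@leb_Omega_fin R k d)).
  exact: measurable_funX.
have := GC_Omega; apply: filterS => z h /h hz; rewrite normrX lerXn2r// ?nnegrE//.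
exact: le_trans hz.
Qed.

Lemma continuous_face : continuous (fun x => f (vsnoc x d)).
Proof.
have : {within setT, continuous top}.
  apply: (within_continuous_compose (B := closed_strip d) (g := fun x => vsnoc x d)) => //.
    exact: continuous_vsnoc_init.
  by move=> x _; rewrite /closed_strip /= vlast_vsnoc lexx ltW.
move=> /subspace_continuousP h x P hP.
have h' : nbhs x (fun y => setT y -> P (top y)) := h x I P hP.
by change (nbhs x (fun y => P (top y))); apply: filterS h' => y; exact.
Qed.

Let ctop : continuous top := continuous_face.

Let inner (x : 'cV[R]_k) : R := \int[mu1]_(y in `]0, d[) GN (vsnoc x y).

Let int_inner : (leb k).-integrable cubeQ (EFin \o inner).
Proof.
by have := intGN; rewrite Omega_cyl => /(integrable_cyl measurable_cubeQ (measurable_itv _)).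
Qed.

Let minner : measurable_fun cubeQ inner.
Proof. by apply/measurable_EFinP; exact: (measurable_int _ int_inner). Qed.

(** The fundamental theorem of calculus along almost every vertical line. In
    Green's formula take a test function that does not depend on the height
    within the strip: the term with its vertical derivative drops out. *)
Lemma trace_identity : \forall x \ae leb k, cubeQ x ->
  f (vsnoc x d) = \int[mu1]_(y in `]0, d[) G (vsnoc x y) ord_max ord0.
Proof.
have lg : loc_integrable cubeQ (fun x => top x - inner x).
  split; first by apply: measurable_funB => //; apply: measurable_funTS; exact: continuous_measurable_cV.
  move=> K cK KQ; have mK := compact_measurable_cV cK.
  have i1 : (leb k).-integrable K (EFin \o top).
    have [M M0 topM] := continuous_bounded_compact cK (continuous_subspaceT ctop).
    apply: (@ae_bounded_integrable _ _ _ _ _ mK _ M (leb_compact_fin cK)).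
      by apply: measurable_funTS; exact: continuous_measurable_cV.
    exact: aeW.
  have i2 : (leb k).-integrable K (EFin \o inner).
    exact: integrableS measurable_cubeQ mK KQ int_inner.
  by have := integrableB mK i1 i2; apply: eq_integrable.
suff : \forall x \ae leb k, cubeQ x -> top x - inner x = 0.
  by apply: filterS => x hx Qx; apply/eqP; rewrite -subr_eq0; apply/eqP; exact: hx.
apply: (fundamental_lemma open_cubeQ lg) => a b m abQ.
(* The interval [-1, d + 1] leaves room of width 1 for the vertical bump to
   reach 1 before it meets the strip. *)
pose eta := box_bump (extend a (-1)) (extend b (d + 1)) m.
have teta : test_function setT eta by exact: test_function_box_bump.
have etaE x y : 0 <= y <= d -> eta (vsnoc x y) = box_bump a b m x.
  by move=> yd; rewrite /eta box_bump_vsnoc plateau_inner// mulr1.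
have bb0 x : ~ cubeQ x -> box_bump a b m x = 0.
  by move=> nQ; apply: box_bump_out => /obox_cbox /abQ.
have detaE z : strip d z -> 'D_(delta_mx ord_max ord0) eta z = 0.
  move=> sz; apply: derive_line0.
  have cv : continuous (fun h : R => h + vlast z).
    by move=> h; apply: cvgD; [exact: cvg_id|exact: cvg_cst].
  have : \forall h \near (0 : R), (h + vlast z) \in `]0, d[.
    have nb : nbhs (0 + vlast z) (fun y => y \in `]0, d[).
      by rewrite add0r; apply: near_in_itvoo; rewrite in_itv.
    exact: (cv 0 _ nb).
  apply: filterS => h; rewrite in_itv /= => /andP[h0 hd].
  have -> : h *: delta_mx ord_max ord0 + z = vsnoc (vinit z) (h + vlast z).
    apply/colP => i; case: (unliftP ord_max i) => [j ->|->].
      by rewrite vsnoc_lift !mxE eq_sym (negbTE (neq_lift _ _)) /= mulr0 add0r.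
    by rewrite vsnoc_max !mxE !eqxx mulr1.
  case/andP: sz => z0 zd; rewrite -[in RHS](vsnocK z) !etaE//.
    by rewrite !ltW.
  by rewrite !ltW.
have := green_strip d_gt0 fG cf f0 GC teta ord_max.
rewrite eqxx mul1r.
have -> : \int[leb k.+1]_(z in strip d) (f z * 'D_(delta_mx ord_max ord0) eta z) = 0.
  rewrite (_ : 0 = \int[leb k.+1]_(z in strip d) 0); last by rewrite /Rintegral integral0.
  by apply: eq_Rintegral => z /set_mem sz; rewrite detaE// mulr0.
rewrite add0r -(@Rintegral_supp _ _ _ (leb k.+1) (strip d) (Omega d)); last 2 first.
- exact: Omega_strip.
- move=> z sz nO; rewrite -(vsnocK z) etaE; last by case/andP: sz => ? ?; rewrite !ltW.
  by rewrite bb0 ?mulr0// => Qz; apply: nO.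
have intGeta : (leb k.+1).-integrable (Omega d) (EFin \o (fun z => GN z * eta z)).
  apply: (@ae_le_integrable _ _ _ (leb k.+1) _ (@measurable_Omega R k d) _ (fun z => `|GN z|)).
  - apply: measurable_funM => //; apply: measurable_funTS.
    by apply: measurable_C1; exact: box_bump_C1.
  - apply: aeW => z _; rewrite normrM ler_piMr// ger0_norm ?box_bump_ge0//.
    exact: box_bump_le1.
  - exact: integrable_norm.
rewrite Omega_cyl Rintegral_cyl; last 3 first.
- exact: measurable_cubeQ.
- exact: measurable_itv.
- by have := intGeta; rewrite Omega_cyl.
have -> : \int[leb k]_x (f (vsnoc x d) * eta (vsnoc x d)) = \int[leb k]_(x in cubeQ) (top x * box_bump a b m x).
  rewrite (@Rintegral_supp _ _ _ (leb k) setT cubeQ)//.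
    by apply: eq_Rintegral => x _; rewrite etaE// lexx ltW.
  by move=> x _ /bb0 ->; rewrite mulr0.
have mbb : measurable_fun cubeQ (box_bump a b m).
  by apply: measurable_funTS; apply: measurable_C1; exact: box_bump_C1.
have mtop : measurable_fun cubeQ top.
  by apply: measurable_funTS; apply: continuous_measurable_cV.
have bb1 x : `|box_bump a b m x| <= 1.
  by rewrite ger0_norm ?box_bump_ge0// box_bump_le1.
have inttop : (leb k).-integrable cubeQ (EFin \o (fun x => top x * box_bump a b m x)).
  have [M M0 topM] := continuous_bounded_compact
    (@closed_box_compact R k (fun=> 0) (fun=> 1)) (continuous_subspaceT ctop).
  apply: (@ae_bounded_integrable _ _ _ _ _ measurable_cubeQ _ M leb_cubeQ_fin).
    exact: measurable_funM.
  apply: aeW => x Qx; rewrite normrM (le_trans _ (topM x _)) ?ler_piMr//.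
  by apply: obox_cbox; rewrite -cubeQ_obox.
have intin : (leb k).-integrable cubeQ (EFin \o (fun x => inner x * box_bump a b m x)).
  apply: (@ae_le_integrable _ _ _ (leb k) _ measurable_cubeQ _ (fun x => `|inner x|)).
  - exact: measurable_funM.
  - by apply: aeW => x _; rewrite normrM ler_piMr.
  - exact: integrable_norm.
under [in X in _ -> X = _]eq_Rintegral do rewrite mulrBl.
rewrite RintegralB//; last exact: measurable_cubeQ.
move=> <-; apply/eqP; rewrite subr_eq0; apply/eqP.
apply: ae_eq_Rintegral.
- exact: measurable_cubeQ.
- apply/measurable_EFinP; apply: (measurable_int (leb k)).
  have := intGeta; rewrite Omega_cyl.
  by move=> /(integrable_cyl measurable_cubeQ (measurable_itv _)).
- exact: measurable_funM.
- have := intGN; rewrite Omega_cyl => /(ae_integrable_cyl measurable_cubeQ (measurable_itv _)).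
  apply: filterS => x intx Qx; rewrite -RintegralZr//; last exact: intx.
  apply: eq_Rintegral => y /set_mem; rewrite /= in_itv /= => /andP[? ?].
  by rewrite etaE// !ltW.
Qed.

(** Cauchy-Schwarz on the vertical segments of length d; the factor d is what
    makes thin films stable. *)
Lemma trace_inequality :
  (leb k).-integrable cubeQ (EFin \o (fun x => f (vsnoc x d) ^+ 2)) /\
  \int[leb k]_(x in cubeQ) (f (vsnoc x d) ^+ 2) <=
  d * \int[leb k.+1]_(z in Omega d) (G z ord_max ord0 ^+ 2).
Proof.
have int1 : (leb k).-integrable cubeQ (EFin \o (fun x => top x ^+ 2)).
  have [M M0 topM] := continuous_bounded_compact
    (@closed_box_compact R k (fun=> 0) (fun=> 1)) (continuous_subspaceT ctop).
  apply: (@ae_bounded_integrable _ _ _ _ _ measurable_cubeQ _ (M ^+ 2) leb_cubeQ_fin).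
    apply: measurable_funX; apply: measurable_funTS.
    exact: continuous_measurable_cV.
  apply: aeW => x Qx; rewrite normrX lerXn2r// ?nnegrE//; apply: topM.
  by apply: obox_cbox; rewrite -cubeQ_obox.
split => //.
have intG2 := intGN2; rewrite Omega_cyl in intG2.
have intI2 := integrable_cyl measurable_cubeQ (measurable_itv _) intG2.
rewrite Omega_cyl (Rintegral_cyl measurable_cubeQ (measurable_itv _) intG2).
rewrite -RintegralZl//; last exact: measurable_cubeQ.
apply: ae_le_Rintegral => //; first exact: measurable_cubeQ.
  by apply: integrable_scale => //; exact: measurable_cubeQ.
have intG := intGN; rewrite Omega_cyl in intG.
have ae1 := ae_integrable_cyl measurable_cubeQ (measurable_itv _) intG.
have ae2 := ae_integrable_cyl measurable_cubeQ (measurable_itv _) intG2.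
apply: filterS3 trace_identity ae1 ae2 => x fx i1 i2 Qx; rewrite /top fx//.
by apply: cauchy_schwarz_itv => //; [exact: i1|exact: i2].
Qed.

End trace_inequality.

(** * Bilinear forms on matrices *)

Section second_derivative.
Context {R : realType} {V : normedModType R}.
Variables (U : set V) (f : V -> R) (x : V).
Hypotheses (oU : open U) (Ux : U x) (fC : Ck 3 U f).

Lemma D2_linearl a u u' v : D2 f x (a *: u + u') v = a * D2 f x u v + D2 f x u' v.
Proof.
have [_ /(_ v)[/(_ x Ux) df _]] := fC.
by rewrite /D2 !deriveE// linearP.
Qed.

(** On the neighbourhood U of x, where f is differentiable, the derivative in
    the direction a v + v' is the combination of those in the directions v and
    v'; this identity is differentiated at x. *)
Lemma D2_linearr a u v v' : D2 f x u (a *: v + v') = a * D2 f x u v + D2 f x u v'.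
Proof.
have dfv w : differentiable ('D_w f) x.
  by have [_ /(_ w)[/(_ x Ux) df _]] := fC.
have [df _] := fC.
rewrite /D2 (@near_eq_derive _ _ _ _ (fun y => a *: 'D_v f y + 'D_v' f y)); last first.
  have : nbhs x U by exact: open_nbhs_nbhs.
  by apply: filterS => y /df dfy; rewrite !deriveE// linearP.
have dv : derivable ('D_v f) x u by exact: diff_derivable.
have dv' : derivable ('D_v' f) x u by exact: diff_derivable.
by rewrite deriveD ?deriveZ//; exact: derivableZ.
Qed.

End second_derivative.

Section bilinear_forms.
Context {R : realType} {m n : nat}.
Variable B : 'M[R]_(m, n) -> 'M[R]_(m, n) -> R.
Hypothesis Bl : forall a X X' Y, B (a *: X + X') Y = a * B X Y + B X' Y.
Hypothesis Br : forall a X Y Y', B X (a *: Y + Y') = a * B X Y + B X Y'.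

Lemma frobE (X Y : 'M[R]_(m, n)) : frob X Y = \sum_i \sum_j X i j * Y i j.
Proof.
rewrite /frob /mxtrace exchange_big; apply: eq_bigr => j _.
by rewrite mxE; apply: eq_bigr => i _; rewrite mxE.
Qed.

Lemma frob_ge0 (X : 'M[R]_(m, n)) : 0 <= frob X X.
Proof. by rewrite frobE; apply: sumr_ge0 => i _; apply: sumr_ge0 => j _; rewrite -expr2 sqr_ge0. Qed.

Lemma frob_entry (X : 'M[R]_(m, n)) i j : X i j ^+ 2 <= frob X X.
Proof.
rewrite frobE (bigD1 i)//= (bigD1 j)//= -expr2 -addrA lerDl addr_ge0//.
  by apply: sumr_ge0 => j' _; rewrite -expr2 sqr_ge0.
by apply: sumr_ge0 => i' _; apply: sumr_ge0 => j' _; rewrite -expr2 sqr_ge0.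
Qed.

Lemma bilinear0l Y : B 0 Y = 0.
Proof. by have := Bl (-1) 0 0 Y; rewrite scaler0 addr0 => ->; ring. Qed.

Lemma bilinear0r X : B X 0 = 0.
Proof. by have := Br (-1) X 0 0; rewrite scaler0 addr0 => ->; ring. Qed.

Lemma bilinear_suml (I : Type) (s : seq I) (c : I -> R) (E : I -> 'M[R]_(m, n)) Y :
  B (\sum_(i <- s) c i *: E i) Y = \sum_(i <- s) c i * B (E i) Y.
Proof.
elim: s => [|i s ih]; first by rewrite !big_nil bilinear0l.
by rewrite !big_cons Bl ih.
Qed.

Lemma bilinear_sumr (I : Type) (s : seq I) (c : I -> R) (E : I -> 'M[R]_(m, n)) X :
  B X (\sum_(i <- s) c i *: E i) = \sum_(i <- s) c i * B X (E i).
Proof.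
elim: s => [|i s ih]; first by rewrite !big_nil bilinear0r.
by rewrite !big_cons Br ih.
Qed.

Let E (p : 'I_m * 'I_n) : 'M[R]_(m, n) := delta_mx p.1 p.2.

Lemma bilinearE X Y : B X Y = \sum_p \sum_q X p.1 p.2 * Y q.1 q.2 * B (E p) (E q).
Proof.
have XE (Z : 'M[R]_(m, n)) : Z = \sum_p Z p.1 p.2 *: E p.
  by rewrite [LHS]matrix_sum_delta pair_big.
rewrite [in LHS](XE X) bilinear_suml; apply: eq_bigr => p _.
rewrite [in LHS](XE Y) bilinear_sumr mulr_sumr; apply: eq_bigr => q _.
by rewrite mulrA.
Qed.

(** Entrywise Young's inequality; K is the sum of the absolute values of the
    coefficients of B. *)
Lemma bilinear_young : exists2 K : R, 0 <= K &
  forall t X Y, 0 < t -> `|B X Y| <= K * (t * frob X X + t^-1 * frob Y Y).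
Proof.
exists (\sum_(p : 'I_m * 'I_n) \sum_(q : 'I_m * 'I_n) `|B (E p) (E q)|).
  by apply: sumr_ge0 => p _; exact: sumr_ge0.
move=> t X Y t0; rewrite bilinearE (le_trans (ler_norm_sum _ _ _))// mulr_suml.
apply: ler_sum => p _; rewrite (le_trans (ler_norm_sum _ _ _))// mulr_suml.
apply: ler_sum => q _; rewrite normrM mulrC ler_wpM2l// normrM.
have hX := frob_entry X p.1 p.2; have hY := frob_entry Y q.1 q.2.
set x := X _ _ in hX *; set y := Y _ _ in hY *.
have : t * x ^+ 2 + t^-1 * y ^+ 2 <= t * frob X X + t^-1 * frob Y Y.
  by rewrite lerD// ler_wpM2l// ?ltW// invr_gt0.
apply: le_trans; rewrite -(real_normK (num_real x)) -(real_normK (num_real y)).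
set u := `|x|; set v := `|y|.
have u0 : 0 <= u by exact: normr_ge0.
have v0 : 0 <= v by exact: normr_ge0.
have -> : t * u ^+ 2 + t^-1 * v ^+ 2 = t * (u - v / t) ^+ 2 + 2 * (u * v).
  by field; rewrite gt_eqF.
have : 0 <= t * (u - v / t) ^+ 2 by rewrite mulr_ge0 ?sqr_ge0// ltW.
have : 0 <= u * v by exact: mulr_ge0.
by lra.
Qed.

Lemma bilinear_quadraticD X Y :
  B (X + Y) (X + Y) = B X X + B X Y + B Y X + B Y Y.
Proof.
have := Bl 1 X Y (X + Y); rewrite scale1r => ->.
have := Br 1 X X Y; rewrite scale1r => ->.
have := Br 1 Y X Y; rewrite scale1r => ->.
by ring.
Qed.

Context {d : measure_display} {T : measurableType d} {mu : {measure set T -> \bar R}}.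
Variable (D : set T).
Hypothesis mD : measurable D.
Implicit Types J : T -> 'M[R]_(m, n).

Definition mx_measurable J : Prop := forall i j, measurable_fun D (fun z => J z i j).

Lemma measurable_bilinear J J' : mx_measurable J -> mx_measurable J' ->
  measurable_fun D (fun z => B (J z) (J' z)).
Proof.
move=> mJ mJ'; under eq_fun do rewrite bilinearE.
apply: measurable_sum => p; apply: measurable_sum => q.
by apply: measurable_funM => //; apply: measurable_funM; [exact: mJ|exact: mJ'].
Qed.

Lemma measurable_frob J J' : mx_measurable J -> mx_measurable J' ->
  measurable_fun D (fun z => frob (J z) (J' z)).
Proof.
move=> mJ mJ'; under eq_fun do rewrite frobE.
apply: measurable_sum => p; apply: measurable_sum => q.
by apply: measurable_funM; [exact: mJ|exact: mJ'].
Qed.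

Definition square_integrable J : Prop :=
  mx_measurable J /\ mu.-integrable D (EFin \o (fun z => frob (J z) (J z))).

Lemma integrable_bilinear J J' : square_integrable J -> square_integrable J' ->
  mu.-integrable D (EFin \o (fun z => B (J z) (J' z))).
Proof.
move=> [mJ iJ] [mJ' iJ']; have [K K0 BK] := bilinear_young.
apply: (@ae_le_integrable _ _ _ mu _ mD _ (fun z => K * (frob (J z) (J z) + frob (J' z) (J' z)))).
- exact: measurable_bilinear.
- apply: aeW => z _; have := BK 1 (J z) (J' z) ltr01.
  by rewrite invr1 !mul1r.
- apply: integrable_scale => //.
  by have := integrableD mD iJ iJ'; apply: eq_integrable.
Qed.

End bilinear_forms.

Lemma frob_linearl {R : realType} m n a (X X' Y : 'M[R]_(m, n)) :
  frob (a *: X + X') Y = a * frob X Y + frob X' Y.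
Proof. by rewrite /frob linearP /= mulmxDl linearD /= -scalemxAl linearZ. Qed.

Lemma frob_linearr {R : realType} m n a (X Y Y' : 'M[R]_(m, n)) :
  frob X (a *: Y + Y') = a * frob X Y + frob X Y'.
Proof. by rewrite /frob mulmxDr linearD /= -scalemxAr linearZ. Qed.

Lemma continuous_det {R : realType} n : continuous (fun X : 'M[R]_n => \det X).
Proof.
have cs (I : Type) (s : seq I) (F : I -> 'M[R]_n -> R) : (forall i, continuous (F i)) ->
    continuous (fun X => \sum_(i <- s) F i X).
  move=> cF; elim: s => [|i s ih].
    by under eq_fun do rewrite big_nil; exact: cst_continuous.
  by under eq_fun do rewrite big_cons; exact: continuous_add.
have cp (I : Type) (s : seq I) (F : I -> 'M[R]_n -> R) : (forall i, continuous (F i)) ->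
    continuous (fun X => \prod_(i <- s) F i X).
  move=> cF; elim: s => [|i s ih].
    by under eq_fun do rewrite big_nil; exact: cst_continuous.
  by under eq_fun do rewrite big_cons; exact: continuous_mul.
apply: cs => s; apply: continuous_mul; first exact: cst_continuous.
by apply: cp => i; exact: coord_continuous.
Qed.

Lemma open_det_gt0 {R : realType} n : open [set X : 'M[R]_n | 0 < \det X].
Proof.
apply: (@open_comp _ _ (fun X : 'M[R]_n => \det X) [set x | 0 < x]).
  by move=> X _; exact: continuous_det.
exact: open_gt.
Qed.

Lemma open_neq0 {R : realType} n : open [set z : 'cV[R]_n | z != 0].
Proof.
rewrite (_ : [set z | _] = ~` [set 0]).
  by apply: closed_openC; apply: accessible_closed_set1; exact: hausdorff_accessible (@norm_hausdorff _ _).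
by apply/seteqP; split => z /=; [move=> /eqP|move=> /eqP].
Qed.

(** * Extension to a thicker film *)

Section vertical_extension.
Context {R : realType} {k : nat}.
Variables (d s : R).
Hypotheses (d_gt0 : 0 < d) (s_ge0 : 0 <= s).
Notation N := k.+1.

Let sv : 'cV[R]_N := vsnoc 0 s.

Lemma vlast_sub z : vlast (z - sv) = vlast z - s.
Proof. by rewrite /vlast !mxE unlift_none. Qed.

Lemma vinit_sub z : vinit (z - sv) = vinit z.
Proof. by apply/colP => i; rewrite !mxE liftK /= mxE subr0. Qed.

Lemma vsnoc_sub (x : 'cV[R]_k) y : vsnoc x y - sv = vsnoc x (y - s).
Proof. by rewrite -[LHS]vsnocK vlast_sub vinit_sub vlast_vsnoc vinit_vsnoc. Qed.

(** Translation upwards by s, with zero below. The closed version keeps the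
    values on the top and serves for a function continuous up to the boundary;
    the open one serves for its gradient. *)
Definition ext_closed {V : zmodType} (w : 'cV[R]_N -> V) (z : 'cV[R]_N) : V :=
  if 0 <= vlast z - s <= d then w (z - sv) else 0.

Definition ext_open {V : zmodType} (w : 'cV[R]_N -> V) (z : 'cV[R]_N) : V :=
  if 0 < vlast z - s < d then w (z - sv) else 0.

Variables (E : set 'cV[R]_k) (mE : measurable E).

Lemma ext_open_patch (g : 'cV[R]_N -> R) z : cyl E `]0, (d + s)[ z ->
  ext_open g z = (g \_ (cyl E `]0, d[)) (z - sv).
Proof.
move=> [Ez _]; rewrite /ext_open /patch.
have -> : (z - sv \in cyl E `]0, d[) = (0 < vlast z - s < d).
  apply/idP/idP => [/set_mem[_]|h]; first by rewrite vlast_sub /= in_itv.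
  by apply/mem_set; split; [rewrite vinit_sub|rewrite vlast_sub /= in_itv].
by [].
Qed.

Lemma cyl_ext_open (z : 'cV[R]_N) : cyl E `]0, d[ (z - sv) -> cyl E `]0, (d + s)[ z.
Proof.
have := s_ge0 => ? [Ez]; rewrite vlast_sub /= !in_itv /= => /andP[? ?].
by split; [rewrite vinit_sub in Ez|rewrite /= in_itv /=; apply/andP; split; lra].
Qed.

Lemma measurable_ext_open (g : 'cV[R]_N -> R) : measurable_fun (cyl E `]0, d[) g ->
  measurable_fun (cyl E `]0, (d + s)[) (ext_open g).
Proof.
move=> mg; have mc := measurable_cyl mE (measurable_itv (`]0, d[ : interval R)).
have mp : measurable_fun setT (g \_ (cyl E `]0, d[)) by exact/(measurable_restrictT _ mc).
have mps : measurable_fun (cyl E `]0, (d + s)[) (fun z => (g \_ (cyl E `]0, d[)) (z - sv)).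
  by apply: measurable_funTS; apply: (measurableT_comp mp); exact: measurable_shift.
by apply: eq_measurable_fun mps => z /set_mem hz; rewrite ext_open_patch.
Qed.

Lemma Rintegral_ext_open (g : 'cV[R]_N -> R) : measurable_fun (cyl E `]0, d[) g ->
  \int[leb N]_(z in cyl E `]0, (d + s)[) ext_open g z = \int[leb N]_(z in cyl E `]0, d[) g z.
Proof.
move=> mg; have mc := measurable_cyl mE (measurable_itv (`]0, d[ : interval R)).
have mp : measurable_fun setT (g \_ (cyl E `]0, d[)) by exact/(measurable_restrictT _ mc).
transitivity (\int[leb N]_(z in cyl E `]0, (d + s)[) (g \_ (cyl E `]0, d[)) (z - sv)).
  by apply: eq_Rintegral => z /set_mem hz; rewrite ext_open_patch.
rewrite [RHS]Rintegral_mkcond (@Rintegral_supp _ _ _ (leb N) setT)//; last first.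
  move=> z _ nz; rewrite /patch ifF//; apply/negP => /set_mem /cyl_ext_open hz.
  exact: nz.
rewrite /Rintegral; congr fine.
by apply: (integral_shift (- sv) (f := EFin \o (g \_ (cyl E `]0, d[)))); exact/measurable_EFinP.
Qed.

Lemma ae_ext_open (P : 'cV[R]_N -> Prop) :
  (\forall z \ae leb N, cyl E `]0, d[ z -> P z) ->
  \forall z \ae leb N, cyl E `]0, (d + s)[ z -> 0 < vlast z - s < d -> P (z - sv).
Proof.
move=> /(ae_shift (- sv)); apply: filterS => z h [Ez _] sz; apply: h.
by split; [rewrite vinit_sub|rewrite vlast_sub /= in_itv].
Qed.

End vertical_extension.

Lemma continuous_addv {R : realType} n (v : 'cV[R]_n) : continuous (fun z : 'cV[R]_n => z + v).
Proof.
move=> z B /nbhs_ballP[e /= e0 eB]; apply/nbhs_ballP; exists e => //= z' [_ zz'].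
apply: eB; split => // i j; rewrite !mxE /ball /= opprD addrACA subrr addr0.
exact: zz'.
Qed.

Section extension_calV.
Context {R : realType} {k : nat}.
Variables (d s : R).
Hypotheses (d_gt0 : 0 < d) (s_ge0 : 0 <= s).
Notation N := k.+1.
Let sv : 'cV[R]_N := vsnoc 0 s.

Lemma derive_shift (eta : 'cV[R]_N -> R) v w z :
  'D_w (fun z => eta (z + v)) z = 'D_w eta (z + v).
Proof.
rewrite /derive (_ : (fun h => _) = (fun h => h^-1 *: ((eta \o shift (z + v)) (h *: w) - eta (z + v)))) //.
by apply/funext => h /=; rewrite addrA.
Qed.

Lemma C1_shift (eta : 'cV[R]_N -> R) v : C1 eta -> C1 (fun z => eta (z + v)).
Proof.
move=> ceta; apply: C1P => [z|w].
  apply: (@differentiable_comp _ _ _ _ (fun z => z + v) eta); last exact: C1_differentiable.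
  by apply: differentiableD; [by apply: ex_diff|exact: differentiable_cst].
rewrite (_ : 'D_w _ = fun z => 'D_w eta (z + v)); last first.
  by apply/funext => z; exact: derive_shift.
by move=> z; apply: (continuous_comp (f := fun z => z + v) (g := 'D_w eta));
  [exact: continuous_addv|exact: C1_derive_continuous].
Qed.

Lemma test_function_shift (eta : 'cV[R]_N -> R) v : test_function setT eta ->
  test_function setT (fun z => eta (z + v)).
Proof.
move=> [ceta [K [cK _ etaK]]]; split; first exact: C1_shift.
exists ((fun z => z - v) @` K); split => //.
  apply: continuous_compact => //; apply: continuous_subspaceT.
  exact: continuous_addv.
move=> z nz; apply: etaK => Kz; apply: nz; exists (z + v) => //.
by rewrite addrK.
Qed.

Lemma ext_closedE {V : zmodType} (f : 'cV[R]_N -> V) z : (forall x, f (vsnoc x 0) = 0) ->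
  strip (d + s) z -> ext_closed d s f z = ext_open d s f z.
Proof.
move=> f0 /andP[z0 zd]; rewrite /ext_closed /ext_open.
have ad : vlast z - s < d by rewrite ltrBlDr.
have [zs|zs] := eqVneq (vlast z - s) 0.
  by rewrite zs lexx ltxx ltW//= -[z - _]vsnocK vlast_sub zs f0.
by rewrite ad (ltW ad) !andbT lt0r zs.
Qed.

(** The two closed pieces, below and above height s, are glued: on the common
    slice the translate takes the value of w on the bottom, which is zero. *)
Lemma continuous_ext_closed {V : normedModType R} (w : 'cV[R]_N -> V) :
  {within closed_strip d, continuous w} -> (forall x, w (vsnoc x 0) = 0) ->
  {within closed_strip (d + s), continuous (ext_closed d s w)}.
Proof.
move=> cw w0; have := s_ge0; have := d_gt0 => ? ?.
pose A := @vlast R k @^-1` `[0, s]%classic; pose B := @vlast R k @^-1` `[s, (d + s)]%classic.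
have cA : closed A.
  by apply: closed_comp; [move=> z _; exact: continuous_vlast|exact: interval_closed].
have cB : closed B.
  by apply: closed_comp; [move=> z _; exact: continuous_vlast|exact: interval_closed].
have -> : closed_strip (d + s) = A `|` B.
  apply/seteqP; split => z; rewrite /closed_strip /A /B /= !in_itv /=.
    move=> /andP[h1 h2]; have [h3|h3] := leP (vlast z) s; [left|right]; apply/andP; split => //.
    exact: ltW.
  by move=> [] /andP[h1 h2]; apply/andP; split; lra.
apply: withinU_continuous => //.
  apply: (@subspace_eq_continuous _ A _ (fun=> 0)); last first.
    by apply: continuous_subspaceT; exact: cst_continuous.
  move=> z /set_mem; rewrite /A /= in_itv /= => /andP[z0 zs].
  rewrite /from_subspace /ext_closed; case: ifPn => // /andP[h1 h2].
  rewrite -[z - _]vsnocK vlast_sub.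
  have -> : vlast z - s = 0 by apply/eqP; rewrite eq_le h1 subr_le0 zs.
  by rewrite w0.
have AB z : B z -> closed_strip d (z - sv).
  rewrite /B /closed_strip /= in_itv /= vlast_sub => /andP[h1 h2].
  by apply/andP; split; lra.
pose g (z : 'cV[R]_N) := w (z - sv).
have cg : {within B, continuous g}.
  exact: (within_continuous_compose (@continuous_addv R N (- sv)) AB cw).
apply: (@subspace_eq_continuous _ B _ g) => //.
move=> z /set_mem; rewrite /B /= in_itv /= => /andP[z0 zs].
rewrite /from_subspace /ext_closed ifT//; apply/andP; split; lra.
Qed.

(** Translating the test function instead of f turns the identity into Green's
    formula on the strip of height d: there is no boundary term at the bottom
    because f vanishes there, nor at the top because the test function does. *)
Lemma is_weak_grad_ext (f : 'cV[R]_N -> R) (G : 'cV[R]_N -> 'cV[R]_N) (C : R) :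
  is_weak_grad (strip d) f G -> {within closed_strip d, continuous f} ->
  (forall x, f (vsnoc x 0) = 0) ->
  (forall j, \forall z \ae leb N, strip d z -> `|G z j ord0| <= C) ->
  is_weak_grad (strip (d + s)) (ext_closed d s f) (ext_open d s G).
Proof.
move=> fG cf f0 GC; have [lf lG wG] := fG.
have mS := @measurable_strip R k (d + s).
have exG j : (fun z => ext_open d s G z j ord0) = ext_open d s (fun z => G z j ord0).
  by apply/funext => z; rewrite /ext_open; case: ifP => // _; rewrite mxE.
have mf : measurable_fun (strip (d + s)) (ext_open d s f).
  by have := lf.1; rewrite !strip_cyl; exact: measurable_ext_open.
have mG j : measurable_fun (strip (d + s)) (ext_open d s (fun z => G z j ord0)).
  by have := (lG j).1; rewrite !strip_cyl; exact: measurable_ext_open.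
have mfc : measurable_fun (strip (d + s)) (ext_closed d s f).
  apply: eq_measurable_fun mf => z /set_mem sz.
  by rewrite ext_closedE.
have ss : strip (d + s) `<=` @closed_strip R k (d + s).
  by move=> z /andP[? ?]; rewrite /closed_strip /= !ltW.
split.
- split => // K cK KS; have mK := compact_measurable_cV cK.
  have [M M0 fM] := continuous_bounded_compact cK
    (continuous_subspaceW (subset_trans KS ss) (continuous_ext_closed cf f0)).
  apply: (@ae_bounded_integrable _ _ _ _ _ mK _ M (leb_compact_fin cK)).
    exact: measurable_funS mfc.
  exact: aeW.
- move=> j; rewrite exG; split => // K cK KS; have mK := compact_measurable_cV cK.
  apply: (@ae_bounded_integrable _ _ _ _ _ mK _ `|C| (leb_compact_fin cK)).
    exact: measurable_funS (mG j).
  have := GC j; rewrite strip_cyl => /(ae_ext_open s).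
  rewrite -strip_cyl; apply: filterS => z h /KS sz; rewrite /ext_open; case: ifPn => hz.
    by rewrite (le_trans (h sz hz))// ler_norm.
  by rewrite normr0.
move=> eta teta j.
have [_ [K [cK KS etaK]]] := teta.
pose eta' z := eta (z + sv).
have teta' : test_function setT eta'.
  by apply: test_function_shift; exact: test_function_sub teta.
have := green_strip d_gt0 fG cf f0 GC teta' j.
rewrite [X in _ = _ * X](_ : _ = 0) ?mulr0; last first.
  rewrite (_ : (fun x => _) = fun=> 0) ?/Rintegral ?integral0//; apply/funext => x.
  rewrite /eta' etaK ?mulr0// => /KS; rewrite /strip /= vsnocD vlast_vsnoc ltxx.
  by rewrite andbF.
have fdeta := test_derive_factor (delta_mx j ord0) teta.
have fdeta' := test_derive_factor (delta_mx j ord0) teta'.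
have feta' := test_factor teta'.
have m1 : measurable_fun (strip d) (fun z => f z * 'D_(delta_mx j ord0) eta' z).
  apply: measurable_funM; first by case: lf.
  by apply: measurable_funTS; apply: continuous_measurable_cV; case: fdeta'.
have m2 : measurable_fun (strip d) (fun z => G z j ord0 * eta' z).
  apply: measurable_funM; first by case: (lG j).
  by apply: measurable_funTS; apply: continuous_measurable_cV; case: feta'.
have E1 : \int[leb N]_(z in strip (d + s)) (ext_closed d s f z * 'D_(delta_mx j ord0) eta z) =
    \int[leb N]_(z in strip d) (f z * 'D_(delta_mx j ord0) eta' z).
  have := m1; rewrite !strip_cyl => /(Rintegral_ext_open s_ge0 measurableT) <-.
  apply: eq_Rintegral => z /set_mem; rewrite -strip_cyl => sz.
  rewrite ext_closedE// /ext_open; case: ifP => _; last by rewrite mul0r.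
  by rewrite derive_shift subrK.
have E2 : \int[leb N]_(z in strip (d + s)) (ext_open d s G z j ord0 * eta z) =
    \int[leb N]_(z in strip d) (G z j ord0 * eta' z).
  have := m2; rewrite !strip_cyl => /(Rintegral_ext_open s_ge0 measurableT) <-.
  apply: eq_Rintegral => z _.
  rewrite /ext_open; case: ifP => _; last by rewrite mxE mul0r.
  by rewrite /eta' subrK.
by rewrite E1 E2 => /eqP; rewrite addr_eq0 => /eqP.
Qed.

Lemma ess_bounded_entry p q U (F : 'cV[R]_N -> 'M[R]_(p, q)) : ess_bounded U F ->
  exists2 C : R, 0 <= C & forall i j, \forall z \ae leb N, U z -> `|F z i j| <= C.
Proof.
move=> [C hC]; exists (1 + `|C|); first by rewrite addr_ge0.
move=> i j; apply: filterS hC => z h Uz.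
have hx := le_trans (frob_entry (F z) i j) (le_trans (h Uz) (ler_norm C)).
have := sqr_ge0 (`|F z i j| - 1); have := real_normK (num_real (F z i j)).
set x := `|_|; set y := F z i j ^+ 2 in hx *; move=> xy h1.
have : 0 <= x by exact: normr_ge0.
move: h1; rewrite (_ : (x - 1) ^+ 2 = x ^+ 2 - 2 * x + 1); last by ring.
by rewrite xy; lra.
Qed.

Lemma calV_jac (u : 'cV[R]_N -> 'cV[R]_N) : calV d u -> is_weak_jac (strip d) u (weak_jac (strip d) u).
Proof. by move=> [[du _ _] _ _ _]; exact: is_weak_jac_weak_jac. Qed.

Lemma within_continuous_coord (A : set 'cV[R]_N) (u : 'cV[R]_N -> 'cV[R]_N) i :
  {within A, continuous u} -> {within A, continuous (fun z => u z i ord0)}.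
Proof.
move=> cu z; apply: (@continuous_comp (subspace A) _ _ u (fun v : 'cV[R]_N => v i ord0)).
  exact: cu.
exact: coord_continuous.
Qed.

Lemma is_weak_jac_ext (u : 'cV[R]_N -> 'cV[R]_N) : calV d u ->
  is_weak_jac (strip (d + s)) (ext_closed d s u) (ext_open d s (weak_jac (strip d) u)).
Proof.
move=> cu i; have uJ := calV_jac cu.
have [[_ _ bJ] contu u0 _] := cu.
have [C C0 JC] := ess_bounded_entry bJ.
have := @is_weak_grad_ext (fun z => u z i ord0) _ C (uJ i) (within_continuous_coord contu) => h.
have {}h := h ltac:(by move=> x; rewrite u0 mxE)
  ltac:(by move=> j; have := JC i j; apply: filterS => z hz sz; have := hz sz; rewrite !mxE).
move: h; congr (is_weak_grad _ _ _); apply/funext => z; rewrite /ext_closed /ext_open; case: ifP => // _.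
  by rewrite mxE.
by apply/colP => j; rewrite !mxE.
Qed.

Lemma ess_bounded_ext_open p q (F : 'cV[R]_N -> 'M[R]_(p, q)) : ess_bounded (strip d) F ->
  ess_bounded (strip (d + s)) (ext_open d s F).
Proof.
move=> [C hC]; exists `|C|; move: hC; rewrite !strip_cyl => /(ae_ext_open s).
apply: filterS => z h sz; rewrite /ext_open; case: ifPn => hz.
  by rewrite (le_trans (h sz hz))// ler_norm.
by rewrite /frob mulmx0 linear0.
Qed.

Lemma calV_ext (u : 'cV[R]_N -> 'cV[R]_N) : calV d u -> calV (d + s) (ext_closed d s u).
Proof.
move=> cu; have Jext := is_weak_jac_ext cu; have [[du bu bJ] contu u0 pu] := cu.
split.
- split.
  + exact: is_weak_jac_vec Jext.
  + have [C hC] := ess_bounded_ext_open bu; exists C; apply: filterS hC => z h sz.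
    by rewrite ext_closedE// h.
  + have [C hC] := ess_bounded_ext_open bJ; exists C.
    have := weak_jac_ae (@open_strip R k (d + s)) Jext; move: hC.
    by apply: filterS2 => z h1 h2 sz; rewrite h2// h1.
- exact: continuous_ext_closed.
- move=> x; rewrite /ext_closed vlast_vsnoc vsnoc_sub; case: ifPn => // /andP[h1 _].
  by have -> : 0 - s = 0 by apply/eqP; rewrite eq_le h1 subr_le0 s_ge0.
- move=> i x y _; rewrite /ext_closed !vlast_vsnoc !vsnoc_sub; case: ifPn => // h.
  exact: pu.
Qed.

End extension_calV.

(** * Uniform coercivity for thin films *)

Lemma ler_mul_dropl (R : realType) (c x y e : R) :
  0 <= c -> 0 <= x -> c * (x + y) <= e -> c * y <= e.
Proof. by move=> c0 x0; apply: le_trans; rewrite ler_wpM2l// lerDr. Qed.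

Section square_integrable.
Context d (T : measurableType d) (R : realType) (mu : {measure set T -> \bar R}).

Lemma frob_subr_le m n (X Y : 'M[R]_(m, n)) :
  frob (X - Y) (X - Y) <= 2 * (frob X X + frob Y Y).
Proof.
rewrite !frobE -big_split /= mulr_sumr; apply: ler_sum => i _.
rewrite -big_split /= mulr_sumr; apply: ler_sum => j _; rewrite !mxE.
set x := X i j; set y := Y i j; rewrite -subr_ge0.
rewrite (_ : _ - _ = (x + y) ^+ 2) ?sqr_ge0//; ring.
Qed.

Lemma square_integrableB m n (U : set T) (J J' : T -> 'M[R]_(m, n)) : measurable U ->
  square_integrable (mu := mu) U J -> square_integrable (mu := mu) U J' ->
  square_integrable (mu := mu) U (fun z => J z - J' z).
Proof.
move=> mU [mJ iJ] [mJ' iJ'].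
have mB : mx_measurable U (fun z => J z - J' z).
  move=> i j; rewrite (_ : (fun z => _) = (fun z => J z i j - J' z i j)); last first.
    by apply/funext => z; rewrite !mxE.
  by apply: measurable_funB; [exact: mJ|exact: mJ'].
split=> //; apply: (@ae_le_integrable _ _ _ mu _ mU _
    (fun z => 2 * (frob (J z) (J z) + frob (J' z) (J' z)))).
- exact: measurable_frob.
- by apply: aeW => z _; rewrite ger0_norm ?frob_ge0// frob_subr_le.
- apply: integrable_scale => //.
  by have := integrableD mU iJ iJ'; apply: eq_integrable.
Qed.

End square_integrable.

Section energies.
Context {R : realType} {k : nat}.
Notation N := k.+1.
Implicit Types (u w : 'cV[R]_N -> 'cV[R]_N).

Lemma mx_measurable_col (U : set 'cV[R]_N) w : weakly_differentiable_vec U w -> mx_measurable U w.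
Proof.
by move=> dw i j; rewrite (ord1 j); have /(_ i)[[]] := is_weak_jac_weak_jac dw.
Qed.

Lemma mx_measurable_jac (U : set 'cV[R]_N) w J : is_weak_jac U w J -> mx_measurable U J.
Proof. by move=> wJ i j; exact: measurable_weak_jac wJ. Qed.

Lemma H1_square_integrable (U : set 'cV[R]_N) w : open U -> H1 U w ->
  square_integrable (mu := leb N) U w /\
  square_integrable (mu := leb N) U (weak_jac U w).
Proof.
move=> oU [dw fin]; have mU := open_measurable_cV oU.
have wJ := is_weak_jac_weak_jac dw.
have mw := mx_measurable_col dw; have mJ := mx_measurable_jac wJ.
have intS : (leb N).-integrable U
    (EFin \o (fun z => frob (w z) (w z) + frob (weak_jac U w z) (weak_jac U w z))).
  apply/integrableP; split.
    by apply/measurable_EFinP; apply: measurable_funD; exact: measurable_frob.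
  apply: le_lt_trans fin; apply: ge0_le_integral => //.
  - apply: measurableT_comp => //; apply/measurable_EFinP.
    by apply: measurable_funD; exact: measurable_frob.
  - apply/measurable_EFinP.
    by apply: measurable_funD; exact: measurable_frob.
  - by move=> z _ /=; rewrite lee_fin ger0_norm// addr_ge0// frob_ge0.
split; split => //.
  apply: (ae_le_integrable mU _ _ intS); first exact: measurable_frob.
  by apply: aeW => z _; rewrite ger0_norm ?frob_ge0// lerDl frob_ge0.
apply: (ae_le_integrable mU _ _ intS); first exact: measurable_frob.
by apply: aeW => z _; rewrite ger0_norm ?frob_ge0// lerDr frob_ge0.
Qed.

Lemma sqnormH1E (U : set 'cV[R]_N) w : open U -> H1 U w ->
  sqnormH1 U w = (\int[leb N]_(z in U) frob (w z) (w z) +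
                  \int[leb N]_(z in U) frob (weak_jac U w z) (weak_jac U w z))%:E.
Proof.
move=> oU hw; have mU := open_measurable_cV oU.
have [[_ iw] [_ iJ]] := H1_square_integrable oU hw.
rewrite -RintegralD// -EFin_Rintegral//.
by have := integrableD mU iw iJ; apply: eq_integrable.
Qed.

Lemma calV_H1 d w : calV d w -> H1 (Omega d) w.
Proof.
move=> cw; have wJ := calV_jac cw; have [[dw bw bJ] _ _ _] := cw.
have oO := @open_Omega R k d.
have wJO := is_weak_jac_sub (@open_strip R k d) oO (@Omega_strip R k d) wJ.
have dwO := is_weak_jac_vec wJO; split => //.
have [C1 hC1] := bw; have [C2 hC2] := bJ.
have mf : measurable_fun (Omega d) (fun z => frob (w z) (w z) +
    frob (weak_jac (Omega d) w z) (weak_jac (Omega d) w z)).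
  apply: measurable_funD; apply: measurable_frob; try exact: mx_measurable_col.
    exact: mx_measurable_jac (is_weak_jac_weak_jac dwO).
  exact: mx_measurable_jac (is_weak_jac_weak_jac dwO).
have intf : (leb N).-integrable (Omega d) (EFin \o (fun z => frob (w z) (w z) +
    frob (weak_jac (Omega d) w z) (weak_jac (Omega d) w z))).
  apply: (@ae_bounded_integrable _ _ _ _ _ (@measurable_Omega R k d) _ (C1 + C2) (@leb_Omega_fin R k d)) => //.
  have := weak_jac_ae oO wJO; move: hC1 hC2; apply: filterS3 => z h1 h2 h3 Oz.
  have sz := Omega_strip Oz.
  by rewrite ger0_norm ?addr_ge0 ?frob_ge0// h3// lerD// ?h1 ?h2.
by rewrite /sqnormH1 (EFin_Rintegral (@measurable_Omega R k d) intf); exact: ltry.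
Qed.

(** The weak gradient of a difference agrees almost everywhere with the
    difference of the weak gradients, which turns H^1 convergence into L^2
    convergence of the functions and of their gradients. *)
Lemma sqnormH1B (U : set 'cV[R]_N) w w' : open U -> H1 U w -> H1 U w' ->
  sqnormH1 U (w \- w') =
  (\int[leb N]_(z in U) frob (w z - w' z) (w z - w' z) +
   \int[leb N]_(z in U) frob (weak_jac U w z - weak_jac U w' z)
                            (weak_jac U w z - weak_jac U w' z))%:E.
Proof.
move=> oU hw hw'; have mU := open_measurable_cV oU.
have [iw iJ] := H1_square_integrable oU hw.
have [iw' iJ'] := H1_square_integrable oU hw'.
have [mw iww] := square_integrableB mU iw iw'.
have [mJ iJJ] := square_integrableB mU iJ iJ'.
have JB := is_weak_jacB oU (is_weak_jac_weak_jac hw.1) (is_weak_jac_weak_jac hw'.1).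
have mJB := mx_measurable_jac (is_weak_jac_weak_jac (is_weak_jac_vec JB)).
rewrite -RintegralD// -EFin_Rintegral//; last first.
  by have := integrableD mU iww iJJ; apply: eq_integrable.
apply: ae_eq_integral => //.
- apply/measurable_EFinP; apply: measurable_funD; first exact: (measurable_frob mw mw).
  exact: measurable_frob.
- by apply/measurable_EFinP; apply: measurable_funD; exact: measurable_frob.
- have := weak_jac_ae oU JB; apply: filterS => z h Uz; congr (_%:E).
  by rewrite h.
Qed.

Lemma frob0l m n (X : 'M[R]_(m, n)) : frob 0 X = 0.
Proof. by rewrite /frob trmx0 mul0mx linear0. Qed.

Lemma calV_calVt d w : calV d w -> calVt d w.
Proof.
move=> cw; have hw := calV_H1 cw; split => //.
exists (fun=> w) => //; apply: cvg_near_cst; apply: nearW => _.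
rewrite (sqnormH1B (@open_Omega R k d) hw hw).
under eq_Rintegral do rewrite subrr frob0l.
under [X in _ + X]eq_Rintegral do rewrite subrr frob0l.
by rewrite /Rintegral integral0 addr0.
Qed.

Lemma Omega_ext_open d s (g : 'cV[R]_N -> R) : 0 <= s -> measurable_fun (Omega d) g ->
  \int[leb N]_(z in Omega (d + s)) ext_open d s g z = \int[leb N]_(z in Omega d) g z.
Proof.
by move=> s0; rewrite !Omega_cyl => mg; apply: Rintegral_ext_open => //; exact: measurable_cubeQ.
Qed.

Lemma measurable_Omega_ext_open d s (g : 'cV[R]_N -> R) : 0 <= s -> measurable_fun (Omega d) g ->
  measurable_fun (Omega (d + s)) (ext_open d s g).
Proof.
by move=> s0; rewrite !Omega_cyl => mg; apply: measurable_ext_open => //; exact: measurable_cubeQ.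
Qed.

Variables (W : 'M[R]_N -> R) (M : 'M[R]_N).
Hypothesis Bl : forall a X X' Y, D2 W M (a *: X + X') Y = a * D2 W M X Y + D2 W M X' Y.
Hypothesis Br : forall a X Y Y', D2 W M X (a *: Y + Y') = a * D2 W M X Y + D2 W M X Y'.

(** The extension of u by zero below is admissible on the thicker strip and has
    the same gradient energies, so the coercivity constant of a thick film
    serves for all the thinner ones. *)
Lemma coercivity_thin d s (c0 : R) u : 0 < d -> 0 <= s -> 0 <= c0 ->
  (forall w, calVt (d + s) w ->
    (c0%:E * sqnormH1 (Omega (d + s)) w <= (hessW_form W (d + s) M w w)%:E)%E) ->
  calV d u ->
  c0 * \int[leb N]_(z in Omega d) frob (weak_jac (Omega d) u z) (weak_jac (Omega d) u z)
    <= hessW_form W d M u u.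
Proof.
move=> d0 s0 c00 coer cu.
pose Js := weak_jac (strip d) u.
have oO := @open_Omega R k d; have oO' := @open_Omega R k (d + s).
have mO := @measurable_Omega R k d; have mO' := @measurable_Omega R k (d + s).
have cu' := calV_ext d0 s0 cu.
have uJ := is_weak_jac_sub (@open_strip R k d) oO (@Omega_strip R k d) (calV_jac cu).
have uJ' := is_weak_jac_sub (@open_strip R k (d + s)) oO' (@Omega_strip R k (d + s))
  (is_weak_jac_ext d0 s0 cu).
have mJ := mx_measurable_jac uJ; have mJ' := mx_measurable_jac uJ'.
have mK := mx_measurable_jac (is_weak_jac_weak_jac (is_weak_jac_vec uJ)).
have mK' := mx_measurable_jac (is_weak_jac_weak_jac (is_weak_jac_vec uJ')).
have h1 := calV_H1 cu'.
have := coer _ (calV_calVt cu'); rewrite (sqnormH1E oO' h1) -EFinM lee_fin => hc.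
have ext0 := fun (g : 'cV[R]_N -> R) mg => @Omega_ext_open d s g s0 mg.
have extm := fun (g : 'cV[R]_N -> R) mg => @measurable_Omega_ext_open d s g s0 mg.
have eqJ := weak_jac_ae oO uJ; have eqJ' := weak_jac_ae oO' uJ'.
have mfJ := measurable_frob mJ mJ; have mfK := measurable_frob mK mK.
have mfK' := measurable_frob mK' mK'.
have mBJ := measurable_bilinear Bl Br mJ mJ; have mBK := measurable_bilinear Bl Br mK mK.
have mBK' := measurable_bilinear Bl Br mK' mK'.
have E1 : \int[leb N]_(z in Omega (d + s)) frob (weak_jac (Omega (d + s)) (ext_closed d s u) z)
     (weak_jac (Omega (d + s)) (ext_closed d s u) z) =
   \int[leb N]_(z in Omega d) frob (weak_jac (Omega d) u z) (weak_jac (Omega d) u z).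
  transitivity (\int[leb N]_(z in Omega (d + s)) ext_open d s (fun z => frob (Js z) (Js z)) z).
    apply: (ae_eq_Rintegral mO' mfK' (extm _ mfJ)).
    apply: filterS eqJ' => z hz Oz; rewrite hz /ext_open; last exact: Oz.
    by case: ifP => _; rewrite ?frob0l.
  rewrite (ext0 _ mfJ); apply: (ae_eq_Rintegral mO mfJ mfK).
  by apply: filterS eqJ => z hz Oz; rewrite hz.
have E2 : hessW_form W (d + s) M (ext_closed d s u) (ext_closed d s u) = hessW_form W d M u u.
  transitivity (\int[leb N]_(z in Omega (d + s)) ext_open d s (fun z => D2 W M (Js z) (Js z)) z).
    apply: (ae_eq_Rintegral mO' mBK' (extm _ mBJ)).
    apply: filterS eqJ' => z hz Oz; rewrite hz /ext_open; last exact: Oz.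
    by case: ifP => _; rewrite ?(bilinear0l Bl).
  rewrite (ext0 _ mBJ); apply: (ae_eq_Rintegral mO mBJ mBK).
  by apply: filterS eqJ => z hz Oz; rewrite hz.
rewrite E1 E2 in hc; apply: (ler_mul_dropl c00 _ hc).
by apply: Rintegral_ge0 => z _; exact: frob_ge0.
Qed.

End energies.

(** * Periodic functions with vanishing gradient *)

Lemma cvg_eq_to0 (R : realType) (u v : nat -> R) (l : R) :
  u m @[m --> \oo] --> l -> v m @[m --> \oo] --> (0 : R) -> u =1 v -> l = 0.
Proof. by move=> ul v0 /funext uv; rewrite uv in ul; exact: (cvg_unique _ ul). Qed.

Section constancy.
Context {R : realType} {n : nat}.

Lemma Rintegral_plateau_cvg (a b : R) : 0 <= a -> b <= 1 ->
  (\int[@lebesgue_measure R]_t plateau a b m t) @[m --> \oo] -->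
    \int[@lebesgue_measure R]_t (\1_(`]a, b[%classic) t : R).
Proof.
move=> a0 b1; set I := `[0, 1]%classic : set R.
have mI : measurable (I : set (measurableTypeR R)) by exact: measurable_itv.
apply: (@Rdominated_cvg _ (measurableTypeR R) R (@lebesgue_measure R) setT measurableT
  (plateau a b) _ \1_I).
- move=> m; apply: continuous_measurable_fun; exact: continuous_plateau.
- by move=> t _; exact: plateau_cvg_indic.
- exact: integrable_indic_itv.
- move=> m t _; rewrite ger0_norm ?plateau_ge0// indicE.
  case: (boolP (t \in I)) => tI; first exact: plateau_le1.
  rewrite plateau_out//; apply: contra tI => /andP[h1 h2].
  apply/mem_set; rewrite /I /= in_itv /= (le_trans a0 (ltW h1)).
  by rewrite (le_trans (ltW h2)).
Qed.

(** The combination of c1 and c2 has integral zero, so its primitive returns to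
    zero at 1. *)
Lemma balanced_primitive (c1 c2 : R -> R) (m1 m2 : R) :
  continuous c1 -> continuous c2 ->
  (forall t, ~~ (0 < t < 1) -> c1 t = 0) -> (forall t, ~~ (0 < t < 1) -> c2 t = 0) ->
  \int[@lebesgue_measure R]_s c1 s = m1 -> \int[@lebesgue_measure R]_s c2 s = m2 ->
  exists H : R -> R, [/\ forall t, derivable H t 1,
    'D_1 H = (fun t => m2 * c1 t - m1 * c2 t) &
    forall t, ~~ (0 < t < 1) -> H t = 0].
Proof.
move=> cc1 cc2 out1 out2 m1E m2E.
have i1 := integrable_supp cc1 out1; have i2 := integrable_supp cc2 out2.
pose f t := m2 * c1 t - m1 * c2 t.
have cf : continuous f.
  by move=> t; apply: cvgB; apply: cvgM; [exact: cvg_cst|exact: cc1|exact: cvg_cst|exact: cc2].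
have f_out t : ~~ (0 < t < 1) -> f t = 0.
  by move=> t01; rewrite /f (out1 t t01) (out2 t t01) !mulr0 subrr.
have f0 : \int[@lebesgue_measure R]_t f t = 0.
  rewrite RintegralB; [|exact: measurableT|exact: integrable_scale..].
  by rewrite (RintegralZl m2 measurableT i1) (RintegralZl m1 measurableT i2) m1E m2E mulrC subrr.
exists (prim f); split; first by move=> t; case: (derivable_prim cf f_out t).
  exact: derive_prim cf f_out.
move=> t; rewrite negb_and -!leNgt => /orP[t0|t1]; first exact: prim_left f_out _ t0.
by rewrite (prim_right f_out).
Qed.

Definition widen (j : 'I_n) (c : R) (a : 'I_n -> R) : 'I_n -> R :=
  fun i => if i == j then c else a i.

(** Testing the vanishing gradient against H (z_j) times the bumps in the other
    coordinates, with H the primitive of balanced_primitive for the bumps on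
    (a_j, b_j) and (0, 1): a function without gradient has the same weighted
    average on a box and on the box stretched across the cube in direction j. *)
Lemma widen_transfer (phi : 'cV[R]_n -> R) (G : 'cV[R]_n -> 'cV[R]_n) a b (j : 'I_n) m :
  is_weak_grad setT phi G ->
  (\forall z \ae leb n, obox (fun=> 0) (fun=> 1) z -> G z = 0) ->
  (forall i, 0 <= a i) -> (forall i, b i <= 1) -> forall m1 m2 : R,
  \int[@lebesgue_measure R]_t plateau (a j) (b j) m t = m1 ->
  \int[@lebesgue_measure R]_t plateau 0 1 m t = m2 ->
  m2 * \int[leb n]_z (phi z * box_bump a b m z) =
  m1 * \int[leb n]_z (phi z * box_bump (widen j 0 a) (widen j 1 b) m z).
Proof.
move=> [lphi lG ibp] G0 a0 b1 m1 m2 m1E m2E.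
have p_out t : ~~ (0 < t < 1) -> plateau (a j) (b j) m t = 0.
  move=> t01; apply: plateau_out; apply: contra t01 => /andP[h1 h2].
  by rewrite (le_lt_trans (a0 j) h1) (lt_le_trans h2).
have [H [dH dHE H_out]] := balanced_primitive (@continuous_plateau R (a j) (b j) m)
  (@continuous_plateau R 0 1 m) p_out (@plateau_out R 0 1 m) m1E m2E.
pose rest (z : 'cV[R]_n) := \prod_(i < n | i != j) plateau (a i) (b i) m (z i ord0).
have C1H : C1 (fun z : 'cV[R]_n => H (z j ord0)).
  apply: C1_coord => //; rewrite dHE => t.
  by apply: cvgB; apply: cvgM; try exact: cvg_cst; exact: continuous_plateau.
have C1r : C1 rest.
  apply: C1_prod => i; apply: C1_coord; first exact: derivable_plateau.
  exact: continuous_derive_plateau.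
(* The weak gradient is known to vanish inside the cube only, and eta is zero
   outside. *)
pose eta := (fun z : 'cV[R]_n => H (z j ord0)) \* rest.
have eta_out z : ~ obox (fun=> 0) (fun=> 1) z -> eta z = 0.
  move=> zQ; have [i zi] : exists i, ~~ (0 < z i ord0 < 1).
    apply/existsP; rewrite -negb_forall; apply/negP => /forallP h; apply: zQ => i.
    by rewrite /= in_itv /= h.
  rewrite /eta /=; have [ij|ij] := eqVneq i j; first by rewrite -ij H_out// mul0r.
  rewrite /rest (bigD1 i)//= plateau_out ?mul0r ?mulr0//.
  apply: contra zi => /andP[h1 h2].
  by rewrite (le_lt_trans (a0 i) h1) (lt_le_trans h2).
have teta : test_function setT eta.
  split; first exact: C1M.
  exists (cbox (fun=> 0) (fun=> 1)); split => //; first exact: (@closed_box_compact R n).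
  by move=> z zc; apply: eta_out => /obox_cbox.
have deta z : 'D_(delta_mx j ord0) eta z =
    (m2 * plateau (a j) (b j) m (z j ord0) - m1 * plateau 0 1 m (z j ord0)) * rest z.
  rewrite (C1_deriveM _ _ C1H C1r) (derive_coord_comp _ _ _ dH) mxE !eqxx mul1r.
  rewrite (congr1 (fun g => g (z j ord0)) dHE).
  rewrite (_ : 'D_(delta_mx j ord0) rest z = 0) ?mulr0 ?add0r 1?mulrC//.
  apply: derive_line0; apply: filterE => h; apply: eq_bigr => i ij.
  by rewrite !mxE (negbTE ij) mulr0 add0r.
have := ibp _ teta j.
rewrite [X in _ = - X](_ : _ = 0); last first.
  have fe := test_factor teta.
  transitivity (\int[leb n]_(z in setT) (0 : R)); last by rewrite /Rintegral integral0.
  apply: ae_eq_Rintegral => //.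
    by have /measurable_int/measurable_EFinP := integrable_mul_factor measurableT (lG j) fe.
  apply: filterS G0 => z hz _; have [zQ|zQ] := pselect (obox (fun=> 0) (fun=> 1) z).
    by rewrite hz// mxE mul0r.
  by rewrite eta_out ?mulr0.
have bb1 z : box_bump a b m z = plateau (a j) (b j) m (z j ord0) * rest z.
  by rewrite /box_bump (bigD1 j).
have bb2 z : box_bump (widen j 0 a) (widen j 1 b) m z = plateau 0 1 m (z j ord0) * rest z.
  rewrite /box_bump (bigD1 j isT) {1 2}/widen eqxx; congr (_ * _).
  by apply: eq_bigr => i /negbTE ij; rewrite /widen ij.
have cfb (a' b' : 'I_n -> R) : compact_factor setT (box_bump a' b' m).
  by apply: test_factor; exact: test_function_box_bump.
have i1 := integrable_mul_factor measurableT lphi (cfb a b).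
have i2 := integrable_mul_factor measurableT lphi (cfb (widen j 0 a) (widen j 1 b)).
rewrite oppr0 => ib; apply/eqP; rewrite -subr_eq0; apply/eqP; rewrite -[RHS]ib.
rewrite -(RintegralZl m2 measurableT i1) -(RintegralZl m1 measurableT i2).
rewrite -(RintegralB measurableT (integrable_scale measurableT m2 i1)
  (integrable_scale measurableT m1 i2)).
apply: eq_Rintegral => z _.
rewrite deta bb1 bb2; move: (rest z) (plateau (a j) _ _ _) (plateau 0 _ _ _) => r s t.
by move: (phi z) => p; ring.
Qed.

Variables (phi : 'cV[R]_n -> R) (G : 'cV[R]_n -> 'cV[R]_n).
Hypothesis phiG : is_weak_grad setT phi G.
Hypothesis G0 : \forall z \ae leb n, obox (fun=> 0) (fun=> 1) z -> G z = 0.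

(** The limit of widen_transfer as the bumps tend to the indicators. *)
Lemma widen_integral0 a b (j : 'I_n) :
  (forall i, 0 <= a i) -> (forall i, b i <= 1) ->
  \int[leb n]_(z in obox (widen j 0 a) (widen j 1 b)) phi z = 0 ->
  \int[leb n]_(z in obox a b) phi z = 0.
Proof.
move=> a0 b1 w0; have [lphi _ _] := phiG.
have lim (a' b' : 'I_n -> R) := @box_bump_integral_cvg R n setT phi a' b' openT lphi (@subsetT _ _).
have m2cvg := @Rintegral_plateau_cvg 0 1 (lexx 0) (lexx 1).
have m1cvg := @Rintegral_plateau_cvg (a j) (b j) (a0 j) (b1 j).
have L1 : \int[@lebesgue_measure R]_t (\1_(`]0, 1[%classic) t : R) = 1.
  rewrite /Rintegral integral_indic//= setIT lebesgue_measure_itv /= lte_fin ltr01.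
  by rewrite -EFinB subr0.
have c1 : ((\int[@lebesgue_measure R]_t plateau 0 1 m t) *
    \int[leb n]_z (phi z * box_bump a b m z)) @[m --> \oo] --> \int[leb n]_(z in obox a b) phi z.
  by rewrite L1 in m2cvg; rewrite -[X in _ --> X]mul1r; apply: cvgM; [exact: m2cvg|exact: lim].
have c2 : ((\int[@lebesgue_measure R]_t plateau (a j) (b j) m t) *
    \int[leb n]_z (phi z * box_bump (widen j 0 a) (widen j 1 b) m z)) @[m --> \oo] --> (0 : R).
  rewrite -[X in _ --> X](mulr0 (\int[@lebesgue_measure R]_t (\1_(`]a j, b j[%classic) t : R))).
  by apply: cvgM; [exact: m1cvg|rewrite -[X in _ --> X]w0; exact: lim].
apply: (cvg_eq_to0 c1 c2) => m.
exact: (widen_transfer phiG G0 a0 b1 erefl erefl).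
Qed.

(** Stretching the coordinates one after the other leads from any box to the
    whole cube; m counts the coordinates that are still to be stretched. *)
Lemma box_integral0 m a b : \int[leb n]_(z in obox (fun=> 0) (fun=> 1)) phi z = 0 ->
  (forall i, 0 <= a i) -> (forall i, b i <= 1) ->
  (forall i : 'I_n, (m <= i)%N -> a i = 0 /\ b i = 1) ->
  \int[leb n]_(z in obox a b) phi z = 0.
Proof.
move=> mean0; elim: m a b => [|m IH] a b a0 b1 ab.
  have -> : a = fun=> 0 by apply/funext => i; case: (ab i (leq0n _)).
  by have -> : b = fun=> 1 by apply/funext => i; case: (ab i (leq0n _)).
have [nm|mn] := leqP n m.
  by apply: IH => // i; rewrite leqNgt (leq_trans (ltn_ord i) nm).
apply: (@widen_integral0 _ _ (Ordinal mn) a0 b1); apply: IH => i.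
- by rewrite /widen; case: ifP.
- by rewrite /widen; case: ifP.
rewrite /widen; case: eqP => // im mi; apply: ab; rewrite ltn_neqAle mi andbT.
by apply/eqP => mi'; apply: im; exact: val_inj.
Qed.

Lemma zero_on_cube : \int[leb n]_(z in obox (fun=> 0) (fun=> 1)) phi z = 0 ->
  \forall z \ae leb n, obox (fun=> 0) (fun=> 1) z -> phi z = 0.
Proof.
move=> mean0; have [[_ intphi] _ _] := phiG; apply: ae_zero_boxes.
  apply: integrableS (intphi _ (@closed_box_compact R n (fun=> 0) (fun=> 1)) (@subsetT _ _)).
  - exact: compact_measurable_cV (@closed_box_compact R n _ _).
  - exact: measurable_obox.
  - exact: obox_cbox.
move=> a b a0 b1; apply: (@box_integral0 n) => // i.
by rewrite leqNgt ltn_ord.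
Qed.

End constancy.

Section periodicity.
Context {R : realType} {k : nat}.
Variable phi : 'cV[R]_k -> R.

Definition ae_period (v : 'cV[R]_k) : Prop := \forall x \ae leb k, phi (x + v) = phi x.

Lemma ae_period0 : ae_period 0.
Proof. by apply: aeW => x; rewrite addr0. Qed.

Lemma ae_periodD u v : ae_period u -> ae_period v -> ae_period (u + v).
Proof.
move=> pu pv; have := ae_shift u pv; move: pu; apply: filterS2 => x <- <-.
by rewrite addrA.
Qed.

Lemma ae_periodN v : ae_period v -> ae_period (- v).
Proof. by move=> /(ae_shift (- v)); apply: filterS => x <-; rewrite subrK. Qed.

Hypothesis periodic : forall i : 'I_k, ae_period (delta_mx i ord0).

Lemma ae_period_int (v : 'cV[int]_k) : ae_period (map_mx intr v).
Proof.
have -> : map_mx intr v = \sum_i (v i ord0)%:~R *: (delta_mx i ord0 : 'cV[R]_k).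
  apply/colP => i; rewrite mxE summxE (bigD1 i)//= big1 ?addr0 => [|j ji].
    by rewrite !mxE !eqxx mulr1.
  by rewrite !mxE eq_sym (negbTE ji) mulr0.
apply: big_ind => [|u w|i _]; [exact: ae_period0|exact: ae_periodD|].
have nat_mul m : ae_period ((delta_mx i ord0 : 'cV[R]_k) *+ m).
  elim: m => [|m IH]; first by rewrite mulr0n; exact: ae_period0.
  by rewrite mulrS; exact: ae_periodD.
by rewrite scaler_int; case: (v i ord0) => m; [|rewrite NegzE mulrNz; apply: ae_periodN]; exact: nat_mul.
Qed.

(** Almost every point is carried into the open cube by an integer vector; the
    exceptional points have an integer coordinate. *)
Lemma ae_zero_of_cube : (\forall x \ae leb k, cubeQ x -> phi x = 0) ->
  \forall x \ae leb k, phi x = 0.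
Proof.
move=> phi0.
have h1 := ae_forall_count ae_period_int.
have h2 := ae_forall_count (fun v : 'cV[int]_k => ae_shift (map_mx intr v) phi0).
have h3 : \forall x \ae leb k, forall p : 'I_k * int, (x : 'cV[R]_k) p.1 ord0 <> p.2%:~R.
  apply: ae_forall_count => -[i c] /=; exists [set x : 'cV[R]_k | x i ord0 = c%:~R]; split.
  - by have := measurable_coord i measurableT (measurable_set1 (c%:~R : R)); rewrite setTI.
  - exact: leb_hyperplane.
  - by move=> x /= /contrapT.
move: h1 h2 h3; apply: filterS3 => x per zero off.
(* The fractional parts of the coordinates are positive off the null set. *)
pose v : 'cV[int]_k := \col_i - Num.floor (x i ord0).
rewrite -(per v); apply: (zero v) => i; rewrite !mxE.
have := off (i, Num.floor (x i ord0)) => /= xi.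
rewrite intrN subr_gt0 ltrBlDr addrC -intrD1 floorD1_gt andbT lt_neqAle floor_le andbT.
by apply/eqP => xE; apply: xi; rewrite xE.
Qed.

End periodicity.

(** * Traces of limits *)

Section finite_sums.
Context d (T : measurableType d) (R : realType) (mu : {measure set T -> \bar R}).
Variables (D : set T) (mD : measurable D).

Lemma integrable_Rsum (I : Type) (s : seq I) (f : I -> T -> R) :
  (forall i, mu.-integrable D (EFin \o f i)) ->
  mu.-integrable D (EFin \o (fun x => \sum_(i <- s) f i x)) /\
  \int[mu]_(x in D) (\sum_(i <- s) f i x) = \sum_(i <- s) \int[mu]_(x in D) f i x.
Proof.
move=> intf; elim: s => [|i s [ih1 ih2]].
  under [X in EFin \o X]eq_fun do rewrite big_nil.
  split; first exact: integrable0.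
  by rewrite big_nil; under eq_Rintegral do rewrite big_nil; rewrite /Rintegral integral0.
split.
  have := integrableD mD (intf i) ih1; apply: eq_integrable => // x _ /=.
  by rewrite big_cons.
rewrite big_cons -ih2 -(RintegralD mD (intf i) ih1).
by apply: eq_Rintegral => x _; rewrite big_cons.
Qed.

End finite_sums.

Section trace_estimate.
Context {R : realType} {k : nat}.
Notation N := k.+1.
Implicit Types (u v w : 'cV[R]_N -> 'cV[R]_N) (T : 'cV[R]_k -> 'cV[R]_N) (d : R).

Lemma frob_col n (x y : 'cV[R]_n) : frob x y = \sum_i x i ord0 * y i ord0.
Proof. by rewrite frobE; apply: eq_bigr => i _; rewrite big_ord1. Qed.

(** The scalar trace inequality, summed over the components. *)
Lemma calV_trace_inequality d u : 0 < d -> calV d u ->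
  square_integrable (mu := leb k) cubeQ (fun x => u (vsnoc x d)) /\
  \int[leb k]_(x in cubeQ) frob (u (vsnoc x d)) (u (vsnoc x d)) <=
  d * \int[leb N]_(z in Omega d) frob (weak_jac (Omega d) u z) (weak_jac (Omega d) u z).
Proof.
move=> d0 cu; have uJ := calV_jac cu; have [[_ _ bJ] contu u0 _] := cu.
have [C C0 JC] := ess_bounded_entry bJ.
pose J := weak_jac (strip d) u; pose f i (z : 'cV[R]_N) := u z i ord0.
have cf i : {within closed_strip d, continuous (f i)} by exact: within_continuous_coord.
have f0 i x : f i (vsnoc x 0) = 0 by rewrite /f u0 mxE.
have GC i j : \forall z \ae leb N, strip d z -> `|(row i (J z))^T j ord0| <= C.
  by apply: filterS (JC i j) => z h sz; have := h sz; rewrite !mxE.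
have tr i := trace_inequality d0 (uJ i) (cf i) (f0 i) (GC i).
have [int1 sum1] := integrable_Rsum (@measurable_cubeQ R k) (index_enum 'I_N) (fun i => (tr i).1).
have frobu x : frob (u (vsnoc x d)) (u (vsnoc x d)) = \sum_i f i (vsnoc x d) ^+ 2.
  by rewrite frob_col; apply: eq_bigr => i _; rewrite -expr2.
split.
  split.
    move=> i j; rewrite (ord1 j); apply: measurable_funTS; apply: continuous_measurable_cV.
    exact: (continuous_face d0 (cf i)).
  by move: int1; apply: eq_integrable => [|x _ /=]; [exact: measurable_cubeQ|rewrite frobu].
have -> : \int[leb k]_(x in cubeQ) frob (u (vsnoc x d)) (u (vsnoc x d)) =
    \int[leb k]_(x in cubeQ) (\sum_i f i (vsnoc x d) ^+ 2).
  by apply: eq_Rintegral => x _; exact: frobu.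
rewrite sum1.
have oO := @open_Omega R k d; have mO := @measurable_Omega R k d.
have uJO := is_weak_jac_sub (@open_strip R k d) oO (@Omega_strip R k d) uJ.
have [_ iJ] := (H1_square_integrable oO (calV_H1 cu)).2.
have mJ := mx_measurable_jac uJO.
have intN i : (leb N).-integrable (Omega d) (EFin \o (fun z => J z i ord_max ^+ 2)).
  apply: (ae_le_integrable mO _ _ iJ); first by apply: measurable_funX; exact: mJ.
  have := weak_jac_ae oO uJO; apply: filterS => z h Oz.
  by rewrite ger0_norm ?sqr_ge0// h// frob_entry.
have [int2 sum2] := integrable_Rsum mO (index_enum 'I_N) intN.
apply: (@le_trans _ _ (d * \int[leb N]_(z in Omega d) \sum_i J z i ord_max ^+ 2)).
  rewrite sum2 mulr_sumr; apply: ler_sum => i _.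
  apply: le_trans (tr i).2 _; rewrite (_ : \int[_]_(z in _) _ = \int[leb N]_(z in Omega d) J z i ord_max ^+ 2)//.
  by apply: eq_Rintegral => z _; rewrite !mxE.
apply: ler_wpM2l; first exact: ltW.
apply: (ae_le_Rintegral mO int2 iJ).
have := weak_jac_ae oO uJO; apply: filterS => z h Oz; rewrite h// frobE.
apply: ler_sum => i _; rewrite (bigD1 ord_max)//= expr2 lerDl.
by apply: sumr_ge0 => j _; rewrite -expr2 sqr_ge0.
Qed.

(** The difference of the two sides is t times the squared norm of
    X + (X - Y) / t. *)
Lemma frob_young m n (t : R) (X Y : 'M[R]_(m, n)) : 0 < t ->
  frob Y Y <= (1 + t) * frob X X + (1 + t^-1) * frob (X - Y) (X - Y).
Proof.
move=> t0; rewrite !frobE !mulr_sumr -big_split /=; apply: ler_sum => i _.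
rewrite !mulr_sumr -big_split /=; apply: ler_sum => j _; rewrite !mxE.
move: (X i j) (Y i j) => x y; rewrite -subr_ge0.
rewrite (_ : _ - _ = t * (x + (x - y) / t) ^+ 2); last by field; rewrite gt_eqF.
by rewrite mulr_ge0 ?sqr_ge0// ltW.
Qed.

Lemma cvg0_near_lt (f : nat -> \bar R) (e : R) : f i @[i --> \oo] --> 0%E -> 0 < e ->
  \forall i \near \oo, (f i < e%:E)%E.
Proof.
move=> f0 e0; apply: (f0 [set x | (x < e%:E)%E]).
by apply: open_nbhs_nbhs; split; [exact: open_ereal_lt_ereal|rewrite /= lte_fin].
Qed.

Lemma trace_approximation d v T (e : R) : calVt d v -> is_trace d v T -> 0 < e ->
  exists u, [/\ calV d u,
    \int[leb N]_(z in Omega d) frob (weak_jac (Omega d) u z - weak_jac (Omega d) v z)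
      (weak_jac (Omega d) u z - weak_jac (Omega d) v z) <= e &
    (sqnormL2 cubeQ (fun x => (u (vsnoc x d) - T x)%R) < e%:E)%E].
Proof.
move=> [hv _] [_ [u [cu uv uT]]] e0.
have [i [h1 h2]] := filter_ex (filterI (cvg0_near_lt uv e0) (cvg0_near_lt uT e0)).
exists (u i); split => //; move: h1; rewrite (sqnormH1B (@open_Omega R k d) (calV_H1 (cu i)) hv).
rewrite lte_fin => /ltW; apply: le_trans; rewrite lerDr.
by apply: Rintegral_ge0 => z _; exact: frob_ge0.
Qed.

Lemma is_trace_square_integrable d v T : 0 < d -> calVt d v -> is_trace d v T ->
  square_integrable (mu := leb k) cubeQ T.
Proof.
move=> d0 cv vT; have [u [cu _ uT]] := trace_approximation cv vT ltr01.
have mQ := @measurable_cubeQ R k.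
have [iU _] := calV_trace_inequality d0 cu; have [mU _] := iU.
have mT : mx_measurable cubeQ T.
  by move=> i j; rewrite (ord1 j); exact: (measurableT_comp (measurable_coord i) vT.1).
have mB : mx_measurable cubeQ (fun x => u (vsnoc x d) - T x).
  move=> i j; rewrite (_ : (fun x => _) = (fun x => u (vsnoc x d) i j - T x i j)); last first.
    by apply/funext => x; rewrite !mxE.
  by apply: measurable_funB; [exact: mU|exact: mT].
have iB : square_integrable (mu := leb k) cubeQ (fun x => u (vsnoc x d) - T x).
  split=> //; apply/integrableP; split; first by apply/measurable_EFinP; exact: measurable_frob.
  apply: (@le_lt_trans _ _ (sqnormL2 cubeQ (fun x => (u (vsnoc x d) - T x)%R))).
    rewrite /sqnormL2 le_eqVlt; apply/orP; left; apply/eqP.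
    by apply: eq_integral => x _ /=; rewrite ger0_norm ?frob_ge0.
  exact: lt_trans uT (ltry _).
have := square_integrableB mQ iU iB; congr square_integrable.
by apply/funext => x; rewrite opprB addrC subrK.
Qed.

Variables (W : 'M[R]_N -> R) (M : 'M[R]_N).
Hypothesis Bl : forall a X X' Y, D2 W M (a *: X + X') Y = a * D2 W M X Y + D2 W M X' Y.
Hypothesis Br : forall a X Y Y', D2 W M X (a *: Y + Y') = a * D2 W M X Y + D2 W M X Y'.

(** Expand the form at the gradient of u written as that of v plus an error of
    L^2 norm at most t; Young's inequality with weight t makes each of the
    cross terms O(t), uniformly in u. *)
Lemma hessW_form_perturbation d v : H1 (Omega d) v -> exists2 C : R, 0 <= C &
  forall u t, H1 (Omega d) u -> 0 < t < 1 ->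
    \int[leb N]_(z in Omega d) frob (weak_jac (Omega d) u z - weak_jac (Omega d) v z)
      (weak_jac (Omega d) u z - weak_jac (Omega d) v z) <= t ^+ 2 ->
    hessW_form W d M u u <= hessW_form W d M v v + C * t.
Proof.
move=> hv; have oO := @open_Omega R k d; have mO := @measurable_Omega R k d.
have [K K0 BK] := bilinear_young Bl Br.
set J := weak_jac (Omega d) v.
set I := \int[leb N]_(z in Omega d) frob (J z) (J z).
have I0 : 0 <= I by apply: Rintegral_ge0 => z _; exact: frob_ge0.
(* Young's inequality leaves 2 K t I and 2 K (t^-1 + 1) times the squared norm
   of the error; the latter is at most 4 K t. *)
exists (2 * K * (I + 2)); first by rewrite mulr_ge0 ?addr_ge0// mulr_ge0.
move=> u t hu /andP[t0 t1]; set J' := weak_jac (Omega d) u; set b := \int[_]_(z in _) _ => bt.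
have [_ iJ] := H1_square_integrable oO hv; have [_ iJ'] := H1_square_integrable oO hu.
have iE := square_integrableB mO iJ' iJ.
have iB X Y := @integrable_bilinear _ _ _ _ Bl Br _ _ (leb N) _ mO X Y.
have i1 := iB _ _ iJ' iJ'; have i2 := iB _ _ iJ iJ.
have i3 := integrable_scale mO (2 * K * t) iJ.2.
have i4 := integrable_scale mO (2 * K * (t^-1 + 1)) iE.2.
have i34 : (leb N).-integrable (Omega d) (EFin \o (fun z => 2 * K * t * frob (J z) (J z) +
    2 * K * (t^-1 + 1) * frob (J' z - J z) (J' z - J z))).
  by have := integrableD mO i3 i4; apply: eq_integrable.
have i5 : (leb N).-integrable (Omega d) (EFin \o (fun z => D2 W M (J z) (J z) +
    (2 * K * t * frob (J z) (J z) + 2 * K * (t^-1 + 1) * frob (J' z - J z) (J' z - J z)))).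
  by have := integrableD mO i2 i34; apply: eq_integrable.
have := ae_le_Rintegral mO i1 i5.
rewrite (RintegralD mO i2 i34) (RintegralD mO i3 i4) (RintegralZl _ mO iJ.2) (RintegralZl _ mO iE.2).
move=> h; apply: (le_trans (h _)).
  apply: aeW => z _; pose e := J' z - J z.
  change (D2 W M (J' z) (J' z) <= D2 W M (J z) (J z) +
    (2 * K * t * frob (J z) (J z) + 2 * K * (t^-1 + 1) * frob e e)).
  have := bilinear_quadraticD Bl Br e (J z); rewrite {1 2}/e subrK => ->.
  have tV : 0 < t^-1 by rewrite invr_gt0.
  have b1 := le_trans (ler_norm _) (BK t^-1 e (J z) tV).
  have b2 := le_trans (ler_norm _) (BK t (J z) e t0).
  have b3 := le_trans (ler_norm _) (BK 1 e e ltr01).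
  move: b1 b2 b3; rewrite invrK invr1.
  move: (D2 _ _ _ _) (D2 _ _ _ _) (D2 _ _ _ _) (D2 _ _ _ _) => x1 x2 x3 x4.
  move: (frob e e) (frob (J z) (J z)) => p q b1 b2 b3.
  have -> : x1 + (2 * K * t * q + 2 * K * (t^-1 + 1) * p) =
    K * (1 * p + 1 * p) + K * (t^-1 * p + t * q) + K * (t * q + t^-1 * p) + x1 by ring.
  by rewrite lerD2r !lerD.
rewrite lerD2l.
have tb : (t^-1 + 1) * b <= 2 * t.
  apply: (@le_trans _ _ ((t^-1 + 1) * t ^+ 2)).
    by rewrite ler_wpM2l// addr_ge0// invr_ge0 ltW.
  rewrite mulrDl mul1r expr2 mulKf ?gt_eqF// mulr_natl mulr2n lerD2l.
  by rewrite ler_piMr ?ltW.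
have -> : 2 * K * (I + 2) * t = 2 * K * t * I + 2 * K * (2 * t) by ring.
by rewrite lerD2l -mulrA ler_wpM2l ?mulr_ge0.
Qed.

Lemma ler_add_small (x y C : R) : (forall t, 0 < t < 1 -> x <= y + C * t) -> x <= y.
Proof.
move=> h; apply/ler_addgt0Pr => e e0; pose D := `|C| + 1 + e.
have C0 : 0 <= `|C| by [].
have D0 : 0 < D by rewrite /D; lra.
have t01 : 0 < e / D < 1.
  by rewrite divr_gt0// ltr_pdivrMr// mul1r /D; lra.
apply: le_trans (h _ t01) _; rewrite lerD2l mulrCA ger_pMr// ler_pdivrMr// mul1r.
by rewrite (le_trans (ler_norm C))// /D; lra.
Qed.

(** For u in calV the bound holds by coercivity and the trace inequality. The
    trace of v and the form at v are limits of those of such u, taken here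
    with errors t ^+ 2 and with all the losses gathered in a term linear in t. *)
Lemma trace_bound d v T (c0 : R) : 0 < d -> 0 < c0 ->
  (forall u, calV d u ->
    c0 * \int[leb N]_(z in Omega d) frob (weak_jac (Omega d) u z) (weak_jac (Omega d) u z)
      <= hessW_form W d M u u) ->
  calVt d v -> is_trace d v T ->
  c0 * \int[leb k]_(x in cubeQ) frob (T x) (T x) <= d * hessW_form W d M v v.
Proof.
move=> d0 c00 coer cv vT; have mQ := @measurable_cubeQ R k.
have iT := is_trace_square_integrable d0 cv vT.
have [C C0 pert] := hessW_form_perturbation cv.1.
set F := hessW_form W d M v v in pert *.
apply: (@ler_add_small _ _ (d * (`|F| + 2 * C) + 2 * c0)) => t t01.
have /andP[t0 t1] := t01.
have [u [cu uv uT]] := trace_approximation cv vT (exprn_gt0 2 t0).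
have Fu := pert u t (calV_H1 cu) t01 uv.
have [iU tr] := calV_trace_inequality d0 cu.
have iB := square_integrableB mQ iU iT.
have B2 : \int[leb k]_(x in cubeQ) frob (u (vsnoc x d) - T x) (u (vsnoc x d) - T x) <= t ^+ 2.
  by move: uT; rewrite /sqnormL2 (EFin_Rintegral mQ iB.2) lte_fin => /ltW.
have i1 := integrable_scale mQ (1 + t) iU.2.
have i2 := integrable_scale mQ (1 + t^-1) iB.2.
have i12 : (leb k).-integrable cubeQ (EFin \o (fun x =>
    (1 + t) * frob (u (vsnoc x d)) (u (vsnoc x d)) +
    (1 + t^-1) * frob (u (vsnoc x d) - T x) (u (vsnoc x d) - T x))).
  by have := integrableD mQ i1 i2; apply: eq_integrable.
have := ae_le_Rintegral mQ iT.2 i12.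
rewrite (RintegralD mQ i1 i2) (RintegralZl _ mQ iU.2) (RintegralZl _ mQ iB.2).
move=> /(_ ltac:(by apply: aeW => x _; exact: frob_young)).
have := coer u cu; move: B2 tr Fu.
move: (hessW_form _ _ _ u u) (\int[leb N]_(z in Omega d) _) => Fu E.
move: (\int[_]_(x in _) frob (u _ - _) _) (\int[_]_(x in _) frob (u _) _) (\int[_]_(x in _) frob (T x) _).
move=> b e x bt eE FuF cE xle.
have h1 : (1 + t^-1) * b <= 2 * t.
  apply: (@le_trans _ _ ((1 + t^-1) * t ^+ 2)).
    by rewrite ler_wpM2l// addr_ge0// invr_ge0 ltW.
  rewrite mulrDl mul1r expr2 mulKf ?gt_eqF// mulr_natl mulr2n lerD2r.
  by rewrite ler_piMr ?ltW.
have h2 : c0 * e <= d * (F + C * t).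
  apply: (@le_trans _ _ (d * (c0 * E))); first by rewrite mulrCA ler_wpM2l// ltW.
  by rewrite ler_pM2l// (le_trans cE).
apply: (@le_trans _ _ (c0 * ((1 + t) * e + 2 * t))).
  by rewrite ler_pM2l// (le_trans xle)// lerD2l.
apply: (@le_trans _ _ ((1 + t) * (d * (F + C * t)) + 2 * c0 * t)).
  rewrite mulrDr mulrCA (mulrA c0) (mulrC c0 2) lerD2r; apply: ler_wpM2l h2.
  by rewrite addr_ge0// ltW.
have hF : d * (t * F) <= d * (t * `|F|) by rewrite !ler_wpM2l ?ler_norm ?ltW.
have hC : d * (C * t * t) <= d * (C * t).
  by rewrite ler_pM2l//; apply: ler_piMr; [apply: mulr_ge0 => //; exact: ltW|exact: ltW].
have -> : (1 + t) * (d * (F + C * t)) + 2 * c0 * t =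
  d * F + d * (C * t) + d * (t * F) + d * (C * t * t) + 2 * c0 * t by ring.
have -> : d * F + (d * (`|F| + 2 * C) + 2 * c0) * t =
  d * F + d * (C * t) + d * (t * `|F|) + d * (C * t) + 2 * c0 * t by ring.
by rewrite lerD2r lerD// lerD2l.
Qed.

End trace_estimate.

(** * Positivity of the second variation *)

Section stability.
Context {R : realType} {k : nat}.
Notation N := k.+1.
Implicit Types (v : 'cV[R]_N -> 'cV[R]_N) (phi : 'cV[R]_k -> R) (d : R).

Lemma frob_vsnoc (x y : 'cV[R]_k) (a b : R) : frob (vsnoc x a) (vsnoc y b) = frob x y + a * b.
Proof.
rewrite !frob_col big_ord_recr /= !vsnoc_max; congr (_ + _).
apply: eq_bigr => i _.
have -> : widen_ord (leqnSn k) i = lift ord_max i by apply/val_inj/esym; exact: lift_max.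
by rewrite !vsnoc_lift.
Qed.

Lemma frob0r m n (X : 'M[R]_(m, n)) : frob X 0 = 0.
Proof. by rewrite /frob mulmx0 linear0. Qed.

Lemma tgrad_square_integrable phi : H1loc phi ->
  square_integrable (mu := leb k) cubeQ (tgrad phi).
Proof.
move=> [dphi fin]; have [lphi lG _] := is_weak_grad_weak_grad dphi.
have mQ := @measurable_cubeQ R k.
have mg : mx_measurable cubeQ (tgrad phi).
  move=> i j; rewrite (ord1 j); case: (unliftP ord_max i) => [i' ->|->].
    under eq_fun do rewrite vsnoc_lift.
    by apply: measurable_funTS; have := (lG i').1.
  by rewrite (_ : (fun z => _) = fun=> 0)//; apply/funext => z; rewrite /tgrad vsnoc_max.
split=> //; apply/integrableP; split; first by apply/measurable_EFinP; exact: measurable_frob.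
have cK := @closed_box_compact R k (fun=> 0) (fun=> 1).
have mK := compact_measurable_cV cK.
have mgK : measurable_fun (cbox (fun=> 0) (fun=> 1))
    (fun x => (phi x ^+ 2 + frob (weak_grad setT phi x) (weak_grad setT phi x))%:E).
  apply/measurable_EFinP; apply: measurable_funTS; apply: measurable_funD.
    by apply: measurable_funX; exact: lphi.1.
  by apply: measurable_frob => i j; rewrite (ord1 j); exact: (lG i).1.
apply: le_lt_trans (fin _ cK).
have QK : @cubeQ R k `<=` cbox (fun=> 0) (fun=> 1) by rewrite cubeQ_obox; exact: obox_cbox.
apply: (@le_trans _ _ (\int[leb k]_(x in @cubeQ R k)
    (phi x ^+ 2 + frob (weak_grad setT phi x) (weak_grad setT phi x))%:E)%E).
  apply: ge0_le_integral => //.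
  - by apply: measurableT_comp => //; apply/measurable_EFinP; exact: measurable_frob.
  - exact: measurable_funS mgK.
  - move=> x _ /=; rewrite lee_fin ger0_norm ?frob_ge0// frob_vsnoc mul0r addr0.
    by rewrite lerDr sqr_ge0.
apply: ge0_subset_integral => // x _; rewrite lee_fin addr_ge0 ?sqr_ge0//; exact: frob_ge0.
Qed.

Lemma square_integrable_mulmx (P : 'M[R]_N) : exists2 C : R, 0 <= C &
  forall g : 'cV[R]_k -> 'cV[R]_N, square_integrable (mu := leb k) cubeQ g ->
  square_integrable (mu := leb k) cubeQ (fun x => P *m g x) /\
  \int[leb k]_(x in cubeQ) frob (P *m g x) (P *m g x) <=
    C * \int[leb k]_(x in cubeQ) frob (g x) (g x).
Proof.
have mQ := @measurable_cubeQ R k.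
pose B (X Y : 'cV[R]_N) := frob (P *m X) (P *m Y).
have Bl' a X X' Y : B (a *: X + X') Y = a * B X Y + B X' Y.
  by rewrite /B mulmxDr -scalemxAr frob_linearl.
have Br' a X Y Y' : B X (a *: Y + Y') = a * B X Y + B X Y'.
  by rewrite /B mulmxDr -scalemxAr frob_linearr.
have [K K0 BK] := bilinear_young Bl' Br'; exists (2 * K); first by rewrite mulr_ge0.
move=> g ig; have iB := integrable_bilinear Bl' Br' mQ ig ig.
split.
  split=> // i j; have [mg _] := ig.
  under eq_fun do rewrite mxE.
  by apply: measurable_sum => l; apply: measurable_funM; [exact: measurable_cst|exact: mg].
rewrite -(RintegralZl _ mQ ig.2).
apply: (ae_le_Rintegral mQ iB (integrable_scale mQ (2 * K) ig.2)).
apply: aeW => x _; have := le_trans (ler_norm _) (BK 1 (g x) (g x) ltr01).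
rewrite invr1 mul1r /B => /le_trans; apply.
by rewrite mulrDr -mulrA mulr_natl mulr2n.
Qed.

Lemma zero_gradient phi : H1per phi ->
  \int[leb k]_(x in cubeQ) frob (tgrad phi x) (tgrad phi x) = 0 ->
  \forall x \ae leb k, phi x = 0.
Proof.
move=> [hphi per mean0] I0; have mQ := @measurable_cubeQ R k.
have [mg ig] := tgrad_square_integrable hphi.
apply: ae_zero_of_cube per _; rewrite cubeQ_obox.
apply: (zero_on_cube (is_weak_grad_weak_grad hphi.1)); last by rewrite -cubeQ_obox.
rewrite -cubeQ_obox.
have mf := measurable_frob mg mg.
have : ae_eq (leb k) cubeQ (EFin \o (fun x => frob (tgrad phi x) (tgrad phi x))) (cst 0%E).
  apply/(ae_eq_integral_abs _ mQ); first exact/measurable_EFinP.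
  rewrite -[RHS]/((0 : R)%:E) -I0 -(EFin_Rintegral mQ ig).
  by apply: eq_integral => x _ /=; rewrite ger0_norm ?frob_ge0.
apply: filterS => x h Qx; have [] := h Qx.
rewrite frob_vsnoc mul0r addr0 => f0; apply/colP => i; rewrite mxE; apply/eqP.
by rewrite -sqrf_eq0 eq_le sqr_ge0 andbT -f0 frob_entry.
Qed.

(** (grad phi, 0) is orthogonal to the unit vector eN, so ellipticity applies
    pointwise. *)
Lemma surface_energy_bound (psi : 'cV[R]_N -> R) (cbar : R) phi :
  Ck 3 [set z | z != 0] psi ->
  (forall v w : 'cV[R]_N, enorm v = 1 -> w != 0 -> frob v w = 0 ->
     cbar * enorm w ^+ 2 < D2 psi v w w) -> H1loc phi ->
  cbar * \int[leb k]_(x in cubeQ) frob (tgrad phi x) (tgrad phi x) <=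
  \int[leb k]_(x in cubeQ) D2 psi eN (tgrad phi x) (tgrad phi x).
Proof.
move=> psiC3 ell hphi; have mQ := @measurable_cubeQ R k.
have ig := tgrad_square_integrable hphi.
have eNE : eN = vsnoc 0 1 :> 'cV[R]_N.
  apply/colP => i; case: (unliftP ord_max i) => [j|] ->.
    by rewrite vsnoc_lift !mxE eq_sym (negbTE (neq_lift _ _)).
  by rewrite vsnoc_max mxE !eqxx.
have eN1 : enorm (eN : 'cV[R]_N) = 1.
  by rewrite /enorm eNE frob_vsnoc frob0r add0r mulr1 sqrtr1.
have eN0 : [set z : 'cV[R]_N | z != 0] eN.
  apply/eqP => e0; move: eN1; rewrite e0 /enorm frob0r sqrtr0 => /eqP.
  by rewrite eq_sym oner_eq0.
have Bl' := D2_linearl eN0 psiC3; have Br' := D2_linearr (@open_neq0 R N) eN0 psiC3.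
rewrite -(RintegralZl _ mQ ig.2).
apply: (ae_le_Rintegral mQ (integrable_scale mQ cbar ig.2) (integrable_bilinear Bl' Br' mQ ig ig)).
apply: aeW => x _; have [->|t0] := eqVneq (tgrad phi x) 0.
  by rewrite frob0r mulr0 (bilinear0r Br').
have := ell eN (tgrad phi x) eN1 t0.
rewrite /enorm sqr_sqrtr ?frob_ge0// => /(_ _)/ltW; apply.
by rewrite eNE frob_vsnoc mulr0 addr0 frob0l.
Qed.

Variables (W : 'M[R]_N -> R) (M : 'M[R]_N).
Hypothesis Bl : forall a X X' Y, D2 W M (a *: X + X') Y = a * D2 W M X Y + D2 W M X' Y.
Hypothesis Br : forall a X Y Y', D2 W M X (a *: Y + Y') = a * D2 W M X Y + D2 W M X Y'.

Lemma frob_product_le m n (a b : R) (X Y : 'M[R]_(m, n)) :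
  2 * a * b * frob X Y <= a ^+ 2 * frob X X + b ^+ 2 * frob Y Y.
Proof.
rewrite !frobE !mulr_sumr -big_split /=; apply: ler_sum => i _.
rewrite !mulr_sumr -big_split /=; apply: ler_sum => j _.
move: (X i j) (Y i j) => x y; rewrite -subr_ge0.
by rewrite (_ : _ - _ = (a * x - b * y) ^+ 2) ?sqr_ge0//; ring.
Qed.

(** The form at v is the pairing of g with the trace T of v. Young's inequality
    bounds 2 d c0 times this pairing by d^2 |g|^2 + c0^2 |T|^2, and trace_bound
    lets the left-hand side absorb the last term. *)
Lemma elastic_energy_bound d (c0 : R) v (g : 'cV[R]_k -> 'cV[R]_N) : 0 < d -> 0 < c0 ->
  (forall u, calV d u ->
    c0 * \int[leb N]_(z in Omega d) frob (weak_jac (Omega d) u z) (weak_jac (Omega d) u z)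
      <= hessW_form W d M u u) ->
  calVt d v -> square_integrable (mu := leb k) cubeQ g ->
  hessW_form W d M v v = \int[leb k]_(x in cubeQ) frob (g x) (trace d v x) ->
  c0 * hessW_form W d M v v <= d * \int[leb k]_(x in cubeQ) frob (g x) (g x).
Proof.
move=> d0 c00 coer cv ig vE; have mQ := @measurable_cubeQ R k.
set G := \int[leb k]_(x in cubeQ) _.
have G0 : 0 <= G by apply: Rintegral_ge0 => x _; exact: frob_ge0.
have [[T vT]|noT] := pselect (exists T, is_trace d v T); last first.
  (* Without a trace the default value 0 makes the form vanish. *)
  rewrite vE /trace xgetPN; last by move=> T vT; apply: noT; exists T.
  under eq_Rintegral do rewrite frob0r.
  by rewrite /Rintegral integral0 mulr0 mulr_ge0// ltW.
have {}vT : is_trace d v (trace d v) by rewrite /trace; case: xgetP => [T' _|/(_ T)].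
have iT := is_trace_square_integrable d0 cv vT.
have TF := trace_bound Bl Br d0 c00 coer cv vT.
have iB := integrable_bilinear (@frob_linearl R N 1) (@frob_linearr R N 1) mQ ig iT.
have i1 := integrable_scale mQ (d ^+ 2) ig.2.
have i2 := integrable_scale mQ (c0 ^+ 2) iT.2.
have i12 : (leb k).-integrable cubeQ (EFin \o (fun x =>
    d ^+ 2 * frob (g x) (g x) + c0 ^+ 2 * frob (trace d v x) (trace d v x))).
  by have := integrableD mQ i1 i2; apply: eq_integrable.
have := ae_le_Rintegral mQ (integrable_scale mQ (2 * d * c0) iB) i12.
rewrite (RintegralD mQ i1 i2) (RintegralZl _ mQ ig.2) (RintegralZl _ mQ iT.2) (RintegralZl _ mQ iB).
move=> /(_ ltac:(by apply: aeW => x _; exact: frob_product_le)).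
rewrite -vE -/G; move: TF.
move: (hessW_form _ _ _ v v) (\int[_]_(x in _) _) => F t TF.
rewrite !expr2 -!mulrA => h.
have h2 : c0 * (c0 * t) <= d * (c0 * F) by rewrite [leRHS]mulrCA ler_pM2l.
rewrite -(ler_pM2l d0); move: h h2.
by move: (d * (c0 * F)) (d * (d * G)) (c0 * (c0 * t)) => X Y Z; lra.
Qed.

Lemma hessW_form0 d : hessW_form W d M (fun=> 0) (fun=> 0) = 0.
Proof.
have oO := @open_Omega R k d; have mO := @measurable_Omega R k d.
have J0 := @is_weak_jac0 R N N (Omega d).
have mJ := mx_measurable_jac (is_weak_jac_weak_jac (is_weak_jac_vec J0)).
transitivity (\int[leb N]_(z in Omega d) (0 : R)); last by rewrite /Rintegral integral0.
apply: (ae_eq_Rintegral mO (measurable_bilinear Bl Br mJ mJ) (measurable_cst _)).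
have := weak_jac_ae oO J0; apply: filterS => z h Oz.
by rewrite (h Oz) (bilinear0l Bl).
Qed.

(** Testing the equation of vphi with its solution. *)
Lemma vphi_energy_bound d (c0 : R) phi : 0 < d -> 0 < c0 ->
  (forall u, calV d u ->
    c0 * \int[leb N]_(z in Omega d) frob (weak_jac (Omega d) u z) (weak_jac (Omega d) u z)
      <= hessW_form W d M u u) ->
  square_integrable (mu := leb k) cubeQ (fun x => gradmx W M *m tgrad phi x) ->
  c0 * hessW_form W d M (vphi W d M phi) (vphi W d M phi) <=
  d * \int[leb k]_(x in cubeQ) frob (gradmx W M *m tgrad phi x) (gradmx W M *m tgrad phi x).
Proof.
move=> d0 c00 coer ig; rewrite /vphi; case: xgetP => [v _ [cv vE]|_].
  exact: (elastic_energy_bound d0 c00 coer cv ig (vE v cv)).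
(* Without a solution the default value is the zero function. *)
rewrite hessW_form0 mulr0; apply: mulr_ge0; first exact: ltW.
by apply: Rintegral_ge0 => x _; exact: frob_ge0.
Qed.

End stability.

Theorem proposition7p3 (R : realType) (k : nat) (k_gt0 : (0 < k)%N)
  (A : 'M[R]_k) (detA_gt0 : 0 < \det A)
  (W : 'M[R]_k.+1 -> R)
  (W_ge0 : forall X, 0 < \det X -> 0 <= W X)
  (W_C3 : Ck 3 [set X | 0 < \det X] W)
  (psi : 'cV[R]_k.+1 -> R)
  (psi_ge0 : forall z, 0 <= psi z)
  (psi_C3 : Ck 3 [set z | z != 0] psi)
  (psi_hom : forall (t : R) z, 0 < t -> psi (t *: z) = t * psi z)
  (psi_growth : exists m M' : R, [/\ 0 < m, 0 < M' &
     forall z, m * enorm z <= psi z <= M' * enorm z])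
  (psi_elliptic : exists2 cbar : R, 0 < cbar &
     forall v w, enorm v = 1 -> w != 0 -> frob v w = 0 ->
       cbar * enorm w ^+ 2 < D2 psi v w w)
  (M : 'M[R]_k.+1)
  (flat : forall d : R, 0 < d -> flat_configuration A W d M) :
  exists2 d0 : R, 0 < d0 &
    forall d : R, 0 < d < d0 ->
    forall phi : 'cV[R]_k -> R, H1per phi ->
      ~ (\forall x \ae leb k, phi x = 0) ->
      0 < second_variation W psi d M phi.
Proof.
have [cbar cbar0 ell] := psi_elliptic.
have [detM _ _ [c0 c00 coer1]] := flat 1 ltr01.
have Bl := D2_linearl detM W_C3; have Br := D2_linearr (@open_det_gt0 R k.+1) detM W_C3.
have [C C0 mulC] := square_integrable_mulmx (gradmx W M).
have C1 : 0 < C + 1 by rewrite ltr_wpDl.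
exists (Num.min 1 (cbar * c0 / (C + 1))).
  by rewrite lt_min ltr01 divr_gt0// mulr_gt0.
move=> d; rewrite lt_min => /and3P[d0 d1 dC] phi hphi phi0.
rewrite ltr_pdivlMr// in dC.
have coer u : calV d u ->
    c0 * \int[leb k.+1]_(z in Omega d) frob (weak_jac (Omega d) u z) (weak_jac (Omega d) u z)
      <= hessW_form W d M u u.
  (* The film of thickness 1 provides the constant for all d < 1. *)
  apply: (coercivity_thin Bl Br d0 (s := 1 - d)); [by rewrite subr_ge0 ltW|exact: ltW|].
  by rewrite (_ : d + (1 - d) = 1)//; ring.
have hloc : H1loc phi by case: hphi.
have [ig gC] := mulC _ (tgrad_square_integrable hloc).
have FG := vphi_energy_bound Bl Br d0 c00 coer ig.
have S := surface_energy_bound psi_C3 ell hloc.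
have G0 : 0 < \int[leb k]_(x in cubeQ) frob (tgrad phi x) (tgrad phi x).
  rewrite lt_def; apply/andP; split; last by apply: Rintegral_ge0 => x _; exact: frob_ge0.
  by apply/eqP => /(zero_gradient hphi).
rewrite /second_variation; move: FG gC S G0.
move: (hessW_form _ _ _ _ _) (\int[_]_(x in _) frob (_ *m _) _) (\int[_]_(x in _) frob (tgrad _ _) _).
move: (\int[_]_(x in _) D2 _ _ _ _) => S F G G0 FG GG0 S0 G00.
rewrite addrC subr_gt0; apply: lt_le_trans S0.
rewrite -(ltr_pM2l c00); apply: (le_lt_trans FG); apply: (@le_lt_trans _ _ (d * (C + 1) * G0)).
  rewrite -mulrA ler_pM2l// (le_trans GG0)// ler_pM2r// lerDl.
  exact: ler01.
by rewrite mulrA (mulrC c0) ltr_pM2r.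
Qed.
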